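(* Let $s<\frac14$ and $T>0$. Consider the massless ($M=0$) Chern-Simons-Dirac system in the Lorenz gauge $$\left\{\begin{array}{l}\Box A_\nu=\partial^\mu(-2\epsilon_{\mu\nu\lambda}\psi^\dagger\alpha^\lambda\psi),\\ -i\alpha^\mu\partial_\mu\psi=A_\mu\alpha^\mu\psi,\\ \psi(0)=\psi_0,\quad A_\mu(0)=a_\mu,\\ \partial_0A_0(0)=-\partial^ja_j,\quad \partial_0A_j(0)=\partial_ja_0-2\epsilon_{0jk}\psi_0^\dagger\alpha^k\psi_0.\end{array}\right.$$ Then the flow map $(a_\nu,\psi_0)\mapsto(A_\nu,\psi)$, which sends initial data to the solution, from $H^s(\mathbb R^2)$ to $C([-T,T];H^s(\mathbb R^2))$ cannot be $C^2$ at the origin.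
   Context: The system is posed on Minkowski space $\mathbb R^{1+2}$ with coordinates $(x^0,x^1,x^2)=(t,x)$ and metric of signature $(+,-,-)$, used to raise and lower indices (so $\partial^0=\partial_0=\partial_t$, $\partial^j=-\partial_j$). The Einstein summation convention is used; Greek indices run over $0,1,2$ and Latin indices over $1,2$. $\Box=\partial^\mu\partial_\mu=\partial_t^2-\Delta$. The unknowns are $A_\mu:\mathbb R^{1+2}\to\mathbb R$ and the spinor $\psi:\mathbb R^{1+2}\to\mathbb C^2$ (column vector); $\psi^\dagger$ is the complex conjugate transpose. $\epsilon_{\mu\nu\lambda}$ is totally skew-symmetric with $\epsilon_{012}=1$. The matrices are $\alpha^0=I_{2\times2}$, $\alpha^1=\begin{pmatrix}0&1\\1&0\end{pmatrix}$, $\alpha^2=\begin{pmatrix}0&-i\\ i&0\end{pmatrix}$. $H^s(\mathbb R^2)$ is the inhomogeneous $L^2$-based Sobolev space (norm equivalent to $\|(1+|\xi|)^s\widehat f\|_{L^2_\xi}$); the data space is the product of copies of $H^s$ for $a_0,a_1,a_2$ and the components of $\psi_0$, and likewise for the target. Integral formulation used for solutions: let $D=|\nabla|$ (Fourier symbol $|\xi|$), $\Pi_\pm(\xi)=\frac12\big(I_{2\times2}\pm\frac{\xi_j\alpha^j}{|\xi|}\big)$ (Fourier multiplier), $R^0_\pm=-1$, $R^j_\pm=\mp\frac{\partial_j}{iD}$. Then $\psi=\psi_++\psi_-$, $\psi_\pm=\Pi_\pm\psi$, $A_\nu=A_{\nu,+}+A_{\nu,-}$, and $$\psi_\pm(t)=e^{\mp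 itD}\Pi_\pm\psi_0+i\int_0^te^{\mp i(t-t')D}\Pi_\pm(A_\mu\alpha^\mu\psi)(t')\,dt',$$ $$A_{\nu,\pm}(t)=A^{\rm hom}_{\nu,\pm}(t)-\frac12\int_0^te^{\mp i(t-t')D}R^\mu_\pm(-2\epsilon_{\mu\nu\lambda}\psi^\dagger\alpha^\lambda\psi)(t')\,dt',$$ with $A^{\rm hom}_{0,\pm}(t)=\frac12e^{\mp itD}\big(a_0\pm\frac{\partial^j}{iD}a_j\big)$ and $A^{\rm hom}_{j,\pm}(t)=\frac12e^{\mp itD}\big(a_j\mp\frac{\partial_j}{iD}a_0\big)$. *)

(* Defs.v *)
From HB Require Import structures.
From mathcomp Require Import all_boot all_order all_algebra.
From mathcomp Require Import ring.
From mathcomp Require Import all_classical all_reals all_analysis.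
From mathcomp.real_closed Require Import complex.

Set Implicit Arguments.
Unset Strict Implicit.
Unset Printing Implicit Defensive.

Import Order.TTheory GRing.Theory Num.Theory.
Import numFieldNormedType.Exports.

Local Open Scope classical_set_scope.
Local Open Scope ring_scope.
Local Open Scope complex_scope.

(* Maps that are C^2 at 0, between real (semi)normed spaces.  A space is a     *)
(* real subspace D of a module over R[i], with an extended-real seminorm that  *)
(* is finite on D.  Elements at distance 0 are identified, so linearity of the *)
(* derivatives is only required up to seminorm 0.  Differentiability is over   *)
(* the reals: psi^dagger alpha psi is not complex differentiable.              *)
Section C2.
Context (R : realType) (X Y : lmodType R[i]).
Variables (DX : set X) (nX : X -> \bar R) (DY : set Y) (nY : Y -> \bar R).

Definition real_linear (L : X -> Y) : Prop :=
  (forall h, DX h -> DY (L h)) /\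
  (forall (a : R) (h k : X), DX h -> DX k ->
     nY (L (a%:C *: h + k) - (a%:C *: L h + L k)) = 0%E).

Definition bounded_linear (L : X -> Y) : Prop :=
  real_linear L /\
  exists M : R, forall h, DX h -> (nY (L h) <= M%:E * nX h)%E.

Definition bounded_bilinear (B : X -> X -> Y) : Prop :=
  (forall h, DX h -> real_linear (B h)) /\
  (forall k, DX k -> real_linear (B ^~ k)) /\
  exists M : R, forall h k, DX h -> DX k ->
    (nY (B h k) <= M%:E * nX h * nX k)%E.

Definition frechet_derivative (Phi : X -> Y) (x : X) (L : X -> Y) : Prop :=
  bounded_linear L /\
  forall e : R, 0 < e -> exists2 d : R, 0 < d &
    forall h, DX h -> (nX h < d%:E)%E ->
      (nY (Phi (x + h)%R - Phi x - L h)%R <= e%:E * nX h)%E.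

Definition frechet_derivative2 (D1 : X -> X -> Y) (x : X) (B : X -> X -> Y)
    : Prop :=
  bounded_bilinear B /\
  forall e : R, 0 < e -> exists2 d : R, 0 < d &
    forall h, DX h -> (nX h < d%:E)%E -> forall k, DX k ->
      (nY (D1 (x + h)%R k - D1 x k - B h k)%R <= e%:E * nX h * nX k)%E.

(* Twice Frechet differentiable near 0, with second derivative continuous     *)
(* (in operator norm) at 0.                                                    *)
Definition C2_at0 (Phi : X -> Y) : Prop :=
  exists (r : R) (D1 : X -> X -> Y) (D2 : X -> X -> X -> Y),
    [/\ 0 < r,
        forall x, DX x -> (nX x < r%:E)%E -> frechet_derivative Phi x (D1 x),
        forall x, DX x -> (nX x < r%:E)%E -> frechet_derivative2 D1 x (D2 x) &
        forall e : R, 0 < e -> exists2 d : R, 0 < d &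
          forall x, DX x -> (nX x < d%:E)%E -> forall h k, DX h -> DX k ->
            (nY (D2 x h k - D2 0 h k)%R <= e%:E * nX h * nX k)%E].

End C2.

Section CSD.
Context (R : realType).
Local Notation C := R[i].

Definition leb2 := (@lebesgue_measure R \x @lebesgue_measure R)%E.

(* The norm `|xi| of the library on R * R is the maximum norm. *)
Definition enorm (xi : R * R) : R := Num.sqrt (xi.1 ^+ 2 + xi.2 ^+ 2).

Definition crd (xi : R * R) (j : 'I_2) : R := if j == ord0 then xi.1 else xi.2.

Definition Ci : C := 0 +i* 1.

Definition cis (theta : R) : C := cos theta +i* sin theta.

Definition measurableC (f : R * R -> C) : Prop :=
  measurable_fun setT (fun x => complex.Re (f x)) /\
  measurable_fun setT (fun x => complex.Im (f x)).

Definition Cint2 (f : R * R -> C) : C :=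
  Rintegral leb2 setT (fun x => complex.Re (f x))
  +i* Rintegral leb2 setT (fun x => complex.Im (f x)).

(* Oriented integral from 0 to t. *)
Definition Rint0 (t : R) (f : R -> R) : R :=
  if 0 <= t then Rintegral lebesgue_measure `[0, t] f
  else - Rintegral lebesgue_measure `[t, 0] f.

Definition Cint0 (t : R) (f : R -> C) : C :=
  Rint0 t (fun t' => complex.Re (f t'))
  +i* Rint0 t (fun t' => complex.Im (f t')).

Definition dot2 (x xi : R * R) : R := x.1 * xi.1 + x.2 * xi.2.

Definition fourier (f : R * R -> C) (xi : R * R) : C :=
  Cint2 (fun x => cis (- dot2 x xi) * f x).

Definition inv_fourier (g : R * R -> C) (x : R * R) : C :=
  (((2 * pi) ^+ 2)^-1)%:C * Cint2 (fun xi => cis (dot2 x xi) * g xi).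

(* An element of H^s(R^2) is represented by its Fourier transform, a           *)
(* measurable function up to a.e. equality; this covers distributions (s < 0). *)
Definition Hs_norm (s : R) (g : R * R -> C) : \bar R :=
  Lnorm leb2 2%:E (fun xi => ((1 + enorm xi) `^ s * Normc.normc (g xi))%:E).

Definition Hs (s : R) (g : R * R -> C) : Prop :=
  measurableC g /\ (Hs_norm s g < +oo)%E.

(* The Fourier transforms of real-valued distributions. *)
Definition hermitian_sym (g : R * R -> C) : Prop :=
  {ae leb2, forall xi, g (- xi) = conjc (g xi)}.

(* The Fourier transforms of (A_0, A_1, A_2) and of the spinor psi. *)
Definition state := (('I_3 -> R * R -> C) * (R * R -> 'cV[C]_2))%type.

Definition component (psi : R * R -> 'cV[C]_2) (k : 'I_2) : R * R -> C :=
  fun x => psi x k ord0.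

Definition state_norm (s : R) (u : state) : \bar R :=
  (\sum_(nu < 3) Hs_norm s (u.1 nu)
   + \sum_(k < 2) Hs_norm s (component u.2 k))%E.

Definition state_Hs (s : R) : set state :=
  [set u | (forall nu, Hs s (u.1 nu) /\ hermitian_sym (u.1 nu)) /\
           (forall k, Hs s (component u.2 k))].

(* C([-T, T]; H^s) and its norm; values at times outside [-T, T] are junk. *)
Definition CT (s T : R) : set (R -> state) :=
  [set u | forall t0, t0 \in `[- T, T] -> state_Hs s (u t0) /\
     (state_norm s (u t - u t0) @[t --> within `[- T, T] (nbhs t0)] --> 0%E)].

Definition CT_norm (s T : R) (u : R -> state) : \bar R :=
  ereal_sup [set state_norm s (u t) | t in `[- T, T]].

Definition alpha (mu : 'I_3) : 'M[C]_2 :=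
  \matrix_(k < 2, l < 2)
    match val mu with
    | 0%N => (k == l)%:R
    | 1%N => (k != l)%:R
    | _ => if k == l then 0 else if k == ord0 then - Ci else Ci
    end.

(* Totally antisymmetric, with eps 0 1 2 = 1: see epsC12, epsC23, eps012. *)
Definition eps (mu nu la : 'I_3) : R :=
  ((nu : nat)%:R - (mu : nat)%:R) * ((la : nat)%:R - (mu : nat)%:R) *
  ((la : nat)%:R - (nu : nat)%:R) / 2.

Lemma epsC12 (mu nu la : 'I_3) : eps nu mu la = - eps mu nu la.
Proof. by rewrite /eps; ring. Qed.

Lemma epsC23 (mu nu la : 'I_3) : eps mu la nu = - eps mu nu la.
Proof. by rewrite /eps; ring. Qed.

Lemma eps012 : eps (inord 0) (inord 1) (inord 2) = 1.
Proof. by rewrite /eps !inordK// !subr0 mul1r (_ : 2 - 1 = 1)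
  ?mulr1 ?divff//; ring. Qed.

(* The index j of R^2 as an index of R^{1+2}. *)
Definition spatial (j : 'I_2) : 'I_3 := lift ord0 j.

(* Products are taken in physical space, pointwise in x. *)
Definition physA (u : state) (mu : 'I_3) : R * R -> C := inv_fourier (u.1 mu).

Definition physpsi (u : state) (x : R * R) : 'cV[C]_2 :=
  \col_k inv_fourier (component u.2 k) x.

(* -2 eps_{mu nu la} psi^dagger alpha^la psi *)
Definition current (u : state) (mu nu : 'I_3) (x : R * R) : C :=
  - 2 * \sum_(la < 3) (eps mu nu la)%:C *
    ((map_mx conjc (physpsi u x))^T *m alpha la *m physpsi u x) ord0 ord0.

(* A_mu alpha^mu psi *)
Definition dirac_source (u : state) (x : R * R) : 'cV[C]_2 :=
  \sum_(mu < 3) physA u mu x *: (alpha mu *m physpsi u x).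

Definition fourier_spinor (f : R * R -> 'cV[C]_2) (xi : R * R) : 'cV[C]_2 :=
  \col_k fourier (component f k) xi.

(* Below, the sign +/- is a boolean: sg false = 1 and sg true = -1. *)
Definition sg (b : bool) : R := (-1) ^+ b.

(* Symbol of exp(-/+ i t D). *)
Definition half_wave (b : bool) (t : R) (xi : R * R) : C :=
  cis (- (sg b * t * enorm xi)).

(* Symbol of d_j / (i D); it is 0 at xi = 0. *)
Definition riesz (j : 'I_2) (xi : R * R) : R := crd xi j / enorm xi.

Definition Pi_ (b : bool) (xi : R * R) : 'M[C]_2 :=
  2^-1 *: (1%:M + (sg b)%:C *:
             \sum_(j < 2) (riesz j xi)%:C *: alpha (spatial j)).

Definition R_ (b : bool) (mu : 'I_3) (xi : R * R) : R :=
  match unlift ord0 mu with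
  | None => - 1
  | Some j => - (sg b * riesz j xi)
  end.

(* In A_0 the derivative d^j = - d_j has a raised index. *)
Definition A_hom (b : bool) (a : 'I_3 -> R * R -> C) (t : R) (nu : 'I_3)
    (xi : R * R) : C :=
  2^-1 * half_wave b t xi *
  match unlift ord0 nu with
  | None => a ord0 xi
            + (sg b)%:C * \sum_(j < 2) (- riesz j xi)%:C * a (spatial j) xi
  | Some j => a (spatial j) xi - (sg b * riesz j xi)%:C * a ord0 xi
  end.

Definition A_rhs (b : bool) (f : state) (u : R -> state) (t : R) (nu : 'I_3)
    (xi : R * R) : C :=
  A_hom b f.1 t nu xi
  - 2^-1 * Cint0 t (fun t' => half_wave b (t - t') xi *
      \sum_(mu < 3) (R_ b mu xi)%:C * fourier (current (u t') mu nu) xi).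

Definition psi_rhs (b : bool) (f : state) (u : R -> state) (t : R)
    (xi : R * R) : 'cV[C]_2 :=
  half_wave b t xi *: (Pi_ b xi *m f.2 xi)
  + Ci *: \col_k Cint0 t (fun t' =>
      (half_wave b (t - t') xi *:
         (Pi_ b xi *m fourier_spinor (dirac_source (u t')) xi)) k ord0).

(* A solution in C([-T, T]; H^sigma) for all sigma, with initial data f, of    *)
(* the integral formulation.  The halves psi_+/- and A_{nu,+/-} are the        *)
(* summands, and the initial conditions are the case t = 0.                    *)
Definition smooth_solution (T : R) (f : state) (u : R -> state) : Prop :=
  (forall sigma : R, CT sigma T u) /\
  forall t, t \in `[- T, T] -> {ae leb2, forall xi,
    (forall nu, (u t).1 nu xi = A_rhs false f u t nu xi
                                + A_rhs true f u t nu xi) /\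
    (u t).2 xi = psi_rhs false f u t xi + psi_rhs true f u t xi}.

(* Phi is defined on the ball of radius r of the data space, takes values in   *)
(* C([-T, T]; H^s), and sends data to the solution.  For rough data, and       *)
(* certainly for s < 0, the nonlinear terms need not make sense, so the only   *)
(* constraint is that Phi f is the smooth solution whenever there is one.  A   *)
(* solution map for another notion of solution satisfies it by uniqueness.     *)
Definition flow_map (s T r : R) (Phi : state -> R -> state) : Prop :=
  forall f, state_Hs s f -> (state_norm s f < r%:E)%E ->
    CT s T (Phi f) /\
    forall u, smooth_solution T f u -> CT_norm s T (Phi f - u) = 0%E.

End CSD.

(* Main.v *)
From HB Require Import structures.
Require Import Defs.
From mathcomp Require Import all_boot all_order all_algebra.
From mathcomp Require Import ring lra.
From mathcomp Require Import all_classical all_reals all_analysis.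
From mathcomp Require Import measurable_realfun.
From mathcomp.real_closed Require Import complex.

(** If the flow map were C^2 at the origin, its second derivative there would
    be a bounded bilinear map, so the part of the solution that is quadratic in
    the data [f] would be at most a constant times [|f|_s ^ 2], the constant
    being independent of [f] ([taylor_line], [quadratic_bound]).  For data
    [a_nu = 0], [psi_0 = tau f], the quadratic part is the first step of the
    Picard iteration: to first order in [tau], [psi] is the free wave, and to
    second order [A_0] is the Duhamel integral of the current of this free wave
    ([small_solutions]).  The theorem follows from a family of data for which
    this integral is too large.

    The data are a wave of positive energy ([Pi_pol]) supported in two boxes of
    frequency space, of dimensions about [N] by [sqrt N], next to the points
    [(N, 0)] and [(2 N, 0)] ([box1], [box2]); below, [N = m ^ 2].  The potential
    [A_0] is tested on a third box [boxX] next to [(N, 0)], where only the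
    interaction of one box of the data with the other contributes
    ([chi_chi]).  All the frequencies involved are nearly parallel, with angles
    of order [N ^ (-1/2)] ([box_geometry]).  Hence the phase
    [|xi| + |eta| - |xi + eta|] of one half wave of [A_0] stays bounded, and the
    interaction is coherent on a short time interval independent of [N]
    ([Re_osc_ge]); the phase of the other half wave is at least [N], so that it
    contributes little ([n1_osc_le]).  The null form [qform] of the system gains
    no more than the angle.  So [A_0] is at least of order
    [N ^ (-1/2) * N ^ (3/2) = N] on [boxX] ([Amap_data_ge]), and its pairing
    with the indicator of this box, corrected by a phase, is at least of order
    [N ^ (5/2)] ([quad_coef_ge]).  On the other hand, the dual norm of the
    indicator is of order [N ^ (3/4 - s)] and the norm of the data of order
    [N ^ (3/4 + s)].  The C^2 bound thus says that
    [N ^ (5/2) <= C N ^ (3/4 - s) (N ^ (3/4 + s)) ^ 2], that is, that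
    [N ^ (1/4 - s)] is bounded ([growth]), which fails for [s < 1/4].

    The flow map is tied to the system only through its smooth solutions, so
    these have to be constructed for the data [tau f] with [tau] small.
    On the Fourier side, the weight [wt] decays exponentially and satisfies
    [wt * wt <= cw wt] for the convolution ([wt_conv]).  In the corresponding
    weighted sup norm the nonlinearity is a cubic map, and Picard iteration
    gives solutions on the whole of [[-T, T]] for small data ([picard],
    [smooth_solution_exists]), which lie in every Sobolev space ([Hs_norm_wt]).
    How small [tau] has to be depends on [N]; this is harmless, because a C^2
    map is expanded at the origin for each [N] separately.  The products in the
    system are taken in physical space; at every frequency their Fourier
    transforms are convolutions ([fourier_inv_fourier_mul]), provided that one
    factor is continuous off a null set.  The set [Z] of possible
    discontinuities is carried along for this reason. *)

Set Implicit Arguments.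
Unset Strict Implicit.
Unset Printing Implicit Defensive.
Import Order.TTheory GRing.Theory Num.Theory.
Import numFieldNormedType.Exports.
Local Open Scope classical_set_scope.
Local Open Scope ring_scope.
Local Open Scope complex_scope.

(** * Complex numbers by coordinates *)
Section ComplexModulus.
Context {R : realType}.
Local Notation C := R[i].
Local Notation Re := (@complex.Re R).
Local Notation Im := (@complex.Im R).

(** A norm equivalent to the modulus that turns an estimate into one for each
    coordinate. *)
Definition n1 (z : C) : R := `|Re z| + `|Im z|.

Lemma cReD (z w : C) : Re (z + w) = Re z + Re w.
Proof. by case: z w => [? ?] [? ?]. Qed.
Lemma cImD (z w : C) : Im (z + w) = Im z + Im w.
Proof. by case: z w => [? ?] [? ?]. Qed.
Lemma cReN (z : C) : Re (- z) = - Re z. Proof. by case: z. Qed.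
Lemma cImN (z : C) : Im (- z) = - Im z. Proof. by case: z. Qed.
Lemma cReM (z w : C) : Re (z * w) = Re z * Re w - Im z * Im w.
Proof. by case: z w => [? ?] [? ?]. Qed.
Lemma cImM (z w : C) : Im (z * w) = Re z * Im w + Im z * Re w.
Proof. by case: z w => [? ?] [? ?]. Qed.
Lemma cReJ (z : C) : Re (conjc z) = Re z. Proof. by case: z. Qed.
Lemma cImJ (z : C) : Im (conjc z) = - Im z. Proof. by case: z. Qed.
Lemma cReR (x : R) : Re x%:C = x. Proof. by []. Qed.
Lemma cImR (x : R) : Im x%:C = 0. Proof. by []. Qed.
Lemma cReCi : Re (Ci R) = 0. Proof. by []. Qed.
Lemma cImCi : Im (Ci R) = 1. Proof. by []. Qed.
Lemma cRecis x : Re (cis x) = cos x. Proof. by []. Qed.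
Lemma cImcis x : Im (cis x) = sin x. Proof. by []. Qed.
Lemma cRe0 : Re 0 = 0. Proof. by []. Qed.
Lemma cIm0 : Im 0 = 0. Proof. by []. Qed.
Lemma cRe1 : Re 1 = 1. Proof. by []. Qed.
Lemma cIm1 : Im 1 = 0. Proof. by []. Qed.
Definition ReImE := (cReD, cImD, cReN, cImN, cReM, cImM, cReJ, cImJ, cReR, cImR, cReCi,
  cImCi, cRecis, cImcis, cRe0, cIm0, cRe1, cIm1).

Lemma C_ext (z w : C) : Re z = Re w -> Im z = Im w -> z = w.
Proof. by case: z w => [? ?] [? ?] /= -> ->. Qed.

Lemma n1_ge0 z : 0 <= n1 z. Proof. by rewrite addr_ge0. Qed.
Lemma n1_0 : n1 0 = 0. Proof. by rewrite /n1 /= normr0 addr0. Qed.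
Lemma n1N z : n1 (- z) = n1 z. Proof. by rewrite /n1 !ReImE !normrN. Qed.
Lemma n1J z : n1 (conjc z) = n1 z. Proof. by rewrite /n1 !ReImE normrN. Qed.
Lemma n1R x : n1 x%:C = `|x|. Proof. by rewrite /n1 /= normr0 addr0. Qed.
Lemma n1D z w : n1 (z + w) <= n1 z + n1 w.
Proof. by rewrite /n1 !ReImE addrACA lerD// ler_normD. Qed.
Lemma n1B z w : n1 (z - w) <= n1 z + n1 w.
Proof. by rewrite -(n1N w) n1D. Qed.
Lemma n1BC z w : n1 (z - w) = n1 (w - z).
Proof. by rewrite -n1N opprB. Qed.
Lemma n1M z w : n1 (z * w) <= n1 z * n1 w.
Proof.
rewrite /n1 !ReImE; apply: (le_trans (lerD (ler_normB _ _) (ler_normD _ _))).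
by rewrite !normrM; lra.
Qed.
Lemma Re_n1 z : `|Re z| <= n1 z. Proof. by rewrite lerDl. Qed.
Lemma Im_n1 z : `|Im z| <= n1 z. Proof. by rewrite lerDr. Qed.
Lemma normc_le_n1 z : Normc.normc z <= n1 z.
Proof.
case: z => a b; rewrite /n1 /= -[leRHS]ger0_norm ?addr_ge0// -sqrtr_sqr.
rewrite ler_sqrt ?sqr_ge0// sqrrD !real_normK ?num_real//.
by rewrite addrAC lerDl mulrn_wge0// mulr_ge0.
Qed.
Lemma Re_normc z : `|Re z| <= Normc.normc z.
Proof.
by case: z => a b /=; rewrite -sqrtr_sqr ler_sqrt ?lerDl ?addr_ge0 ?sqr_ge0.
Qed.
Lemma n1_cis (x : R) : n1 (cis x) <= 2.
Proof.
by rewrite /n1 /= (_ : 2 = 1 + 1)// lerD// ler_norml ?cos_geN1 ?cos_le1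
  ?sin_geN1 ?sin_le1.
Qed.
Lemma cisD (x y : R) : cis (x + y) = cis x * cis y.
Proof. by apply: C_ext; rewrite !ReImE /= ?cosD ?sinD; ring. Qed.
Lemma cisN (x : R) : cis (- x) = conjc (cis x).
Proof. by apply: C_ext; rewrite /= ?cosN ?sinN. Qed.
Lemma cis0 : cis (0 : R) = 1. Proof. by apply: C_ext; rewrite /= ?cos0 ?sin0. Qed.

Lemma cJM (z w : C) : conjc (z * w) = conjc z * conjc w.
Proof. by apply: C_ext; rewrite !ReImE; ring. Qed.
Lemma rcM (x y : R) : (x * y)%:C = x%:C * y%:C.
Proof. by apply: C_ext; rewrite !ReImE; ring. Qed.
Lemma rcD (x y : R) : (x + y)%:C = x%:C + y%:C.
Proof. by apply: C_ext; rewrite !ReImE; ring. Qed.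

Definition ccvg (z : nat -> C) (l : C) :=
  ((fun n => Re (z n)) @ \oo --> Re l) /\ ((fun n => Im (z n)) @ \oo --> Im l).

Lemma ccvg_cst (l : C) : ccvg (fun=> l) l.
Proof. by split; exact: cvg_cst. Qed.
Lemma ccvgD z w a b : ccvg z a -> ccvg w b -> ccvg (fun n => z n + w n) (a + b).
Proof.
by move=> [h1 h2] [h3 h4]; split; under eq_fun do rewrite ReImE;
  rewrite ReImE; apply: cvgD.
Qed.
Lemma ccvgN z a : ccvg z a -> ccvg (fun n => - z n) (- a).
Proof.
by move=> [h1 h2]; split; under eq_fun do rewrite ReImE; rewrite ReImE; apply: cvgN.
Qed.
Lemma ccvgB z w a b : ccvg z a -> ccvg w b -> ccvg (fun n => z n - w n) (a - b).
Proof. by move=> h1 h2; apply: ccvgD => //; exact: ccvgN. Qed.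
Lemma ccvgM z w a b : ccvg z a -> ccvg w b -> ccvg (fun n => z n * w n) (a * b).
Proof.
move=> [h1 h2] [h3 h4]; split; under eq_fun do rewrite ReImE; rewrite ReImE.
  by apply: cvgB; exact: cvgM.
by apply: cvgD; exact: cvgM.
Qed.
Lemma ccvgJ z a : ccvg z a -> ccvg (fun n => conjc (z n)) (conjc a).
Proof.
move=> [h1 h2]; split; under eq_fun do rewrite ReImE; rewrite ReImE//.
exact: cvgN.
Qed.
Lemma ccvgR (x : nat -> R) (a : R) : x @ \oo --> a -> ccvg (fun n => (x n)%:C) a%:C.
Proof. by move=> h; split => //=; exact: cvg_cst. Qed.
Lemma ccvg_cis (x : nat -> R) (a : R) : x @ \oo --> a -> ccvg (fun n => cis (x n)) (cis a).
Proof.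
by move=> h; split; apply: continuous_cvg => //; [exact: continuous_cos|exact: continuous_sin].
Qed.
Lemma ccvg_n1 (z : nat -> C) l :
  ccvg z l <-> (fun n => n1 (z n - l)) @ \oo --> (0 : R).
Proof.
split=> [[h1 h2]|h].
  rewrite -[0]addr0; under eq_fun do rewrite /n1 !ReImE.
  by apply: cvgD; apply/norm_cvg0P/subr_cvg0.
split; apply/subr_cvg0/norm_cvg0P; apply: (squeeze_cvgr _ (cvg_cst 0) h) => //.
  by apply: nearW => n; rewrite normr_ge0 -cReN -cReD Re_n1.
by apply: nearW => n; rewrite normr_ge0 -cImN -cImD Im_n1.
Qed.
Lemma ccvg_squeeze (z : nat -> C) l (e : nat -> R) :
  (forall n, n1 (z n - l) <= e n) -> e @ \oo --> (0 : R) -> ccvg z l.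
Proof.
move=> h he; apply/ccvg_n1; apply: (squeeze_cvgr _ (cvg_cst 0) he) => //.
by apply: nearW => n; rewrite n1_ge0/=.
Qed.
Lemma ccvg_le (z : nat -> C) l (b : R) : ccvg z l -> (forall n, n1 (z n) <= b) ->
  n1 l <= b.
Proof.
move=> /ccvg_n1 h hb; rewrite -subr_le0; apply: (cvgr_to_ge h).
apply: nearW => n; rewrite n1BC lerBlDr (le_trans _ (lerD (lexx _) (hb n)))//.
by rewrite -[X in n1 X <= _](subrK (z n)) n1D.
Qed.
Lemma ccvg_unique (z : nat -> C) l l' : ccvg z l -> ccvg z l' -> l = l'.
Proof.
move=> [h1 h2] [h3 h4]; apply: C_ext.
  exact: (cvg_unique (@Rhausdorff R) h1 h3).
exact: (cvg_unique (@Rhausdorff R) h2 h4).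
Qed.

End ComplexModulus.

(** * Integrals of complex functions *)
Section ComplexIntegral.
Context {R : realType} d {T : measurableType d}.
Local Notation C := R[i].
Local Notation Re := (@complex.Re R).
Local Notation Im := (@complex.Im R).

(** In names, the letters m, i, r and C stand for measurable, integrable, real
    valued and complex valued. *)
Definition mC (f : T -> C) :=
  measurable_fun setT (fun x => Re (f x)) /\ measurable_fun setT (fun x => Im (f x)).

Lemma mC_cst c : mC (fun=> c). Proof. by split. Qed.
Lemma mCD f g : mC f -> mC g -> mC (fun x => f x + g x).
Proof.
by move=> [? ?] [? ?]; split; under eq_fun do rewrite ReImE; apply: measurable_funD.
Qed.
Lemma mCM f g : mC f -> mC g -> mC (fun x => f x * g x).
Proof.
move=> [? ?] [? ?]; split; under eq_fun do rewrite ReImE.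
  by apply: measurable_funB; apply: measurable_funM.
by apply: measurable_funD; apply: measurable_funM.
Qed.
Lemma mCN f : mC f -> mC (fun x => - f x).
Proof.
by move=> [? ?]; split; under eq_fun do rewrite ReImE; apply: measurable_funN.
Qed.
Lemma mCB f g : mC f -> mC g -> mC (fun x => f x - g x).
Proof. by move=> hf hg; apply: mCD => //; exact: mCN. Qed.
Lemma mCJ f : mC f -> mC (fun x => conjc (f x)).
Proof.
move=> [h1 h2]; split; first by under eq_fun do rewrite cReJ.
by under eq_fun do rewrite cImJ; exact: measurable_funN.
Qed.
Lemma mCR (g : T -> R) : measurable_fun setT g -> mC (fun x => (g x)%:C).
Proof. by move=> ?; split. Qed.
Lemma mC_cis (g : T -> R) : measurable_fun setT g -> mC (fun x => cis (g x)).
Proof.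
move=> mg; split => /=; apply: measurableT_comp => //; apply: continuous_measurable_fun.
  exact: continuous_cos.
exact: continuous_sin.
Qed.
Lemma mC_lim (f_ : nat -> T -> C) f : (forall n, mC (f_ n)) ->
  (forall x, ccvg (f_ ^~ x) (f x)) -> mC f.
Proof.
move=> mf h; split.
  apply: (@measurable_fun_cvg _ _ _ setT (fun n x => Re (f_ n x)) (fun x => Re (f x))).
    by move=> n; have [] := mf n.
  by move=> x _; have [] := h x.
apply: (@measurable_fun_cvg _ _ _ setT (fun n x => Im (f_ n x)) (fun x => Im (f x))).
  by move=> n; have [] := mf n.
by move=> x _; have [] := h x.
Qed.

Variable mu : {measure set T -> \bar R}.

Definition rI (g : T -> R) := mu.-integrable setT (fun x => (g x)%:E).
Definition iC (f : T -> C) := rI (fun x => Re (f x)) /\ rI (fun x => Im (f x)).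
Definition cint (f : T -> C) : C :=
  Rintegral mu setT (fun x => Re (f x)) +i* Rintegral mu setT (fun x => Im (f x)).

Lemma rI_m g : rI g -> measurable_fun setT g.
Proof. by move=> /(measurable_int mu)/measurable_EFinP. Qed.
Lemma rI_le (f g : T -> R) : measurable_fun setT f -> rI g -> (forall x, `|f x| <= g x) -> rI f.
Proof.
move=> mf ig h; apply: (le_integrable measurableT _ _ ig); first exact/measurable_EFinP.
by move=> x _ /=; rewrite lee_fin (le_trans (h x))// ler_norm.
Qed.
Lemma rID f g : rI f -> rI g -> rI (fun x => f x + g x).
Proof. by move=> hf hg; exact: (integrableD measurableT hf hg). Qed.
Lemma rIZ k f : rI f -> rI (fun x => k * f x).
Proof. by move=> hf; exact: (integrableZl measurableT k hf). Qed.
Lemma rI_abs f : rI f -> rI (fun x => `|f x|).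
Proof. by move=> hf; exact: (integrable_norm hf). Qed.
Lemma rI0 : rI (fun=> 0). Proof. exact: integrable0. Qed.

Lemma iC_m f : iC f -> mC f.
Proof. by move=> [/rI_m ? /rI_m ?]. Qed.
Lemma iC_le f g : mC f -> rI g -> (forall x, n1 (f x) <= g x) -> iC f.
Proof.
move=> [mf1 mf2] ig h; split; apply: rI_le ig _ => // x; apply: le_trans (h x).
  exact: Re_n1.
exact: Im_n1.
Qed.
Lemma iC_n1 f : iC f -> rI (fun x => n1 (f x)).
Proof. by move=> [h1 h2]; apply: rID; exact: rI_abs. Qed.
Lemma iCD f g : iC f -> iC g -> iC (fun x => f x + g x).
Proof.
by move=> [? ?] [? ?]; split; rewrite /rI; under eq_fun do rewrite ReImE; exact: rID.
Qed.
Lemma iCZ k f : iC f -> iC (fun x => k * f x).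
Proof.
move=> h; apply: (@iC_le _ (fun x => n1 k * n1 (f x))).
- by apply: mCM; [exact: mC_cst|exact: iC_m].
- by apply: rIZ; exact: iC_n1.
- by move=> x; exact: n1M.
Qed.
Lemma iC_sum (I : Type) (r : seq I) (f : I -> T -> C) : (forall i, iC (f i)) ->
  iC (fun x => \sum_(i <- r) f i x).
Proof.
move=> h; elim: r => [|i r ih].
  by under eq_fun do rewrite big_nil; split; exact: rI0.
by under eq_fun do rewrite big_cons; exact: iCD.
Qed.

Lemma Re_cint f : Re (cint f) = Rintegral mu setT (fun x => Re (f x)).
Proof. by []. Qed.
Lemma Im_cint f : Im (cint f) = Rintegral mu setT (fun x => Im (f x)).
Proof. by []. Qed.
Lemma eq_cint f g : f =1 g -> cint f = cint g.
Proof. by move=> /funext ->. Qed.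
Lemma cintD f g : iC f -> iC g -> cint (fun x => f x + g x) = cint f + cint g.
Proof.
move=> [? ?] [? ?]; apply: C_ext; rewrite !ReImE /cint /= -RintegralD//.
  by apply: eq_Rintegral => x _; rewrite ReImE.
by apply: eq_Rintegral => x _; rewrite ReImE.
Qed.
Lemma cintZ (k : C) f : iC f -> cint (fun x => k * f x) = k * cint f.
Proof.
move=> [h1 h2]; apply: C_ext.
  rewrite Re_cint [RHS]cReM Re_cint Im_cint -!RintegralZl// -RintegralB//; [|exact: rIZ..].
  by apply: eq_Rintegral => x _; rewrite ReImE.
rewrite Im_cint [RHS]cImM Re_cint Im_cint -!RintegralZl// -RintegralD//; [|exact: rIZ..].
by apply: eq_Rintegral => x _; rewrite ReImE.
Qed.
Lemma cintB f g : iC f -> iC g -> cint (fun x => f x - g x) = cint f - cint g.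
Proof.
move=> hf hg; rewrite -[- cint g]mulN1r -cintZ// -cintD//; last exact: iCZ.
by apply: eq_cint => x; rewrite mulN1r.
Qed.
Lemma cint0 : cint (fun=> 0) = 0.
Proof.
have h : iC (fun=> 0) by split; exact: rI0.
by rewrite -[RHS](mul0r (cint (fun=> 0))) -cintZ//; apply: eq_cint => x; rewrite mul0r.
Qed.
Lemma cint_sum (I : Type) (r : seq I) (f : I -> T -> C) : (forall i, iC (f i)) ->
  cint (fun x => \sum_(i <- r) f i x) = \sum_(i <- r) cint (f i).
Proof.
move=> h; elim: r => [|i r ih].
  by under eq_fun do rewrite big_nil; rewrite big_nil cint0.
under eq_fun do rewrite big_cons; rewrite big_cons cintD// ?ih//; exact: iC_sum.
Qed.
Lemma cintJ f : iC f -> cint (fun x => conjc (f x)) = conjc (cint f).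
Proof.
move=> [h1 h2]; apply: C_ext; rewrite !ReImE /cint /=.
  by apply: eq_Rintegral => x _; rewrite ReImE.
rewrite -mulN1r -RintegralZl//; apply: eq_Rintegral => x _; rewrite ReImE mulN1r//.
Qed.
Lemma n1_cint_le f g : iC f -> rI g -> (forall x, n1 (f x) <= g x) ->
  n1 (cint f) <= Rintegral mu setT g.
Proof.
move=> [h1 h2] hg h; rewrite /n1 /cint /=.
apply: (le_trans (lerD (le_normr_Rintegral measurableT h1)
                       (le_normr_Rintegral measurableT h2))).
rewrite -RintegralD//; [|exact: rI_abs..].
have hs := rID (rI_abs h1) (rI_abs h2).
by apply: (le_Rintegral measurableT hs hg) => x _; exact: h.
Qed.
Lemma aeS (P Q : T -> Prop) : {ae mu, forall x, P x} -> (forall x, P x -> Q x) ->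
  {ae mu, forall x, Q x}.
Proof. by move=> h hPQ; exact: filterS h. Qed.
(** Dominated convergence, by coordinates. *)
Lemma cint_dct (f_ : nat -> T -> C) f g : (forall n, mC (f_ n)) -> mC f ->
  {ae mu, forall x, ccvg (f_ ^~ x) (f x)} -> rI g ->
  (forall n x, n1 (f_ n x) <= g x) -> ccvg (fun n => cint (f_ n)) (cint f).
Proof.
move=> mf_ mf hcv ig h.
have key (p : C -> R) : (forall n, measurable_fun setT (fun x => p (f_ n x))) ->
    measurable_fun setT (fun x => p (f x)) -> (forall z, `|p z| <= n1 z) ->
    {ae mu, forall x, (fun n => p (f_ n x)) @ \oo --> p (f x)} ->
    (fun n => Rintegral mu setT (fun x => p (f_ n x))) @ \oo -->
    Rintegral mu setT (fun x => p (f x)).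
  move=> m1 m2 hp hc.
  have [|||||i0 _ hint] := @dominated_convergence _ _ _ mu setT measurableT
    (fun n x => (p (f_ n x))%:E) (fun x => (p (f x))%:E) (fun x => (g x)%:E).
  - by move=> n; exact/measurable_EFinP.
  - exact/measurable_EFinP.
  - by apply: filterS hc => x hx _; apply: cvg_EFin => //; exact: nearW.
  - exact: ig.
  - by apply: aeW => x n _; rewrite lee_fin (le_trans (hp _)).
  by apply: fine_cvg; rewrite fineK//; exact: integrable_fin_num.
split; apply: key.
- by move=> n; have [] := mf_ n.
- by have [] := mf.
- exact: Re_n1.
- by apply: filterS hcv => x [].
- by move=> n; have [] := mf_ n.
- by have [] := mf.
- exact: Im_n1.
- by apply: filterS hcv => x [].
Qed.

End ComplexIntegral.
Arguments rI {R d T} mu g.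
Arguments aeS {R d T mu P Q}.
Arguments iC {R d T} mu f.
Arguments cint {R d T} mu f.

Lemma mC_comp (R : realType) d1 d2 (T1 : measurableType d1) (T2 : measurableType d2)
    (f : T2 -> R[i]) (phi : T1 -> T2) :
  mC f -> measurable_fun setT phi -> mC (fun x => f (phi x)).
Proof.
by move=> [h1 h2] hp; split; [exact: measurableT_comp h1 hp|exact: measurableT_comp h2 hp].
Qed.

Section ComplexFubini.
Context {R : realType} d1 d2 {T1 : measurableType d1} {T2 : measurableType d2}.
Local Notation C := R[i].
Variables (m1 : {sigma_finite_measure set T1 -> \bar R}).
Variables (m2 : {sigma_finite_measure set T2 -> \bar R}).

Lemma measurable_Rintegral2 (f : T1 * T2 -> R) : measurable_fun setT f ->
  measurable_fun setT (fun x => Rintegral m2 setT (fun y => f (x, y))).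
Proof.
move=> mf.
apply: (@measurableT_comp _ _ _ _ _ _ fine); first exact: fine_measurable.
under eq_fun do rewrite integralE.
have mE : measurable_fun setT (fun z => (f z)%:E) by exact/measurable_EFinP.
have hp := @measurable_fun_fubini_tonelli_F _ _ T1 T2 R m2 _
  (measurable_funepos mE) (fun z => funepos_ge0 _ z).
have hn := @measurable_fun_fubini_tonelli_F _ _ T1 T2 R m2 _
  (measurable_funeneg mE) (fun z => funeneg_ge0 _ z).
apply: emeasurable_funB.
  rewrite (_ : (fun x => _) = fubini_F m2 (fun z => (f z)%:E)^\+%E)//.
  by apply/funext => x; apply: eq_integral => y _; rewrite !funeposE.
rewrite (_ : (fun x => _) = fubini_F m2 (fun z => (f z)%:E)^\-%E)//.
by apply/funext => x; apply: eq_integral => y _; rewrite !funenegE.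
Qed.

Lemma mC_cint2 (F : T1 * T2 -> C) : mC F ->
  mC (fun x => cint m2 (fun y => F (x, y))).
Proof.
by move=> [h1 h2]; split; [exact: measurable_Rintegral2 h1|exact: measurable_Rintegral2 h2].
Qed.

Lemma rI_prod (g1 : T1 -> R) (g2 : T2 -> R) : rI m1 g1 -> rI m2 g2 ->
  rI (m1 \x m2)%E (fun z => g1 z.1 * g2 z.2).
Proof.
move=> i1 i2.
have mF : measurable_fun setT (fun z : T1 * T2 => (g1 z.1 * g2 z.2)%:E).
  apply/measurable_EFinP; apply: measurable_funM.
    exact: measurableT_comp (rI_m i1) measurable_fst.
  exact: measurableT_comp (rI_m i2) measurable_snd.
apply/(integrable12ltyP _ _ mF).
have /integrableP[m1' f1] := i1; have /integrableP[m2' f2] := i2.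
have E x : (\int[m2]_y `|(g1 (x, y).1 * g2 (x, y).2)%:E| =
    `|(g1 x)%:E| * \int[m2]_y `|(g2 y)%:E|)%E.
  rewrite -ge0_integralZl//; last exact: measurableT_comp.
  by apply: eq_integral => y _; rewrite -abseM.
under eq_integral => x _ do rewrite E.
rewrite ge0_integralZr//=; last 2 first.
- by apply/measurable_EFinP; apply: measurableT_comp => //; exact: rI_m i1.
- exact: integral_ge0.
by apply: lte_mul_pinfty => //; [exact: integral_ge0|rewrite ge0_fin_numE//; exact: integral_ge0].
Qed.

Lemma Rfubini (F : T1 * T2 -> R) (g1 : T1 -> R) (g2 : T2 -> R) :
  measurable_fun setT F -> rI m1 g1 -> rI m2 g2 ->
  (forall x y, `|F (x, y)| <= g1 x * g2 y) ->
  Rintegral m1 setT (fun x => Rintegral m2 setT (fun y => F (x, y))) =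
  Rintegral m2 setT (fun y => Rintegral m1 setT (fun x => F (x, y))).
Proof.
move=> mF i1 i2 h.
have iF : rI (m1 \x m2)%E F.
  by apply: (rI_le mF (rI_prod i1 i2)) => -[x y]; exact: h.
have s1 x : rI m2 (fun y => F (x, y)).
  apply: (rI_le _ (rIZ (g1 x) i2)) => [|y]; last exact: h.
  exact: measurable_fun_pair2.
have s2 y : rI m1 (fun x => F (x, y)).
  apply: (rI_le _ (rIZ (g2 y) i1)) => [|x]; last by rewrite mulrC.
  exact: measurable_fun_pair1.
have := Fubini iF; rewrite /Rintegral => E.
transitivity (fine (\int[m1]_x \int[m2]_y (F (x, y))%:E))%E.
  congr fine; apply: eq_integral => x _; rewrite fineK//.
  exact: integrable_fin_num (s1 x).
rewrite E; congr fine; apply: eq_integral => y _; rewrite fineK//.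
exact: integrable_fin_num (s2 y).
Qed.

Lemma cfubini (F : T1 * T2 -> C) (g1 : T1 -> R) (g2 : T2 -> R) :
  mC F -> rI m1 g1 -> rI m2 g2 -> (forall x y, n1 (F (x, y)) <= g1 x * g2 y) ->
  cint m1 (fun x => cint m2 (fun y => F (x, y))) =
  cint m2 (fun y => cint m1 (fun x => F (x, y))).
Proof.
move=> [mF1 mF2] i1 i2 h; apply: C_ext => /=.
  apply: (Rfubini mF1 i1 i2) => x y; exact: le_trans (Re_n1 _) (h _ _).
apply: (Rfubini mF2 i1 i2) => x y; exact: le_trans (Im_n1 _) (h _ _).
Qed.

Lemma Rintegral_prod (F : T1 * T2 -> R) (g1 : T1 -> R) (g2 : T2 -> R) :
  measurable_fun setT F -> rI m1 g1 -> rI m2 g2 ->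
  (forall x y, `|F (x, y)| <= g1 x * g2 y) ->
  Rintegral (m1 \x m2)%E setT F =
  Rintegral m1 setT (fun x => Rintegral m2 setT (fun y => F (x, y))).
Proof.
move=> mF i1 i2 h.
have iF : rI (m1 \x m2)%E F.
  by apply: (rI_le mF (rI_prod i1 i2)) => -[x y]; exact: h.
have s1 x : rI m2 (fun y => F (x, y)).
  apply: (rI_le _ (rIZ (g1 x) i2)) => [|y]; last exact: h.
  exact: measurable_fun_pair2.
rewrite /Rintegral -(integral12_prod_meas1 iF).
congr fine; apply: eq_integral => x _; rewrite fineK//.
exact: integrable_fin_num (s1 x).
Qed.

Lemma cint_prod (F : T1 * T2 -> C) (g1 : T1 -> R) (g2 : T2 -> R) :
  mC F -> rI m1 g1 -> rI m2 g2 -> (forall x y, n1 (F (x, y)) <= g1 x * g2 y) ->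
  cint (m1 \x m2)%E F = cint m1 (fun x => cint m2 (fun y => F (x, y))).
Proof.
move=> [mF1 mF2] i1 i2 h; apply: C_ext => /=.
  apply: (Rintegral_prod mF1 i1 i2) => x y; exact: le_trans (Re_n1 _) (h _ _).
apply: (Rintegral_prod mF2 i1 i2) => x y; exact: le_trans (Im_n1 _) (h _ _).
Qed.

End ComplexFubini.

(** * Affine changes of variables in the plane *)
Section ImageIntegral.
Context {R : realType} d1 d2 {T1 : measurableType d1} {T2 : measurableType d2}.
Variables (m1 : {measure set T1 -> \bar R}) (m2 : {measure set T2 -> \bar R}).
Variables (phi : T1 -> T2) (mphi : measurable_fun setT phi) (k : R) (k0 : 0 < k).
Hypothesis hphi : forall f : T2 -> \bar R, measurable_fun setT f ->
  (forall x, 0 <= f x)%E -> (\int[m2]_x f x = k%:E * \int[m1]_x f (phi x))%E.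

Lemma rI_image (g : T2 -> R) : rI m2 g -> rI m1 (fun x => g (phi x)).
Proof.
move=> ig; have mg := rI_m ig.
apply/integrableP; split; first by apply/measurable_EFinP; exact: measurableT_comp mg mphi.
have /integrableP[mg' +] := ig.
rewrite (@hphi (fun x => `|(g x)%:E|%E))//; last exact: measurableT_comp.
move=> h; rewrite ltNge leye_eq; apply/negP => /eqP E; move: h.
by rewrite E gt0_muley ?ltxx.
Qed.

Lemma Rintegral_image (g : T2 -> R) : rI m2 g ->
  Rintegral m2 setT g = k * Rintegral m1 setT (fun x => g (phi x)).
Proof.
move=> ig; have ia := rI_image ig.
have mg : measurable_fun setT (fun x => (g x)%:E) by exact: measurable_int ig.
rewrite /Rintegral [in LHS]integralE [in RHS]integralE.
have Ep : (\int[m2]_x (fun x => (g x)%:E)^\+ x =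
    k%:E * \int[m1]_x (fun x => (g (phi x))%:E)^\+ x)%E.
  rewrite (hphi (measurable_funepos mg))//; congr (_ * _)%E.
  by apply: eq_integral => x _; rewrite !funeposE.
have En : (\int[m2]_x (fun x => (g x)%:E)^\- x =
    k%:E * \int[m1]_x (fun x => (g (phi x))%:E)^\- x)%E.
  rewrite (hphi (measurable_funeneg mg))//; congr (_ * _)%E.
  by apply: eq_integral => x _; rewrite !funenegE.
have p3 : (\int[m1]_x (fun x => (g (phi x))%:E)^\+ x)%E \is a fin_num.
  by apply: integrable_fin_num => //; exact: integrable_funepos.
have p4 : (\int[m1]_x (fun x => (g (phi x))%:E)^\- x)%E \is a fin_num.
  by apply: integrable_fin_num => //; exact: integrable_funeneg.
by rewrite Ep En -(fineK p3) -(fineK p4) -!EFinM -!EFinB /= mulrBr.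
Qed.
End ImageIntegral.

Section PlaneMeasure.
Context {R : realType}.
Local Notation C := R[i].
Local Notation mR := (measurableTypeR R).
Local Notation leb := (@lebesgue_measure R).

Definition mu2 : set (mR * mR)%type -> \bar R := (leb \x leb)%E.
HB.instance Definition _ := Measure.on mu2.

Lemma sigma_finite_mu2 : sigma_finite setT mu2.
Proof.
have /sigma_finiteP[F [TF ndF Foo]] := sigma_finiteT leb.
exists (fun n => F n `*` F n).
  rewrite -setXTT TF predeqE => -[x y]; split.
    move=> [/= [n _ Fnx] [k _ Gky]]; exists (maxn n k) => //; split.
    - by move: x Fnx; exact/subsetPset/ndF/leq_maxl.
    - by move: y Gky; exact/subsetPset/ndF/leq_maxr.
  by move=> [n _ []/= ? ?]; split; exists n.
move=> k; have [? ?] := Foo k; split; first exact: measurableX.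
by rewrite /mu2 product_measure1E// lte_mul_pinfty// ge0_fin_numE.
Qed.
HB.instance Definition _ := Measure_isSigmaFinite.Build _ _ _ mu2 sigma_finite_mu2.

Lemma Cint2E (f : R * R -> C) : Cint2 f = cint mu2 f. Proof. by []. Qed.

Definition affine (a b x : mR) : mR := a + b * x.
Lemma measurable_affine a b : measurable_fun setT (affine a b).
Proof. by apply: measurable_funD => //; exact: measurable_funM. Qed.

(** Affine changes of variables are proved by uniqueness of Lebesgue measure;
    this needs the scaled image as a bundled measure, together with the integral
    that goes with it. *)
Lemma scaled_image d1 d2 (T1 : measurableType d1) (T2 : measurableType d2)
    (m : {measure set T1 -> \bar R}) (phi : T1 -> T2) (k : R) :
  measurable_fun setT phi -> 0 <= k ->
  exists m' : {measure set T2 -> \bar R},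
    (forall A, m' A = (k%:E * m (phi @^-1` A))%E) /\
    (forall f : T2 -> \bar R, measurable_fun setT f -> (forall x, 0 <= f x)%E ->
      (\int[m']_x f x = k%:E * \int[m]_x f (phi x))%E).
Proof.
move=> mphi k0.
unshelve (eexists (mscale (NngNum k0) (pushforward m phi))); first exact: mphi.
split=> // f mf f0.
by rewrite ge0_integral_mscale//= ge0_integral_pushforward.
Qed.

Lemma lebesgue_affine (a b : R) (A : set mR) : b != 0 -> measurable A ->
  leb A = (`|b|%:E * leb (affine a b @^-1` A))%E.
Proof.
move=> b0 mA.
have [m' [E _]] := scaled_image leb (measurable_affine a b) (normr_ge0 b).
rewrite -E; apply: lebesgue_measure_unique => //= _ [[x y]] _ <-.
rewrite E lebesgue_measure_itv /= lte_fin.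
have [bp|bn] := ltrP 0 b.
  rewrite (_ : _ @^-1` _ = `](x - a) / b, (y - a) / b]%classic); last first.
    apply/seteqP; split => z /=; rewrite /affine !in_itv /= ltr_pdivrMr// ler_pdivlMr//;
    by rewrite ltrBlDl lerBrDl (mulrC z).
  rewrite lebesgue_measure_itv /= lte_fin ltr_pM2r ?invr_gt0// ltrD2r.
  case: ifP => _; last by rewrite mule0.
  rewrite -!EFinB -EFinM gtr0_norm//; congr _%:E; field; exact: lt0r_neq0.
have {bn} bn : b < 0 by rewrite lt_neqAle b0.
rewrite (_ : _ @^-1` _ = `[(y - a) / b, (x - a) / b[%classic); last first.
  apply/seteqP; split => z /=; rewrite /affine !in_itv /= ltr_ndivlMr// ler_ndivrMr//;
  by rewrite ltrBlDl lerBrDl (mulrC z) andbC.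
rewrite lebesgue_measure_itv /= lte_fin ltr_nM2r ?invr_lt0// ltrD2r.
case: ifP => _; last by rewrite mule0.
rewrite -!EFinB -EFinM ltr0_norm//; congr _%:E; field; exact: ltr0_neq0.
Qed.

Lemma ge0_integral_affine (a b : R) (f : R -> \bar R) : b != 0 ->
  measurable_fun setT f -> (forall x, 0 <= f x)%E ->
  (\int[leb]_x f x = `|b|%:E * \int[leb]_x f (affine a b x))%E.
Proof.
move=> b0 mf f0.
have [m' [E h]] := scaled_image leb (measurable_affine a b) (normr_ge0 b).
rewrite -h//; apply: eq_measure_integral => A mA _.
by rewrite E; exact: lebesgue_affine.
Qed.

Lemma rI_affine (a b : R) (g : R -> R) : b != 0 -> rI leb g ->
  rI leb (fun x => g (affine a b x)).
Proof.
move=> b0; apply: (@rI_image _ _ _ _ _ leb leb _ (measurable_affine a b) `|b|).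
- by rewrite normr_gt0.
- by move=> f mf f0; exact: ge0_integral_affine.
Qed.

Lemma Rintegral_affine (a b : R) (g : R -> R) : b != 0 -> rI leb g ->
  Rintegral leb setT g = `|b| * Rintegral leb setT (fun x => g (affine a b x)).
Proof.
move=> b0.
apply: (@Rintegral_image _ _ _ _ _ leb leb _ (measurable_affine a b) `|b|).
- by rewrite normr_gt0.
- by move=> f mf f0; exact: ge0_integral_affine.
Qed.

Definition affine2 (a : R * R) (b : R) (x : mR * mR) : (mR * mR)%type :=
  (affine a.1 b x.1, affine a.2 b x.2).
Lemma measurable_affine2 a b : measurable_fun setT (affine2 a b).
Proof.
by apply: measurable_fun_pair; apply: measurableT_comp => //;
  exact: measurable_affine.
Qed.

Lemma ge0_integral_affine2 (a : R * R) (b : R) (f : R * R -> \bar R) : b != 0 ->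
  measurable_fun setT f -> (forall x, 0 <= f x)%E ->
  (\int[mu2]_x f x = (b ^+ 2)%:E * \int[mu2]_x f (affine2 a b x))%E.
Proof.
move=> b0 mf f0.
have [m' [E h]] := scaled_image mu2 (measurable_affine2 a b) (sqr_ge0 b).
rewrite -h//; apply: eq_measure_integral => //= A mA _.
apply: (@product_measure_unique _ _ _ _ _ leb leb) => // A1 A2 m1 m2.
transitivity (`|b|%:E * leb (affine a.1 b @^-1` A1) *
              (`|b|%:E * leb (affine a.2 b @^-1` A2)))%E; last first.
  by congr (_ * _)%E; rewrite -lebesgue_affine.
rewrite E.
rewrite (_ : _ @^-1` _ = (affine a.1 b @^-1` A1) `*` (affine a.2 b @^-1` A2))//.
have mpre c A' : measurable A' -> measurable (affine c b @^-1` A').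
  by move=> mA'; rewrite -[X in measurable X]setTI; exact: measurable_affine.
have P := @product_measure1E _ _ _ _ _ leb leb _ _ (mpre a.1 _ m1) (mpre a.2 _ m2).
transitivity ((b ^+ 2)%:E * (leb (affine a.1 b @^-1` A1) *
    leb (affine a.2 b @^-1` A2)))%E; first by congr (_ * _)%E; exact: P.
by rewrite muleACA -EFinM -normrM -expr2 ger0_norm// sqr_ge0.
Qed.

Lemma rI_affine2 (a : R * R) (b : R) (g : R * R -> R) : b != 0 -> rI mu2 g ->
  rI mu2 (fun x => g (affine2 a b x)).
Proof.
move=> b0; apply: (@rI_image _ _ _ _ _ mu2 mu2 _ (measurable_affine2 a b) (b ^+ 2)).
- by rewrite exprn_even_gt0.
- by move=> f mf f0; exact: ge0_integral_affine2.
Qed.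

Lemma Rintegral_affine2 (a : R * R) (b : R) (g : R * R -> R) : b != 0 -> rI mu2 g ->
  Rintegral mu2 setT g = b ^+ 2 * Rintegral mu2 setT (fun x => g (affine2 a b x)).
Proof.
move=> b0.
apply: (@Rintegral_image _ _ _ _ _ mu2 mu2 _ (measurable_affine2 a b) (b ^+ 2)).
- by rewrite exprn_even_gt0.
- by move=> f mf f0; exact: ge0_integral_affine2.
Qed.

Lemma iC_affine2 (a : R * R) (b : R) (f : R * R -> C) : b != 0 -> iC mu2 f ->
  iC mu2 (fun x => f (affine2 a b x)).
Proof.
move=> b0 [h1 h2]; split; [exact: (rI_affine2 a b0 h1)|exact: (rI_affine2 a b0 h2)].
Qed.

Lemma cint_affine2 (a : R * R) (b : R) (f : R * R -> C) : b != 0 -> iC mu2 f ->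
  cint mu2 f = (b ^+ 2)%:C * cint mu2 (fun x => f (affine2 a b x)).
Proof.
move=> b0 [h1 h2]; apply: C_ext; rewrite ?cReM ?cImM !Re_cint !Im_cint !mul0r.
  by rewrite subr0; exact: Rintegral_affine2.
by rewrite addr0; exact: Rintegral_affine2.
Qed.

Lemma cint_reflect (c : R * R) (f : R * R -> C) : iC mu2 f ->
  cint mu2 f = cint mu2 (fun x => f (c.1 - x.1, c.2 - x.2)).
Proof.
move=> h; rewrite (@cint_affine2 c (-1))// ?oppr_eq0 ?oner_eq0//.
rewrite sqrrN expr1n mul1r; apply: eq_cint => x.
by rewrite /affine2 /affine !mulN1r.
Qed.

Lemma rI_reflect (c : R * R) (g : R * R -> R) : rI mu2 g ->
  rI mu2 (fun x => g (c.1 - x.1, c.2 - x.2)).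
Proof.
move=> /(@rI_affine2 c (-1) g); rewrite oppr_eq0 oner_eq0 => /(_ isT).
by apply: eq_integrable => // x _; rewrite /affine2 /affine !mulN1r.
Qed.

End PlaneMeasure.

(** * The Poisson kernel *)
Section Poisson.
Context {R : realType}.
Local Notation C := R[i].
Local Notation leb := (@lebesgue_measure R).

Section HalfLine.
Variables (d y : R) (d0 : 0 < d).
Let q := d ^+ 2 + y ^+ 2.
Let q0 : 0 < q. Proof. by rewrite ltr_pwDl ?exprn_gt0// sqr_ge0. Qed.
Let E (x : R) := expR (- (d * x)).
Let F (x : R) := - (d^-1 * E x) + (y / q * (E x * sin (x * y)) - d / q * (E x * cos (x * y))).

Let derE (x : R) : is_derive x (1 : R) E (- d * E x).
Proof.
rewrite /E; have h : is_derive x (1 : R) (fun x : R => - (d * x)) (- d).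
  have -> : (fun x : R => - (d * x)) = - (d *: id) by apply/funext.
  by apply: is_derive_eq; rewrite scaler1.
have := @is_derive1_comp R expR (fun x : R => - (d * x)) x _ _ (is_derive_expR _) h.
by rewrite [expR _ * _]mulrC.
Qed.

Let derxy (x : R) : is_derive x (1 : R) (fun x : R => x * y) y.
Proof.
have -> : (fun x : R => x * y) = y *: id by apply/funext => z; rewrite /GRing.scale /= mulrC.
by apply: is_derive_eq; rewrite scaler1.
Qed.

Let derS (x : R) : is_derive x (1 : R) (fun x => sin (x * y)) (y * cos (x * y)).
Proof.
have := @is_derive1_comp R sin (fun x : R => x * y) x _ _ (is_derive_sin _) (derxy x).
by rewrite [cos _ * _]mulrC.
Qed.

Let derC (x : R) : is_derive x (1 : R) (fun x => cos (x * y)) (- (y * sin (x * y))).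
Proof.
have := @is_derive1_comp R cos (fun x : R => x * y) x _ _ (is_derive_cos _) (derxy x).
by rewrite mulNr [sin _ * _]mulrC.
Qed.

Let derF (x : R) : is_derive x (1 : R) F ((1 + cos (x * y)) * E x).
Proof.
have -> : F = - (d^-1 *: E) + ((y / q) *: (E * (fun x => sin (x * y))) -
    (d / q) *: (E * (fun x => cos (x * y)))).
  by apply/funext.
have hS := is_deriveZ (y / q) (is_deriveM (derE x) (derS x)).
have hC := is_deriveZ (d / q) (is_deriveM (derE x) (derC x)).
have h := is_deriveD (is_deriveN (is_deriveZ d^-1 (derE x))) (is_deriveB hS hC).
apply: is_derive_eq h _; rewrite /GRing.scale /= /q; field.
by rewrite !gt_eqF.
Qed.

Let contE : continuous E.
Proof. by move=> x; apply/differentiable_continuous/derivable1_diffP; exact: ex_derive. Qed.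

Let cvgF : F x @[x --> +oo] --> 0.
Proof.
have cE : E x @[x --> +oo] --> 0.
  apply: (cvg_comp (fun x : R => d * x) (fun x => expR (- x))); last exact: cvgr_expR.
  exact: gt0_cvgMry.
pose K := d^-1 + (`|y| / q + d / q).
apply/norm_cvg0P.
apply: (@squeeze_cvgr _ _ _ _ (cst 0) (fun x => K * E x)).
- apply: nearW => x; rewrite normr_ge0/= /F /K.
  have e0 : 0 <= E x by exact: expR_ge0.
  apply: (le_trans (ler_normD _ _)).
  rewrite mulrDl lerD//; first by rewrite normrN ger0_norm// mulr_ge0// invr_ge0 ltW.
  apply: (le_trans (ler_normB _ _)); rewrite mulrDl lerD//.
    rewrite normrM normrM (gtr0_norm (x := q^-1)) ?invr_gt0// ler_wpM2l//.
      by rewrite mulr_ge0// invr_ge0 ltW.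
    by rewrite normrM ger0_norm// ler_piMr// ler_norml sin_geN1 sin_le1.
  have dq : 0 <= d / q by rewrite mulr_ge0// ?invr_ge0 ltW.
  rewrite normrM (ger0_norm dq) ler_wpM2l//.
  by rewrite normrM ger0_norm// ler_piMr// ler_norml cos_geN1 cos_le1.
- exact: cvg_cst.
- by rewrite -[X in _ --> X](mulr0 K); apply: cvgM => //; exact: cvg_cst.
Qed.

(** The integrand [(1 + cos) exp] is nonnegative, unlike [cos exp], so that the
    fundamental theorem of calculus applies on the half-line without any prior
    integrability; the choice [y = 0] then isolates [exp]. *)
Lemma integral_one_cos_expR :
  (\int[leb]_x ((1 + cos (x * y)) * expR (- (d * `|x|)))%:E =
   (2 * (d^-1 + d / q))%:E)%E.
Proof.
have cf : continuous (fun x : R => (1 + cos (x * y)) * expR (- (d * `|x|))).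
  move=> x; apply: cvgM.
    apply: cvgD; first exact: cvg_cst.
    by apply/differentiable_continuous/derivable1_diffP; exact: ex_derive.
  apply: continuous_comp; last exact: continuous_expR.
  by apply: cvgN; apply: cvgM; [exact: cvg_cst|exact: norm_continuous].
rewrite ge0_symfun_integralT//; last by move=> x /=; rewrite mulNr cosN normrN.
rewrite -set_itvcy.
rewrite (@eq_integral _ _ _ leb _ (fun x : R => ((1 + cos (x * y)) * E x)%:E)); last first.
  by move=> x; rewrite inE /= in_itv /= andbT => x0; rewrite ger0_norm.
have cF : continuous F.
  by move=> x; apply/differentiable_continuous/derivable1_diffP; exact: ex_derive.
rewrite (@ge0_continuous_FTC2y _ _ F 0 0)//.
- rewrite /F /E mul0r mulr0 oppr0 expR0 sin0 cos0 -EFinB -EFinM; congr _%:E; field.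
  by rewrite !gt_eqF.
- move=> x _; rewrite mulr_ge0 ?expR_ge0// addrC -lerBlDr sub0r; exact: cos_geN1.
- apply: continuous_subspaceT => x; apply: cvgM; last exact: contE.
  apply: cvgD; first exact: cvg_cst.
  by apply/differentiable_continuous/derivable1_diffP; exact: ex_derive.
- by apply: cvg_at_right_filter; exact: cF.
- by move=> x _; rewrite derive1E; exact: derive_val.
Qed.

End HalfLine.

Let m_exp (d : R) : measurable_fun setT (fun x : R => expR (- (d * `|x|))).
Proof.
apply: measurableT_comp => //; apply: measurable_funN; apply: measurable_funM.
  exact: measurable_cst.
exact: normr_measurable.
Qed.

Let m_cos (y : R) : measurable_fun setT (fun x : R => cos (x * y)).
Proof.
apply: measurableT_comp; first by apply: continuous_measurable_fun; exact: continuous_cos.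
exact: measurable_funM.
Qed.

Let m_sin (y : R) : measurable_fun setT (fun x : R => sin (x * y)).
Proof.
apply: measurableT_comp; first by apply: continuous_measurable_fun; exact: continuous_sin.
exact: measurable_funM.
Qed.

Lemma rI_expRNabs (d : R) : 0 < d -> rI leb (fun x : R => expR (- (d * `|x|))).
Proof.
move=> d0.
have h : rI leb (fun x : R => (1 + cos (x * 0)) * expR (- (d * `|x|))).
  apply/integrableP; split.
    by apply/measurable_EFinP; apply: measurable_funM (m_exp d);
      exact: measurable_funD (measurable_cst _) (m_cos 0).
  have p (x : R) : 0 <= (1 + cos (x * 0)) * expR (- (d * `|x|)).
    by rewrite mulr0 cos0 mulr_ge0 ?expR_ge0// addr_ge0.
  under eq_integral => x _ do rewrite gee0_abs ?lee_fin ?p//.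
  by rewrite integral_one_cos_expR// ltry.
apply: (rI_le _ h) => [|x]; first exact: m_exp.
rewrite mulr0 cos0 ger0_norm ?expR_ge0// ler_peMl ?expR_ge0//.
by rewrite lerDl.
Qed.

Lemma rI_trig_expR (d : R) (f : R -> R) : 0 < d -> measurable_fun setT f ->
  (forall x, `|f x| <= 1) -> rI leb (fun x : R => f x * expR (- (d * `|x|))).
Proof.
move=> d0 mf hf; apply: rI_le (rI_expRNabs d0) _; first exact: measurable_funM mf (m_exp d).
by move=> x; rewrite normrM [X in _ * X]ger0_norm ?expR_ge0// ler_piMl// expR_ge0.
Qed.

(** The Poisson kernel of the line: the Fourier transform of [expR (- d |x|)]. *)
Definition poisson (d y : R) : R := 2 * (d / (d ^+ 2 + y ^+ 2)).

Lemma cint_cis_expR (d y : R) : 0 < d ->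
  cint leb (fun x : R => cis (x * y) * (expR (- (d * `|x|)))%:C) = (poisson d y)%:C.
Proof.
move=> d0.
have cb x : `|cos (x * y)| <= 1 by rewrite ler_norml cos_geN1 cos_le1.
have sb x : `|sin (x * y)| <= 1 by rewrite ler_norml sin_geN1 sin_le1.
have ic := rI_trig_expR d0 (m_cos y) cb; have is_ := rI_trig_expR d0 (m_sin y) sb.
apply: C_ext; rewrite ?Re_cint ?Im_cint.
  transitivity (Rintegral leb setT (fun x : R => cos (x * y) * expR (- (d * `|x|)))).
    by apply: eq_Rintegral => x _; rewrite !ReImE mulr0 subr0.
  have E z : Rintegral leb setT (fun x : R => (1 + cos (x * z)) * expR (- (d * `|x|))) =
     2 * (d^-1 + d / (d ^+ 2 + z ^+ 2)) by rewrite /Rintegral integral_one_cos_expR.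
  have E0 : Rintegral leb setT (fun x : R => expR (- (d * `|x|))) = 2 / d.
    have := E 0; under eq_Rintegral do rewrite mulr0 cos0.
    rewrite RintegralZl//; last exact: rI_expRNabs.
    rewrite expr0n addr0 => h.
    apply: (@mulfI _ 2) => //; rewrite h; field; exact: lt0r_neq0.
  have := E y; rewrite (_ : (fun x => _) = (fun x : R => expR (- (d * `|x|)) +
     cos (x * y) * expR (- (d * `|x|)))); last by apply/funext => x; rewrite mulrDl mul1r.
  rewrite RintegralD//; last exact: rI_expRNabs.
  rewrite E0 /poisson => /eqP; rewrite mulrDr addrC -[X in X == _]addrC => /eqP.
  by move/addrI.
transitivity (Rintegral leb setT (fun x : R => sin (x * y) * expR (- (d * `|x|)))).
  by apply: eq_Rintegral => x _; rewrite !ReImE mulr0 add0r.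
have odd : Rintegral leb setT (fun x : R => sin (x * y) * expR (- (d * `|x|))) =
  - Rintegral leb setT (fun x : R => sin (x * y) * expR (- (d * `|x|))).
  rewrite [LHS](@Rintegral_affine _ 0 (-1))// ?oppr_eq0 ?oner_eq0//.
  rewrite normrN normr1 mul1r -[RHS]mulN1r -RintegralZl//.
  by apply: eq_Rintegral => x _; rewrite /affine add0r !mulN1r mulNr sinN normrN mulNr.
by move/eqP: odd; rewrite -subr_eq0 opprK -mulr2n mulrn_eq0 /= => /eqP ->.
Qed.

Lemma rI_inv_oneDsqr : rI leb (fun x : R => (1 + x ^+ 2)^-1).
Proof.
have mf : measurable_fun setT (fun x : R => (1 + x ^+ 2)^-1).
  by apply: continuous_measurable_fun; exact: continuous_oneDsqrV.
have p x : 0 <= (1 + x ^+ 2)^-1 :> R by rewrite invr_ge0 addr_ge0// sqr_ge0.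
apply/integrableP; split; first exact/measurable_EFinP.
under eq_integral => x _ do rewrite gee0_abs ?lee_fin//.
rewrite ge0_symfun_integralT//; last 2 first.
- exact: continuous_oneDsqrV.
- by move=> x /=; rewrite sqrrN.
by rewrite -set_itvcy integral0y_oneDsqr -EFinM ltry.
Qed.

End Poisson.

(** * A weight adapted to convolution *)
Section Weight.
Context {R : realType}.
Local Notation leb := (@lebesgue_measure R).
Local Notation mu2 := (@mu2 R).

Definition rho1 (x : R) : R := (1 + x ^+ 2)^-1.
Definition w1 (x : R) : R := expR (- `|x|) * rho1 x.
Definition rho (xi : R * R) : R := rho1 xi.1 * rho1 xi.2.
(** The exponential factor controls every Sobolev norm.  Its
    convolution with itself exceeds it by a polynomial factor, which the rational
    factor compensates ([wt_conv]). *)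
Definition wt (xi : R * R) : R := w1 xi.1 * w1 xi.2.

Lemma oneDsqr_gt0 (x : R) : 0 < 1 + x ^+ 2. Proof. by rewrite ltr_pwDl ?sqr_ge0. Qed.
Lemma rho1_gt0 x : 0 < rho1 x. Proof. by rewrite invr_gt0 oneDsqr_gt0. Qed.
Lemma rho1_le1 x : rho1 x <= 1.
Proof. by rewrite invf_le1 ?oneDsqr_gt0// lerDl sqr_ge0. Qed.
Lemma rho_gt0 xi : 0 < rho xi. Proof. by rewrite mulr_gt0 ?rho1_gt0. Qed.
Lemma w1_gt0 x : 0 < w1 x. Proof. by rewrite mulr_gt0 ?expR_gt0 ?rho1_gt0. Qed.
Lemma w1_le x : w1 x <= rho1 x.
Proof. by rewrite ler_piMl ?(ltW (rho1_gt0 _))// -expR0 ler_expR oppr_le0. Qed.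
Lemma wt_gt0 xi : 0 < wt xi. Proof. by rewrite mulr_gt0 ?w1_gt0. Qed.
Lemma wt_ge0 xi : 0 <= wt xi. Proof. exact: ltW (wt_gt0 xi). Qed.
Lemma wt_le_rho xi : wt xi <= rho xi.
Proof. by rewrite ler_pM ?w1_le// ltW ?w1_gt0. Qed.
Lemma rho_le1 xi : rho xi <= 1.
Proof. by rewrite mulr_ile1 ?rho1_le1// ltW ?rho1_gt0. Qed.
Lemma wt_le1 xi : wt xi <= 1. Proof. exact: le_trans (wt_le_rho xi) (rho_le1 xi). Qed.

Lemma wtN xi : wt (- xi) = wt xi.
Proof. by rewrite /wt /w1 /rho1 /= !normrN !sqrrN. Qed.

Lemma measurable_rho1 : measurable_fun setT rho1.
Proof. by apply: continuous_measurable_fun; exact: continuous_oneDsqrV. Qed.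
Lemma measurable_w1 : measurable_fun setT w1.
Proof.
apply: measurable_funM measurable_rho1; apply: measurableT_comp => //.
by apply: measurable_funN; exact: normr_measurable.
Qed.
Lemma measurable_wt : measurable_fun setT wt.
Proof.
apply: measurable_funM.
  exact: measurableT_comp measurable_w1 measurable_fst.
exact: measurableT_comp measurable_w1 measurable_snd.
Qed.

Lemma rI_rho : rI mu2 rho.
Proof. exact: (rI_prod rI_inv_oneDsqr rI_inv_oneDsqr). Qed.
Lemma rI_wt : rI mu2 wt.
Proof.
apply: (rI_le _ rI_rho) => [|x]; first exact: measurable_wt.
by rewrite ger0_norm ?wt_ge0// wt_le_rho.
Qed.

Definition psub (xi eta : R * R) : R * R := (xi.1 - eta.1, xi.2 - eta.2).
Lemma measurable_psub xi : measurable_fun setT (psub xi).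
Proof.
apply: measurable_fun_pair; apply: measurable_funB => //.
Qed.

(** The exponential factors are handled by the triangle inequality.  For the
    rational ones, [1 + x^2 <= 2 ((1 + y^2) + (1 + (x - y)^2))] exchanges one of
    the two decays at [y] and [x - y] for the decay at [x]. *)
Lemma w1_conv (x y : R) : w1 y * w1 (x - y) <= 2 * w1 x * (rho1 y + rho1 (x - y)).
Proof.
have h1 : expR (- `|y|) * expR (- `|x - y|) <= expR (- `|x|).
  rewrite -expRD ler_expR -opprD lerN2.
  by rewrite -{1}[x](subrKC y) ler_normD.
have p1 := oneDsqr_gt0 y; have p2 := oneDsqr_gt0 (x - y); have p3 := oneDsqr_gt0 x.
have h2 : rho1 y * rho1 (x - y) <= 2 * rho1 x * (rho1 y + rho1 (x - y)).
  rewrite /rho1 -subr_ge0.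
  have -> : 2 * (1 + x ^+ 2)^-1 * ((1 + y ^+ 2)^-1 + (1 + (x - y) ^+ 2)^-1) -
     (1 + y ^+ 2)^-1 * (1 + (x - y) ^+ 2)^-1 =
     (2 * ((1 + y ^+ 2) + (1 + (x - y) ^+ 2)) - (1 + x ^+ 2)) /
     ((1 + y ^+ 2) * (1 + (x - y) ^+ 2) * (1 + x ^+ 2)).
    by field; rewrite !gt_eqF.
  rewrite mulr_ge0 ?invr_ge0 ?mulr_ge0 ?(ltW p1) ?(ltW p2) ?(ltW p3)//.
  by rewrite (_ : _ - _ = 3 + (x - 2 * y) ^+ 2); [rewrite addr_ge0 ?sqr_ge0|ring].
rewrite /w1 mulrACA.
apply: (le_trans (ler_pM _ _ h1 h2)).
- by rewrite mulr_ge0 ?expR_ge0.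
- by rewrite mulr_ge0 ?ltW ?rho1_gt0.
by rewrite le_eqVlt; apply/orP; left; apply/eqP; ring.
Qed.

Definition I1 : R := Rintegral leb setT rho1.
Definition cw : R := 16 * I1 ^+ 2.
Lemma cw_ge0 : 0 <= cw. Proof. by rewrite mulr_ge0// sqr_ge0. Qed.

Let v (x y : R) := rho1 y + rho1 (x - y).
Let rI_v x : rI leb (v x).
Proof.
apply: rID; first exact: rI_inv_oneDsqr.
have := @rI_affine _ x (-1) _ _ rI_inv_oneDsqr; rewrite oppr_eq0 oner_eq0 => /(_ isT).
by apply: eq_integrable => // y _; rewrite /affine mulN1r.
Qed.
Let int_v x : Rintegral leb setT (v x) = 2 * I1.
Proof.
have h := @rI_affine _ x (-1) _ _ rI_inv_oneDsqr; rewrite oppr_eq0 oner_eq0 in h.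
have {}h : rI leb (fun y => rho1 (x - y)).
  by move: (h isT); apply: eq_integrable => // y _; rewrite /affine mulN1r.
rewrite RintegralD//; last exact: rI_inv_oneDsqr.
rewrite mulrDl !mul1r; congr (_ + _).
rewrite /I1 (@Rintegral_affine _ x (-1) rho1) ?oppr_eq0 ?oner_eq0//; last exact: rI_inv_oneDsqr.
rewrite normrN normr1 mul1r; apply: eq_Rintegral => y _; by rewrite /affine mulN1r.
Qed.

Lemma rI_wt_conv xi : rI mu2 (fun eta => wt eta * wt (psub xi eta)).
Proof.
apply: (rI_le _ rI_wt).
  apply: measurable_funM measurable_wt _.
  exact: measurableT_comp measurable_wt (measurable_psub xi).
move=> eta; have p := wt_ge0 eta; have p' := wt_ge0 (psub xi eta).
rewrite (ger0_norm (mulr_ge0 p p')); apply: (ler_piMr p); exact: wt_le1.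
Qed.

Lemma wt_conv xi :
  Rintegral mu2 setT (fun eta => wt eta * wt (psub xi eta)) <= cw * wt xi.
Proof.
have ip : rI mu2 (fun eta => 4 * wt xi * (v xi.1 eta.1 * v xi.2 eta.2)).
  apply: rIZ; exact: (rI_prod (rI_v xi.1) (rI_v xi.2)).
apply: (le_trans (le_Rintegral measurableT (rI_wt_conv xi) ip _)).
  move=> eta _; rewrite /wt mulrACA /psub /=.
  apply: (le_trans (ler_pM _ _ (w1_conv _ _) (w1_conv _ _))).
  - by rewrite mulr_ge0 ?ltW ?w1_gt0.
  - by rewrite mulr_ge0 ?ltW ?w1_gt0.
  by rewrite le_eqVlt; apply/orP; left; apply/eqP; rewrite /v; ring.
rewrite RintegralZl//; last exact: (rI_prod (rI_v xi.1) (rI_v xi.2)).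
rewrite (_ : Rintegral _ _ _ = (2 * I1) * (2 * I1)).
  by rewrite le_eqVlt; apply/orP; left; apply/eqP; rewrite /cw; ring.
have E := @Rintegral_prod R _ _ _ _ leb leb (fun eta => v xi.1 eta.1 * v xi.2 eta.2)
  (v xi.1) (v xi.2).
rewrite E//.
- rewrite -[X in _ = X * _](int_v xi.1) -RintegralZr//; last exact: rI_v.
  by apply: eq_Rintegral => x _; rewrite -(int_v xi.2) -RintegralZl//; exact: rI_v.
- apply: measurable_funM.
    exact: measurableT_comp (rI_m (rI_v xi.1)) measurable_fst.
  exact: measurableT_comp (rI_m (rI_v xi.2)) measurable_snd.
- move=> x y /=; rewrite ger0_norm//.
  by rewrite /v mulr_ge0// addr_ge0// ltW ?rho1_gt0.
Qed.

End Weight.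

(** * Products in physical space are convolutions of Fourier transforms *)
Section FourierProduct.
Context {R : realType}.
Local Notation C := R[i].
Local Notation leb := (@lebesgue_measure R).
Local Notation mu2 := (@mu2 R).
Local Notation P2 := (measurableTypeR R * measurableTypeR R)%type.

Definition conv (f g : P2 -> C) (xi : P2) : C :=
  cint mu2 (fun eta => f eta * g (psub xi eta)).
Definition refl (f : P2 -> C) (xi : P2) : C := conjc (f (- xi)).

(** Continuity along sequences, the form in which dominated convergence yields
    and uses it. *)
Definition scont (f : P2 -> C) (xi : P2) :=
  forall x : nat -> R * R, (fun n => (x n).1) @ \oo --> xi.1 ->
    (fun n => (x n).2) @ \oo --> xi.2 -> ccvg (fun n => f (x n)) (f xi).

Definition ae_scont (f : P2 -> C) :=
  forall xi, {ae mu2, forall eta, scont f (psub xi eta)}.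

Definition wbound (K : R) (f : P2 -> C) := forall xi, n1 (f xi) <= K * wt xi.

Lemma wbound_ge0 K f : wbound K f -> 0 <= K.
Proof.
move=> /(_ 0) h; have := le_trans (n1_ge0 _) h.
by rewrite pmulr_lge0// wt_gt0.
Qed.

Lemma wbound_le K f xi : wbound K f -> n1 (f xi) <= K.
Proof.
move=> h; apply: (le_trans (h xi)); rewrite ler_piMr ?wt_le1//.
exact: wbound_ge0 h.
Qed.

Lemma iC_wbound K f : mC f -> wbound K f -> iC mu2 f.
Proof. by move=> mf h; apply: (iC_le _ (rIZ K rI_wt)). Qed.

Lemma measurable_oppxi : measurable_fun setT (fun xi : P2 => - xi).
Proof.
by apply: measurable_fun_pair; apply: measurable_funN.
Qed.

Lemma mC_refl (f : P2 -> C) : mC f -> mC (refl f).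
Proof. by move=> mf; apply: mCJ; exact: mC_comp mf measurable_oppxi. Qed.
Lemma wbound_refl K f : wbound K f -> wbound K (refl f).
Proof. by move=> h xi; rewrite /refl n1J -(wtN xi); exact: h. Qed.

Lemma mC_psub (g : P2 -> C) (xi : P2) : mC g -> mC (fun eta => g (psub xi eta)).
Proof. by move=> mg; exact: mC_comp mg (measurable_psub xi). Qed.

Lemma iC_conv K L (f g : P2 -> C) xi : mC f -> mC g -> wbound K f -> wbound L g ->
  iC mu2 (fun eta => f eta * g (psub xi eta)).
Proof.
move=> mf mg bf bg.
apply: (iC_le _ (rIZ (K * L) (rI_wt_conv xi))).
- by apply: mCM => //; exact: mC_psub.
- move=> eta; apply: (le_trans (n1M _ _)); rewrite mulrACA.
  by apply: ler_pM; rewrite ?n1_ge0.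
Qed.

Lemma wbound_conv K L (f g : P2 -> C) : mC f -> mC g -> wbound K f -> wbound L g ->
  wbound (cw * (K * L)) (conv f g).
Proof.
move=> mf mg bf bg xi.
have ik : rI mu2 (fun eta => K * L * (wt eta * wt (psub xi eta))).
  by apply: rIZ; exact: rI_wt_conv.
apply: (le_trans (n1_cint_le (iC_conv xi mf mg bf bg) ik _)).
  move=> eta; apply: (le_trans (n1M _ _)); rewrite mulrACA.
  by apply: ler_pM; rewrite ?n1_ge0.
rewrite RintegralZl//; last exact: rI_wt_conv.
rewrite (mulrC cw) -[leRHS]mulrA; apply: ler_wpM2l; last exact: wt_conv.
by rewrite mulr_ge0 ?(wbound_ge0 bf) ?(wbound_ge0 bg).
Qed.

(** The inverse Fourier transform up to its normalising factor. *)
Definition ift (f : P2 -> C) (x : P2) : C :=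
  cint mu2 (fun xi => cis (dot2 x xi) * f xi).

Lemma measurable_dot2 : measurable_fun setT (fun z : (P2 * P2)%type => dot2 z.1 z.2).
Proof.
apply: measurable_funD; apply: measurable_funM.
- exact: measurableT_comp measurable_fst measurable_fst.
- exact: measurableT_comp measurable_fst measurable_snd.
- exact: measurableT_comp measurable_snd measurable_fst.
- exact: measurableT_comp measurable_snd measurable_snd.
Qed.

Lemma mC_character (a : R * R) : mC (fun x : P2 => cis (dot2 a x)).
Proof.
apply: mC_cis; apply: measurable_funD; apply: measurable_funM => //.
Qed.

Lemma mC_ift (f : P2 -> C) : mC f -> mC (ift f).
Proof.
move=> mf; apply: (@mC_cint2 _ _ _ _ _ mu2 (fun z => cis (dot2 z.1 z.2) * f z.2)).
apply: mCM; last exact: mC_comp mf measurable_snd.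
exact: mC_cis measurable_dot2.
Qed.

Lemma n1_ift (K : R) (f : P2 -> C) x : mC f -> wbound K f -> n1 (ift f x) <= 2 * K * Rintegral mu2 setT wt.
Proof.
move=> mf bf; rewrite -RintegralZl; [|by []|exact: rI_wt].
have b xi : n1 (cis (dot2 x xi) * f xi) <= 2 * K * wt xi.
  apply: (le_trans (n1M _ _)); rewrite -mulrA; by apply: ler_pM; rewrite ?n1_ge0 ?n1_cis.
apply: (n1_cint_le _ (rIZ (2 * K) rI_wt) b).
by apply: (iC_le _ (rIZ (2 * K) rI_wt) b); apply: mCM => //; exact: mC_character.
Qed.

Lemma ift_refl (K : R) (f : P2 -> C) x : mC f -> wbound K f -> ift (refl f) x = conjc (ift f x).
Proof.
move=> mf bf.
have i1 : iC mu2 (fun xi => cis (dot2 x xi) * f xi).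
  apply: (iC_le _ (rIZ (2 * K) rI_wt)).
  - by apply: mCM => //; exact: mC_character.
  - move=> xi; apply: (le_trans (n1M _ _)); rewrite -mulrA.
    by apply: ler_pM; rewrite ?n1_ge0 ?n1_cis//; exact: bf.
rewrite /ift -cintJ// [RHS](cint_reflect (0, 0)).
  apply: eq_cint => xi; rewrite /refl cJM -cisN /= !sub0r.
  by congr (cis _ * conjc (f _)); rewrite /dot2 /=; ring.
apply: (iC_le _ (iC_n1 i1)).
- by apply: mCJ; exact: iC_m i1.
- by move=> xi; rewrite n1J.
Qed.

(** The inverse Fourier transform of a function with jumps need not be
    integrable; [damp] is the summability factor that makes Fubini available, and
    [kern] its Fourier transform. *)
Definition damp (d : R) (x : R * R) : R := expR (- (d * `|x.1|)) * expR (- (d * `|x.2|)).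
Definition kern (d : R) (x : R * R) : R := poisson d x.1 * poisson d x.2.

Lemma damp_ge0 d x : 0 <= damp d x. Proof. by rewrite mulr_ge0 ?expR_ge0. Qed.
Lemma damp_le1 d x : 0 <= d -> damp d x <= 1.
Proof.
move=> d0; rewrite mulr_ile1 ?expR_ge0// -expR0 ler_expR oppr_le0 mulr_ge0//.
Qed.
Lemma rI_damp d : 0 < d -> rI mu2 (damp d).
Proof. by move=> d0; exact: (rI_prod (rI_expRNabs d0) (rI_expRNabs d0)). Qed.

Lemma ft_damp (d : R) (th : P2) : 0 < d ->
  cint mu2 (fun x => cis (dot2 x th) * (damp d x)%:C) = (kern d th)%:C.
Proof.
move=> d0.
have m1 (y : R) : mC (fun x : R => cis (x * y) * (expR (- (d * `|x|)))%:C).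
  apply: mCM; first by apply: mC_cis; exact: measurable_funM.
  by apply: mCR; exact: rI_m (rI_expRNabs d0).
have b1 (y x : R) : n1 (cis (x * y) * (expR (- (d * `|x|)))%:C) <= 2 * expR (- (d * `|x|)).
  apply: (le_trans (n1M _ _)); rewrite n1R (ger0_norm (expR_ge0 _)).
  by rewrite ler_wpM2r ?expR_ge0// n1_cis.
have i1 (y : R) : iC leb (fun x : R => cis (x * y) * (expR (- (d * `|x|)))%:C).
  by apply: (iC_le _ (rIZ 2 (rI_expRNabs d0)) (b1 y)); exact: m1.
have E := @cint_prod R _ _ _ _ leb leb (fun x => cis (dot2 x th) * (damp d x)%:C)
  (fun x => 2 * expR (- (d * `|x|))) (fun x => 2 * expR (- (d * `|x|))).
have F x : cis (dot2 x th) * (damp d x)%:C =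
    (cis (x.1 * th.1) * (expR (- (d * `|x.1|)))%:C) *
    (cis (x.2 * th.2) * (expR (- (d * `|x.2|)))%:C).
  by rewrite /dot2 cisD /damp rcM; ring.
rewrite [LHS]E.
- rewrite /kern rcM -(cint_cis_expR th.1 d0) -(cint_cis_expR th.2 d0).
  rewrite mulrC -cintZ//; apply: eq_cint => x.
  rewrite mulrC -cintZ//; apply: eq_cint => y.
  by rewrite F.
- under eq_fun do rewrite F; apply: mCM.
    exact: mC_comp (m1 th.1) measurable_fst.
  exact: mC_comp (m1 th.2) measurable_snd.
- exact: rIZ (rI_expRNabs d0).
- exact: rIZ (rI_expRNabs d0).
- move=> x y; rewrite F; apply: (le_trans (n1M _ _)).
  by apply: ler_pM; rewrite ?n1_ge0//= b1.
Qed.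

End FourierProduct.

(** ** Regularisation by the Poisson kernel *)
Section Regularisation.
Context {R : realType}.
Local Notation C := R[i].
Local Notation leb := (@lebesgue_measure R).
Local Notation mu2 := (@mu2 R).
Local Notation P2 := (measurableTypeR R * measurableTypeR R)%type.

Lemma n1_cisM (a : R) z : n1 (cis a * z) <= 2 * n1 z.
Proof. by apply: (le_trans (n1M _ _)); rewrite ler_wpM2r ?n1_ge0 ?n1_cis. Qed.

Lemma iC_cisM (phi : P2 -> R) (f : P2 -> C) : measurable_fun setT phi -> iC mu2 f ->
  iC mu2 (fun x => cis (phi x) * f x).
Proof.
move=> mphi i; apply: (iC_le _ (rIZ 2 (iC_n1 i))) => [|x]; last exact: n1_cisM.
by apply: mCM; [exact: mC_cis|exact: iC_m i].
Qed.

Lemma measurable_dot2l (a : P2) : measurable_fun setT (fun x : P2 => dot2 x a).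
Proof. by apply: measurable_funD; apply: measurable_funM. Qed.
Lemma measurable_dot2r (a : P2) : measurable_fun setT (fun x : P2 => dot2 a x).
Proof. by apply: measurable_funD; apply: measurable_funM. Qed.

Lemma ift_fubini (h g : P2 -> C) : iC mu2 h -> iC mu2 g ->
  cint mu2 (fun x => h x * ift g x) =
  cint mu2 (fun eta => g eta * cint mu2 (fun x => cis (dot2 x eta) * h x)).
Proof.
move=> ih ig.
transitivity (cint mu2 (fun x => cint mu2 (fun eta => h x * (cis (dot2 x eta) * g eta)))).
  apply: eq_cint => x; rewrite -cintZ//; apply: iC_cisM => //; exact: measurable_dot2r.
rewrite (@cfubini _ _ _ _ _ mu2 mu2 (fun z => h z.1 * (cis (dot2 z.1 z.2) * g z.2))
   (fun x => n1 (h x)) (fun eta => 2 * n1 (g eta))).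
- apply: eq_cint => eta; rewrite -cintZ; last by apply: iC_cisM => //; exact: measurable_dot2l.
  by apply: eq_cint => x /=; ring.
- apply: mCM; first exact: mC_comp (iC_m ih) measurable_fst.
  apply: mCM; last exact: mC_comp (iC_m ig) measurable_snd.
  exact: mC_cis measurable_dot2.
- exact: iC_n1.
- exact: rIZ (iC_n1 ig).
- move=> x y /=; apply: (le_trans (n1M _ _)); rewrite ler_wpM2l ?n1_ge0//.
  exact: n1_cisM.
Qed.

Lemma iC_damp (d : R) (f : P2 -> C) (M : R) : 0 < d -> mC f -> (forall x, n1 (f x) <= M) ->
  iC mu2 (fun x => (damp d x)%:C * f x).
Proof.
move=> d0 mf b; apply: (iC_le _ (rIZ M (rI_damp d0))).
  by apply: mCM => //; apply: mCR; exact: rI_m (rI_damp d0).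
move=> x; apply: (le_trans (n1M _ _)); rewrite n1R ger0_norm ?damp_ge0// mulrC.
by rewrite ler_wpM2r ?damp_ge0.
Qed.

(** Damping in physical space is convolution with the Poisson kernel in
    frequency. *)
Lemma ift_damp (d : R) (f : P2 -> C) (th : P2) : 0 < d -> iC mu2 f ->
  cint mu2 (fun x => cis (- dot2 x th) * ((damp d x)%:C * ift f x)) =
  cint mu2 (fun eta => f eta * (kern d (psub eta th))%:C).
Proof.
move=> d0 i_f.
have ih : iC mu2 (fun x => cis (- dot2 x th) * (damp d x)%:C).
  apply: iC_cisM; first by apply: measurable_funN; exact: measurable_dot2l.
  by split; [exact: rI_damp|exact: rI0].
transitivity (cint mu2 (fun x => cis (- dot2 x th) * (damp d x)%:C * ift f x)).
  by apply: eq_cint => x; rewrite mulrA.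
rewrite ift_fubini//; apply: eq_cint => eta; congr (_ * _).
rewrite -ft_damp//; apply: eq_cint => x; rewrite mulrA -cisD; congr (cis _ * _).
by rewrite /dot2 /psub /=; ring.
Qed.

Lemma poisson_scale (d y : R) : 0 < d -> d * poisson d (d * y) = 2 * rho1 y.
Proof.
move=> d0; rewrite /poisson /rho1; field.
by rewrite gt_eqF ?oneDsqr_gt0//= gt_eqF// ltr_pwDl ?exprn_gt0 ?sqr_ge0// mulr_gt0// exprn_gt0.
Qed.

Lemma measurable_poisson (d : R) : 0 < d -> measurable_fun setT (poisson d : R -> R).
Proof.
move=> d0; rewrite (_ : poisson d = fun x => (2 / d) * rho1 (d^-1 * x)); last first.
  apply/funext => x; have := poisson_scale (d^-1 * x) d0.
  rewrite mulVKf ?gt_eqF// => h; rewrite mulrAC -h mulrC mulrA mulVf ?mul1r// gt_eqF//.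
apply: measurable_funM => //; apply: measurableT_comp; first exact: measurable_rho1.
exact: measurable_funM.
Qed.

Lemma poisson_bound (d y : R) : 0 < d -> 0 <= poisson d y <= 2 / d.
Proof.
move=> d0; have q : 0 < d ^+ 2 + y ^+ 2 by rewrite ltr_pwDl ?exprn_gt0// sqr_ge0.
rewrite /poisson mulr_ge0 ?divr_ge0 ?(ltW d0) ?(ltW q)//= ler_wpM2l//.
rewrite ler_pdivrMr// mulrDr expr2 mulrA mulVf ?gt_eqF// mul1r lerDl.
by rewrite mulr_ge0 ?sqr_ge0// invr_ge0 ltW.
Qed.

Lemma iC_kern (d : R) (f : P2 -> C) (th : P2) : 0 < d -> iC mu2 f ->
  iC mu2 (fun eta => f eta * (kern d (psub eta th))%:C).
Proof.
move=> d0 i_f; apply: (iC_le _ (rIZ (2 / d * (2 / d)) (iC_n1 i_f))).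
  apply: mCM; first exact: iC_m i_f.
  apply: mCR; apply: measurable_funM.
    apply: (measurableT_comp (measurable_poisson d0)); exact: measurable_funB.
  apply: (measurableT_comp (measurable_poisson d0)); exact: measurable_funB.
move=> eta; apply: (le_trans (n1M _ _)); rewrite n1R mulrC ler_wpM2r ?n1_ge0//.
have /andP[p1 q1] := poisson_bound (psub eta th).1 d0.
have /andP[p2 q2] := poisson_bound (psub eta th).2 d0.
by rewrite (ger0_norm (mulr_ge0 p1 p2)); exact: ler_pM.
Qed.

(** In rescaled variables the Poisson kernel is the fixed density [4 rho], and
    the parameter only appears in the argument of [f], so that the limit can be
    taken by dominated convergence. *)
Lemma kern_rescale (d : R) (f : P2 -> C) (th : P2) : 0 < d -> iC mu2 f ->
  cint mu2 (fun eta => f eta * (kern d (psub eta th))%:C) =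
  cint mu2 (fun y => f (affine2 th d y) * (4 * rho y)%:C).
Proof.
move=> d0 i_f; rewrite (@cint_affine2 _ th d) ?gt_eqF//; last exact: iC_kern.
rewrite -cintZ; last first.
  apply: (@iC_affine2 _ th d (fun eta => f eta * (kern d (psub eta th))%:C)).
    by rewrite gt_eqF.
  exact: iC_kern.
apply: eq_cint => y; rewrite mulrCA; congr (_ * _); rewrite -rcM; congr (_%:C).
have e (u v : R) : u + v - u = v by rewrite addrAC subrr add0r.
rewrite /kern /psub /affine2 /affine /= !e.
by rewrite expr2 mulrACA !poisson_scale// /rho; ring.
Qed.

Definition Irho : R := Rintegral mu2 setT rho.
Lemma Irho_ge0 : 0 <= Irho.
Proof. by apply: Rintegral_ge0 => x _; rewrite ltW ?rho_gt0. Qed.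

Section OneFunction.
Variables (K : R) (f : P2 -> C).
Hypotheses (mf : mC f) (bf : wbound K f).

Let reg (d : R) (th : P2) := cint mu2 (fun y => f (affine2 th d y) * (4 * rho y)%:C).

Let reg_bound_pt d th y : n1 (f (affine2 th d y) * (4 * rho y)%:C) <= K * (4 * rho y).
Proof.
have r0 : 0 <= 4 * rho y by rewrite mulr_ge0// ltW ?rho_gt0.
apply: (le_trans (n1M _ _)); rewrite n1R (ger0_norm r0) ler_wpM2r//.
exact: wbound_le.
Qed.

Let m_reg d th : mC (fun y => f (affine2 th d y) * (4 * rho y)%:C).
Proof.
apply: mCM; first exact: mC_comp mf (measurable_affine2 th d).
by apply: mCR; exact: (rI_m (rIZ 4 rI_rho)).
Qed.

Let iK : rI mu2 (fun y : P2 => K * (4 * rho y)).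
Proof. exact: (rIZ K (rIZ 4 rI_rho)). Qed.

Lemma reg_bound d th : n1 (reg d th) <= 4 * K * Irho.
Proof.
have i : iC mu2 (fun y => f (affine2 th d y) * (4 * rho y)%:C).
  by apply: (iC_le _ iK) (reg_bound_pt d th).
apply: (le_trans (n1_cint_le i iK (reg_bound_pt d th))).
rewrite RintegralZl//; last exact: (rIZ 4 rI_rho).
by rewrite RintegralZl//; [rewrite mulrA (mulrC K)|exact: rI_rho].
Qed.

Lemma cvg_harmonic_affine (a y : R) : (fun n => affine a n.+1%:R^-1 y) @ \oo --> a.
Proof.
rewrite -[X in _ --> X]addr0; apply: cvgD; first exact: cvg_cst.
rewrite -(mul0r y); apply: cvgM; last exact: cvg_cst.
exact: cvg_harmonic.
Qed.

Lemma reg_cvg th : scont f th ->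
  ccvg (fun n => reg n.+1%:R^-1 th) (f th * (4 * Irho)%:C).
Proof.
move=> cf.
have -> : f th * (4 * Irho)%:C = cint mu2 (fun y => f th * (4 * rho y)%:C).
  rewrite cintZ; last by split; [exact: (rIZ 4 rI_rho)|exact: rI0].
  congr (_ * _); apply: C_ext; rewrite ?Re_cint ?Im_cint.
    by rewrite RintegralZl//; exact: rI_rho.
  by rewrite /= Rintegral_cst// mul0r.
apply: (cint_dct _ _ _ iK).
- by move=> n; exact: m_reg.
- apply: mCM; first exact: mC_cst.
  by apply: mCR; exact: (rI_m (rIZ 4 rI_rho)).
- apply: aeW => y; apply: ccvgM; last exact: ccvg_cst.
  by apply: cf; exact: cvg_harmonic_affine.
- by move=> n y; exact: reg_bound_pt.
Qed.

End OneFunction.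

End Regularisation.

(** ** The product formula *)
Section ProductFormula.
Context {R : realType}.
Local Notation C := R[i].
Local Notation mu2 := (@mu2 R).
Local Notation P2 := (measurableTypeR R * measurableTypeR R)%type.

Let reg (d : R) (f : P2 -> C) (th : P2) :=
  cint mu2 (fun y => f (affine2 th d y) * (4 * rho y)%:C).

(** Fubini in [g] only: [f] is left as its regularisation. *)
Lemma ift_damp2 (d K L : R) (f g : P2 -> C) (xi : P2) : 0 < d ->
  mC f -> wbound K f -> mC g -> wbound L g ->
  cint mu2 (fun x => cis (- dot2 x xi) * ((damp d x)%:C * (ift f x * ift g x))) =
  cint mu2 (fun zeta => g zeta * reg d f (psub xi zeta)).
Proof.
move=> d0 mf bf mg bg.
have i_f := iC_wbound mf bf; have ig := iC_wbound mg bg.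
have ih : iC mu2 (fun x => cis (- dot2 x xi) * ((damp d x)%:C * ift f x)).
  apply: iC_cisM; first by apply: measurable_funN; exact: measurable_dot2l.
  by apply: (iC_damp d0 (mC_ift mf)) => x; exact: n1_ift bf.
transitivity (cint mu2
    (fun x => cis (- dot2 x xi) * ((damp d x)%:C * ift f x) * ift g x)).
  by apply: eq_cint => x; rewrite !mulrA.
rewrite (ift_fubini ih ig); apply: eq_cint => zeta; congr (g zeta * _).
rewrite /reg -(kern_rescale _ d0 i_f) -(ift_damp _ d0 i_f); apply: eq_cint => x.
rewrite mulrA -cisD; congr (cis _ * _).
by rewrite /dot2 /psub /=; ring.
Qed.

Lemma mC_reg (d K : R) (f : P2 -> C) : 0 < d -> mC f -> wbound K f -> mC (reg d f).
Proof.
move=> d0 mf bf; have i_f := iC_wbound mf bf.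
rewrite (_ : reg d f = fun th => cint mu2 (fun x =>
   cis (- dot2 x th) * ((damp d x)%:C * ift f x))); last first.
  by apply/funext => th; rewrite ift_damp// kern_rescale.
apply: (@mC_cint2 _ _ _ _ _ mu2
  (fun z : (P2 * P2)%type => cis (- dot2 z.2 z.1) * ((damp d z.2)%:C * ift f z.2))).
apply: mCM; last first.
  have m : mC (fun x : P2 => (damp d x)%:C * ift f x).
    by apply: mCM; [apply: mCR; exact: (rI_m (rI_damp d0))|exact: mC_ift].
  exact: mC_comp m measurable_snd.
apply: mC_cis; apply: measurable_funN.
have sw : measurable_fun setT (fun z : (P2 * P2)%type => (z.2, z.1)).
  by apply: measurable_fun_pair; [exact: measurable_snd|exact: measurable_fst].
exact: (measurableT_comp measurable_dot2 sw).
Qed.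

Lemma ift_damp2_bound (d K L : R) (f g : P2 -> C) (xi : P2) : 0 < d ->
  mC f -> wbound K f -> mC g -> wbound L g ->
  n1 (cint mu2 (fun x => cis (- dot2 x xi) * ((damp d x)%:C * (ift f x * ift g x)))) <=
  4 * K * Irho * (L * Rintegral mu2 setT wt).
Proof.
move=> d0 mf bf mg bg; rewrite (ift_damp2 xi d0 mf bf mg bg).
have i : rI mu2 (fun zeta : P2 => 4 * K * Irho * (L * wt zeta)).
  exact: (rIZ (4 * K * Irho) (rIZ L rI_wt)).
have b zeta : n1 (g zeta * reg d f (psub xi zeta)) <= 4 * K * Irho * (L * wt zeta).
  apply: (le_trans (n1M _ _)); rewrite mulrC; apply: ler_pM; rewrite ?n1_ge0//.
  exact: reg_bound.
apply: (le_trans (n1_cint_le _ i b)).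
  apply: (iC_le _ i b); apply: mCM => //.
  exact: (mC_comp (mC_reg d0 mf bf) (measurable_psub xi)).
by rewrite RintegralZl ?RintegralZl//; [exact: rI_wt|exact: (rIZ L rI_wt)].
Qed.

Lemma ift_damp2_cvg (K L : R) (f g : P2 -> C) (xi : P2) :
  mC f -> wbound K f -> ae_scont f -> mC g -> wbound L g ->
  ccvg (fun n => cint mu2 (fun x =>
     cis (- dot2 x xi) * ((damp n.+1%:R^-1 x)%:C * (ift f x * ift g x))))
   ((4 * Irho)%:C * conv g f xi).
Proof.
move=> mf bf cf mg bg.
have d0 n : 0 < n.+1%:R^-1 :> R by rewrite invr_gt0 ltr0n.
under eq_fun do rewrite (ift_damp2 xi (d0 _) mf bf mg bg).
have -> : (4 * Irho)%:C * conv g f xi =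
    cint mu2 (fun zeta => g zeta * (f (psub xi zeta) * (4 * Irho)%:C)).
  rewrite /conv -cintZ; last exact: (iC_conv xi mg mf bg bf).
  by apply: eq_cint => zeta; ring.
have i : rI mu2 (fun zeta : P2 => 4 * K * Irho * (L * wt zeta)).
  exact: (rIZ (4 * K * Irho) (rIZ L rI_wt)).
apply: (cint_dct _ _ _ i).
- move=> n; apply: mCM => //.
  exact: (mC_comp (mC_reg (d0 n) mf bf) (measurable_psub xi)).
- apply: mCM => //; apply: mCM; last exact: mC_cst.
  exact: mC_psub.
- apply: (aeS (cf xi)) => zeta h; apply: ccvgM; first exact: ccvg_cst.
  exact: (reg_cvg mf bf h).
- move=> n zeta; apply: (le_trans (n1M _ _)); rewrite mulrC.
  by apply: ler_pM; rewrite ?n1_ge0//; exact: reg_bound.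
Qed.

Definition sqn (z : C) : R := complex.Re z ^+ 2 + complex.Im z ^+ 2.
Lemma sqn_ge0 z : 0 <= sqn z. Proof. by rewrite addr_ge0 ?sqr_ge0. Qed.

Lemma damp_cvg (x : P2) : (fun n => damp n.+1%:R^-1 x) @ \oo --> (1 : R).
Proof.
have h (a : R) : (fun n => expR (- (n.+1%:R^-1 * a))) @ \oo --> (1 : R).
  rewrite -[X in _ --> X]expR0; apply: continuous_cvg; first exact: continuous_expR.
  rewrite -[X in _ --> X]oppr0 -[X in _ --> - X](mul0r a); apply: cvgN; apply: cvgM; last exact: cvg_cst.
  exact: cvg_harmonic.
by rewrite -[X in _ --> X]mulr1; apply: cvgM; exact: h.
Qed.

Lemma damp_nd (x : P2) : nondecreasing_seq (fun n => damp n.+1%:R^-1 x).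
Proof.
move=> m n mn; rewrite /damp ler_pM ?expR_ge0// ler_expR lerN2 ler_wpM2r//;
by rewrite lef_pV2 ?posrE ?ltr0n// ler_nat ltnS.
Qed.

(** The damped integrals of [|ift f|^2] are the values at frequency 0 of the
    regularised product formula for [f] and its reflection, hence bounded, and
    they increase to the full integral. *)
Lemma rI_sqn_ift (K : R) (f : P2 -> C) : mC f -> wbound K f ->
  rI mu2 (fun x => sqn (ift f x)).
Proof.
move=> mf bf.
have mq : measurable_fun setT (fun x : P2 => sqn (ift f x)).
  have [m1 m2] := mC_ift mf.
  by apply: measurable_funD; apply: measurable_funX.
pose B := 4 * K * Irho * (K * Rintegral mu2 setT (@wt R)).
have d0 n : 0 < n.+1%:R^-1 :> R by rewrite invr_gt0 ltr0n.
have idn n : rI mu2 (fun x => damp n.+1%:R^-1 x * sqn (ift f x)).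
  pose M := 2 * K * Rintegral mu2 setT (@wt R).
  apply: (rI_le _ (rIZ (M ^+ 2) (rI_damp (d0 n)))) => [|x].
    by apply: measurable_funM => //; exact: (rI_m (rI_damp (d0 n))).
  rewrite ger0_norm ?mulr_ge0 ?damp_ge0 ?sqn_ge0// mulrC ler_wpM2r ?damp_ge0//.
  apply: (@le_trans _ _ (n1 (ift f x) ^+ 2)).
    rewrite /n1 /sqn sqrrD !real_normK ?num_real// lerD2r lerDl mulrn_wge0//.
  by rewrite ler_pXn2r ?nnegrE ?n1_ge0 ?(le_trans (n1_ge0 _) (n1_ift x mf bf)) ?n1_ift.
(* The product formula at frequency 0, where the character is 1. *)
have bn n : Rintegral mu2 setT (fun x => damp n.+1%:R^-1 x * sqn (ift f x)) <= B.
  have := ift_damp2_bound 0 (d0 n) mf bf (mC_refl mf) (wbound_refl bf).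
  apply: le_trans; apply: le_trans (Re_n1 _); rewrite Re_cint.
  apply: le_trans (ler_norm _).
  rewrite le_eqVlt; apply/orP; left; apply/eqP; apply: eq_Rintegral => x _.
  have d00 : dot2 x 0 = 0 by rewrite /dot2 /= !mulr0 addr0.
  rewrite (ift_refl _ mf bf) d00 oppr0 cis0 mul1r.
  by rewrite !ReImE mul0r subr0 mulrN opprK -!expr2.
apply/integrableP; split; first by apply/measurable_EFinP.
have E : (\int[mu2]_x `|(sqn (ift f x))%:E| =
   \int[mu2]_x limn (fun n => (damp n.+1%:R^-1 x * sqn (ift f x))%:E))%E.
  apply: eq_integral => x _; rewrite gee0_abs ?lee_fin ?sqn_ge0//.
  apply/esym/cvg_lim => //; apply: cvg_EFin; first exact: nearW.
  rewrite -[X in _ --> X]mul1r; apply: cvgM; [exact: damp_cvg|exact: cvg_cst].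
rewrite E monotone_convergence//; last 3 first.
- by move=> n; apply/measurable_EFinP; exact: rI_m (idn n).
- by move=> n x _; rewrite lee_fin mulr_ge0 ?damp_ge0 ?sqn_ge0.
- move=> x _ m n mn; rewrite lee_fin ler_wpM2r ?sqn_ge0//; exact: damp_nd.
apply: (@le_lt_trans _ _ B%:E); last exact: ltry.
apply: lime_le.
  apply: ereal_nondecreasing_is_cvgn => m n mn; apply: ge0_le_integral => //.
  - by move=> x _; rewrite lee_fin mulr_ge0 ?damp_ge0 ?sqn_ge0.
  - by apply/measurable_EFinP; exact: rI_m (idn m).
  - by apply/measurable_EFinP; exact: rI_m (idn n).
  - by move=> x _; rewrite lee_fin ler_wpM2r ?sqn_ge0//; exact: damp_nd.
apply: nearW => n; rewrite -(fineK (integrable_fin_num measurableT (idn n))) lee_fin.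
exact: bn.
Qed.

Lemma n1M_sqn z w : n1 (z * w) <= sqn z + sqn w.
Proof.
rewrite /n1 /sqn !ReImE.
set a := complex.Re z; set b := complex.Im z; set c := complex.Re w; set d := complex.Im w.
have h1 : `|a * c - b * d| <= (a ^+ 2 + b ^+ 2 + (c ^+ 2 + d ^+ 2)) / 2.
  have := sqr_ge0 (a + c); have := sqr_ge0 (a - c); have := sqr_ge0 (b + d).
  have := sqr_ge0 (b - d); rewrite !sqrrD !sqrrN !mulrN.
  by rewrite ler_norml => *; apply/andP; split; lra.
have h2 : `|a * d + b * c| <= (a ^+ 2 + b ^+ 2 + (c ^+ 2 + d ^+ 2)) / 2.
  have := sqr_ge0 (a + d); have := sqr_ge0 (a - d); have := sqr_ge0 (b + c).
  have := sqr_ge0 (b - c); rewrite !sqrrD !sqrrN !mulrN.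
  by rewrite ler_norml => *; apply/andP; split; lra.
lra.
Qed.

(** By [rI_sqn_ift] both factors are square integrable. *)
Lemma iC_ift_mul (K L : R) (f g : P2 -> C) : mC f -> wbound K f -> mC g -> wbound L g ->
  iC mu2 (fun x => ift f x * ift g x).
Proof.
move=> mf bf mg bg.
apply: (iC_le _ (rID (rI_sqn_ift mf bf) (rI_sqn_ift mg bg))).
  by apply: mCM; exact: mC_ift.
by move=> x; exact: n1M_sqn.
Qed.

Lemma ft_ift_mul (K L : R) (f g : P2 -> C) (xi : P2) :
  mC f -> wbound K f -> ae_scont f -> mC g -> wbound L g ->
  cint mu2 (fun x => cis (- dot2 x xi) * (ift f x * ift g x)) =
  (4 * Irho)%:C * conv g f xi.
Proof.
move=> mf bf cf mg bg.
apply: (ccvg_unique _ (ift_damp2_cvg xi mf bf cf mg bg)).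
have i := iC_ift_mul mf bf mg bg.
have d0 n : 0 < n.+1%:R^-1 :> R by rewrite invr_gt0 ltr0n.
have mchar : mC (fun x : P2 => cis (- dot2 x xi)).
  by apply: mC_cis; apply: measurable_funN; exact: measurable_dot2l.
apply: (cint_dct _ _ _ (rIZ 2 (iC_n1 i))).
- move=> n; apply: mCM => //; apply: mCM; last exact: iC_m i.
  by apply: mCR; exact: (rI_m (rI_damp (d0 n))).
- by apply: mCM => //; exact: iC_m i.
- apply: aeW => x; apply: ccvgM; first exact: ccvg_cst.
  rewrite -[X in ccvg _ X]mul1r; apply: ccvgM; last exact: ccvg_cst.
  exact: (ccvgR (damp_cvg x)).
- move=> n x; apply: (le_trans (n1_cisM _ _)); rewrite ler_wpM2l//.
  apply: (le_trans (n1M _ _)); rewrite n1R ger0_norm ?damp_ge0//.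
  by rewrite ler_piMl ?n1_ge0// damp_le1// ltW.
Qed.

(** Since [Irho] is [pi^2], this is [(2 pi)^-2]. *)
Definition kappa0 : R := (((2 * pi) ^+ 2)^-1) ^+ 2 * (4 * Irho).

Lemma inv_fourierE (f : R * R -> C) x :
  inv_fourier f x = (((2 * pi) ^+ 2)^-1)%:C * ift f x.
Proof. by []. Qed.

(** The damped integrals converge to the left-hand side by dominated
    convergence, the product being integrable, and to the right-hand side because
    the Poisson regularisation of [g] converges at its points of continuity. *)
Lemma fourier_inv_fourier_mul (K L : R) (f g : P2 -> C) (xi : P2) :
  mC f -> wbound K f -> mC g -> wbound L g -> ae_scont g ->
  fourier (fun x => inv_fourier f x * inv_fourier g x) xi = kappa0%:C * conv f g xi.
Proof.
move=> mf bf mg bg cg.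
set c := (((2 * pi) ^+ 2)^-1)%:C : C.
transitivity (cint mu2 (fun x => (c * c) * (cis (- dot2 x xi) * (ift g x * ift f x)))).
  by rewrite /fourier Cint2E; apply: eq_cint => x; rewrite !inv_fourierE; ring.
rewrite cintZ; last first.
  apply: iC_cisM; first by apply: measurable_funN; exact: measurable_dot2l.
  exact: iC_ift_mul bg mf bf.
by rewrite (ft_ift_mul xi mg bg cg mf bf) mulrA /kappa0 !rcM.
Qed.

Lemma iC_inv_fourier_mul (K L : R) (f g : P2 -> C) :
  mC f -> wbound K f -> mC g -> wbound L g ->
  iC mu2 (fun x => inv_fourier f x * inv_fourier g x).
Proof.
move=> mf bf mg bg.
set c := (((2 * pi) ^+ 2)^-1)%:C : C.
rewrite (_ : (fun x => _) = fun x => (c * c) * (ift f x * ift g x)); last first.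
  by apply/funext => x; rewrite !inv_fourierE; ring.
by apply: iCZ; exact: iC_ift_mul bf mg bg.
Qed.

Lemma inv_fourier_refl (K : R) (f : P2 -> C) x : mC f -> wbound K f ->
  inv_fourier (refl f) x = conjc (inv_fourier f x).
Proof.
move=> mf bf; rewrite !inv_fourierE (ift_refl x mf bf) cJM; congr (_ * _).
by apply: C_ext; rewrite !ReImE ?oppr0.
Qed.

End ProductFormula.

(** * Space-time fields dominated by the weight *)
Section Fields.
Context {R : realType}.
Local Notation C := R[i].
Local Notation leb := (@lebesgue_measure R).
Local Notation mu2 := (@mu2 R).
Local Notation P2 := (measurableTypeR R * measurableTypeR R)%type.
Local Notation mR := (measurableTypeR R).

(** Points where fields are allowed to be discontinuous in frequency. *)
Variable Z : P2 -> Prop.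
Hypothesis Z_ae : forall xi, {ae mu2, forall eta, ~ Z (psub xi eta)}.
Hypothesis Z_opp : forall xi, Z (- xi) -> Z xi.
Hypothesis Z_0 : Z 0.

(** Continuity in time is left out of the notion: it is a consequence of the
    Duhamel formula ([duh_lip]). *)
Record fld (K : R) (u : R -> P2 -> C) : Prop := Fld {
  fld_m : mC (fun z : (mR * P2)%type => u z.1 z.2);
  fld_b : forall t, wbound K (u t);
  fld_c : forall t xi, ~ Z xi -> scont (u t) xi }.

Record symb (M : R) (c : P2 -> C) : Prop := Symb {
  symb_m : mC c;
  symb_b : forall xi, n1 (c xi) <= M;
  symb_c : forall xi, ~ Z xi -> scont c xi }.

Lemma scontD f g (xi : P2) : scont f xi -> scont g xi -> scont (fun x => f x + g x) xi.
Proof. by move=> hf hg x h1 h2; apply: ccvgD; [exact: hf|exact: hg]. Qed.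
Lemma scontM f g (xi : P2) : scont f xi -> scont g xi -> scont (fun x => f x * g x) xi.
Proof. by move=> hf hg x h1 h2; apply: ccvgM; [exact: hf|exact: hg]. Qed.
Lemma scont_cst c (xi : P2) : scont (fun=> c) xi.
Proof. by move=> x _ _; exact: ccvg_cst. Qed.

Lemma symb_cst c : symb (n1 c) (fun=> c).
Proof. by split=> //; move=> *; exact: scont_cst. Qed.

Lemma symb_le M M' c : symb M c -> M <= M' -> symb M' c.
Proof. by move=> [h1 h2 h3] h; split=> // xi; exact: le_trans (h2 xi) h. Qed.

Lemma fld_ge0 K u : fld K u -> 0 <= K.
Proof. by move=> [_ /(_ 0) h _]; exact: wbound_ge0 h. Qed.

Lemma fld_le K K' u : fld K u -> K <= K' -> fld K' u.
Proof.
move=> [h1 h2 h3] h; split=> // t xi; apply: (le_trans (h2 t xi)).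
by rewrite ler_wpM2r ?wt_ge0.
Qed.

Lemma fld_mt K u t : fld K u -> mC (u t).
Proof.
move=> [h _ _]; apply: (mC_comp (phi := fun xi : P2 => (t, xi) : (mR * P2)%type) h).
exact: measurable_fun_pair.
Qed.

Lemma fld_ae K u t : fld K u -> ae_scont (u t).
Proof. by move=> h xi; apply: (aeS (Z_ae xi)) => eta; exact: fld_c h t _. Qed.

Lemma fld0 : fld 0 (fun _ _ => 0).
Proof.
split; first exact: mC_cst.
  by move=> t xi; rewrite n1_0 mul0r.
by move=> *; exact: scont_cst.
Qed.

Lemma fldD K L u v : fld K u -> fld L v -> fld (K + L) (fun t xi => u t xi + v t xi).
Proof.
move=> hu hv; split.
- exact: mCD (fld_m hu) (fld_m hv).
- move=> t xi; apply: (le_trans (n1D _ _)); rewrite mulrDl.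
  by apply: lerD; [exact: fld_b hu t xi|exact: fld_b hv t xi].
- by move=> t xi hz; apply: scontD; [exact: fld_c hu t _ hz|exact: fld_c hv t _ hz].
Qed.

Lemma fldM M K c u : symb M c -> fld K u -> fld (M * K) (fun t xi => c xi * u t xi).
Proof.
move=> hc hu; split.
- apply: mCM; last exact: fld_m hu.
  exact: (mC_comp (symb_m hc) measurable_snd).
- move=> t xi; apply: (le_trans (n1M _ _)); rewrite -mulrA.
  by apply: ler_pM; rewrite ?n1_ge0//; [exact: symb_b|exact: fld_b hu t xi].
- by move=> t xi hz; apply: scontM; [exact: symb_c hc _ hz|exact: fld_c hu t _ hz].
Qed.

Lemma fld_refl K u : fld K u -> fld K (fun t => refl (u t)).
Proof.
move=> hu; split.
- apply: mCJ.
  apply: (mC_comp (phi := fun z : (mR * P2)%type => (z.1, - z.2) : (mR * P2)%type) (fld_m hu)).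
  apply: measurable_fun_pair; first exact: measurable_fst.
  exact: (measurableT_comp measurable_oppxi measurable_snd).
- by move=> t; exact: wbound_refl (fld_b hu t).
- move=> t xi hz x h1 h2; apply: ccvgJ.
  by apply: (fld_c hu t (fun h => hz (Z_opp h))); exact: cvgN.
Qed.

(** By dominated convergence a convolution is continuous at every point, also at
    the discontinuities of its factors. *)
Lemma scont_conv K L f g (xi : P2) : mC f -> wbound K f -> mC g -> wbound L g ->
  (forall xi, {ae mu2, forall eta, scont g (psub xi eta)}) -> scont (conv f g) xi.
Proof.
move=> mf bf mg bg cg x h1 h2.
have i : rI mu2 (fun eta : P2 => L * (K * wt eta)) by exact: (rIZ L (rIZ K rI_wt)).
apply: (cint_dct _ _ _ i).
- by move=> n; apply: mCM => //; exact: mC_psub.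
- by apply: mCM => //; exact: mC_psub.
- apply: (aeS (cg xi)) => eta h; apply: ccvgM; first exact: ccvg_cst.
  by apply: h; apply: cvgB => //; exact: cvg_cst.
- move=> n eta; apply: (le_trans (n1M _ _)); rewrite mulrC.
  by apply: ler_pM; rewrite ?n1_ge0//; exact: wbound_le.
Qed.

Lemma fld_conv K L u v : fld K u -> fld L v ->
  fld (cw * (K * L)) (fun t => conv (u t) (v t)).
Proof.
move=> hu hv; split.
- apply: (@mC_cint2 _ _ _ _ _ mu2
    (fun z : ((mR * P2) * P2)%type => u z.1.1 z.2 * v z.1.1 (psub z.1.2 z.2))).
  apply: mCM.
    apply: (mC_comp (phi := fun z : ((mR * P2) * P2)%type => (z.1.1, z.2) : (mR * P2)%type) (fld_m hu)).
    apply: measurable_fun_pair; last exact: measurable_snd.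
    exact: (measurableT_comp measurable_fst measurable_fst).
  apply: (mC_comp (phi := fun z : ((mR * P2) * P2)%type =>
     (z.1.1, psub z.1.2 z.2) : (mR * P2)%type) (fld_m hv)).
  have m12 : measurable_fun setT (fun z : ((mR * P2) * P2)%type => z.1.2).
    exact: (measurableT_comp measurable_snd measurable_fst).
  apply: measurable_fun_pair; first exact: (measurableT_comp measurable_fst measurable_fst).
  apply: measurable_fun_pair; apply: measurable_funB.
  + exact: (measurableT_comp measurable_fst m12).
  + exact: (measurableT_comp measurable_fst measurable_snd).
  + exact: (measurableT_comp measurable_snd m12).
  + exact: (measurableT_comp measurable_snd measurable_snd).
- move=> t; apply: wbound_conv; [exact: fld_mt hu|exact: fld_mt hv|exact: fld_b hu t|exact: fld_b hv t].
- move=> t xi _.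
  exact: (scont_conv (fld_mt t hu) (fld_b hu t) (fld_mt t hv) (fld_b hv t) (fld_ae t hv)).
Qed.

(** ** The oriented time integral *)

(** With this signed indicator the oriented integral from 0 to [t] becomes an
    integral over the line, whose integrand is jointly measurable. *)
Definition osgn (t s : R) : R :=
  if 0 <= t then (if 0 <= s then (if s <= t then 1 else 0) else 0)
  else (if t <= s then (if s <= 0 then -1 else 0) else 0).

Lemma measurable_osgn : measurable_fun setT (fun z : (mR * mR)%type => osgn z.1 z.2).
Proof.
have m1 : measurable_fun setT (fun z : (mR * mR)%type => z.1) by exact: measurable_fst.
have m2 : measurable_fun setT (fun z : (mR * mR)%type => z.2) by exact: measurable_snd.
have mc (c : R) : measurable_fun setT (fun _ : (mR * mR)%type => c) by [].
rewrite /osgn; apply: measurable_fun_ifT; first exact: measurable_fun_ler.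
  apply: measurable_fun_ifT => //; first exact: measurable_fun_ler.
  by apply: measurable_fun_ifT => //; exact: measurable_fun_ler.
apply: measurable_fun_ifT => //; first exact: measurable_fun_ler.
by apply: measurable_fun_ifT => //; exact: measurable_fun_ler.
Qed.

Lemma measurable_osgn_t t : measurable_fun setT (osgn t : mR -> R).
Proof.
apply: (measurableT_comp measurable_osgn (g := fun s : mR => (t, s) : (mR * mR)%type)).
exact: measurable_fun_pair.
Qed.

Definition between (s t r : R) : R :=
  if Num.min s t <= r then (if r <= Num.max s t then 1 else 0) else 0.

Lemma rI_between s t : rI leb (between s t) /\ Rintegral leb setT (between s t) = `|t - s|.
Proof.
have E : between s t = \1_(`[Num.min s t, Num.max s t]%classic).
  apply/funext => r; rewrite /between indicE.
  case: ifPn => h1; last by rewrite memNset//= in_itv /= (negbTE h1).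
  case: ifPn => h2; last by rewrite memNset//= in_itv /= (negbTE h2) andbF.
  by rewrite mem_set//= in_itv /= h1 h2.
have hmm : Num.min s t <= Num.max s t by rewrite ge_min le_max lexx.
have hl : leb (`[Num.min s t, Num.max s t]%classic : set R) =
    (Num.max s t - Num.min s t)%:E.
  rewrite lebesgue_measure_itv /= lte_fin EFinB; case: ltP => // h.
  by rewrite -EFinB (le_anti (introT andP (conj h hmm))) subrr.
split.
  rewrite E; apply/integrableP; split; first by apply/measurable_EFinP.
  under eq_integral => r _ do rewrite gee0_abs ?lee_fin//.
  rewrite integral_indic// setIT.
  apply: (@le_lt_trans _ _ (Num.max s t - Num.min s t)%:E); last exact: ltry.
  by rewrite le_eqVlt; apply/orP; left; apply/eqP; exact: hl.
rewrite /Rintegral E integral_indic// setIT.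
transitivity (fine (Num.max s t - Num.min s t)%:E); first by congr fine; exact: hl.
by rewrite /= maxr_absE minr_absE (distrC s t); field.
Qed.

Lemma osgn_between t s : `|osgn t s| <= between 0 t s.
Proof.
rewrite /osgn /between; case: (leP 0 t) => t0.
  by case: ifP => _; [case: ifP => _|]; rewrite ?normr1 ?normr0.
case: ifP => h1; last by rewrite normr0.
by case: ifP => h2; rewrite ?normrN1 ?normr0.
Qed.

Lemma osgn_gt t r : r < t -> osgn t r = if 0 <= r then 1 else 0.
Proof.
move=> rt; rewrite /osgn (ltW rt) leNgt.
case: (ltP t 0) => t0 /=; last by [].
by rewrite leNgt rt /= leNgt (lt_trans rt t0).
Qed.

Lemma osgn_lt t r : t < r -> osgn t r = if r <= 0 then -1 else 0.
Proof.
move=> tr; rewrite /osgn (ltW tr) [r <= t]leNgt tr /=.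
case: (leP 0 t) => t0; last by [].
by rewrite if_same leNgt (le_lt_trans t0 tr).
Qed.

Lemma osgn_le1 t r : `|osgn t r| <= 1.
Proof.
apply: (le_trans (osgn_between t r)); rewrite /between.
by case: ifP => // _; case: ifP.
Qed.

Lemma osgnB_between s t r : `|osgn t r - osgn s r| <= 2 * between s t r.
Proof.
rewrite /between; case: (leP (Num.min s t) r) => h1; last first.
  move: h1; rewrite lt_min => /andP[h1 h2].
  by rewrite !osgn_gt// subrr normr0 mulr0.
case: (leP r (Num.max s t)) => h2; last first.
  move: h2; rewrite gt_max => /andP[h2 h3].
  by rewrite !osgn_lt// subrr normr0 mulr0.
by rewrite mulr1 (le_trans (ler_normB _ _))// (lerD (osgn_le1 _ _) (osgn_le1 _ _)).
Qed.

Lemma rI_osgn t (g : R -> R) (M : R) : measurable_fun setT (g : mR -> R) ->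
  (forall s, `|g s| <= M) -> rI leb (fun s => osgn t s * g s).
Proof.
move=> mg b; apply: (rI_le _ (rIZ M (rI_between 0 t).1)) => [|s].
  by apply: measurable_funM => //; exact: measurable_osgn_t.
by rewrite normrM mulrC ler_pM// osgn_between.
Qed.

Lemma Rint0E t (f : R -> R) (M : R) : measurable_fun setT (f : mR -> R) ->
  (forall s, `|f s| <= M) ->
  Defs.Rint0 t f = Rintegral leb setT (fun s => osgn t s * f s).
Proof.
move=> mf b; have i := rI_osgn t mf b.
rewrite /Defs.Rint0; case: ifPn => t0.
  rewrite Rintegral_mkcond; apply: eq_Rintegral => s _.
  rewrite /osgn t0 patchE; case: ifPn; rewrite ?inE ?notin_setE /= in_itv /=.
    by move=> /andP[-> ->]; rewrite mul1r.
  by move/negP; case: ifP => _ /=; [case: ifP => _ //=|]; rewrite mul0r.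
rewrite Rintegral_mkcond -mulN1r.
have E : (f \_ `[t, 0]) = fun s => -1 * (osgn t s * f s).
  apply/funext => s; rewrite /osgn (negbTE t0) patchE; case: ifPn;
    rewrite ?inE ?notin_setE /= in_itv /=.
    by move=> /andP[-> ->]; rewrite !mulN1r opprK.
  by move/negP; case: ifP => _ /=; [case: ifP => _ //=|]; rewrite mul0r mulr0.
by rewrite E RintegralZl// !mulN1r opprK.
Qed.

Lemma Cint0E t (f : R -> C) (M : R) : mC (f : mR -> C) -> (forall s, n1 (f s) <= M) ->
  Defs.Cint0 t f = cint leb (fun s => (osgn t s)%:C * f s).
Proof.
move=> [m1 m2] b; apply: C_ext; rewrite /Defs.Cint0 ?Re_cint ?Im_cint /=.
  rewrite (Rint0E t m1 (fun s => le_trans (Re_n1 _) (b s))).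
  by apply: eq_Rintegral => s _; rewrite !ReImE mul0r subr0.
rewrite (Rint0E t m2 (fun s => le_trans (Im_n1 _) (b s))).
by apply: eq_Rintegral => s _; rewrite !ReImE mul0r addr0.
Qed.

(** ** The Duhamel operator *)

Variable T : R.
Hypothesis T0 : 0 < T.

Lemma n1_half_wave b t xi : n1 (half_wave b t xi : C) <= 2.
Proof. exact: n1_cis. Qed.

Lemma enorm_ge0 (xi : R * R) : 0 <= enorm xi. Proof. exact: sqrtr_ge0. Qed.

Lemma measurable_enorm : measurable_fun setT (fun xi : P2 => enorm xi).
Proof.
apply: (measurableT_comp (f := @Num.sqrt R)).
  by apply: continuous_measurable_fun; exact: sqrt_continuous.
by apply: measurable_funD; apply: measurable_funX.
Qed.

Lemma cvg_enorm (x : nat -> R * R) (xi : P2) :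
  (fun n => (x n).1) @ \oo --> xi.1 -> (fun n => (x n).2) @ \oo --> xi.2 ->
  (fun n => enorm (x n)) @ \oo --> enorm xi.
Proof.
move=> h1 h2; apply: (cvg_comp (fun n => (x n).1 ^+ 2 + (x n).2 ^+ 2) (@Num.sqrt R));
  last exact: sqrt_continuous.
by apply: cvgD; apply: cvgM.
Qed.

(** The integral kernel of the Duhamel operator. *)
Definition prop b (t : R) (xi : P2) (s : R) : C :=
  (osgn t s)%:C * half_wave b (t - s) xi.

Lemma n1_prop b t xi s : n1 (prop b t xi s) <= 2 * between 0 t s.
Proof.
apply: (le_trans (n1M _ _)); rewrite n1R mulrC.
by apply: ler_pM; rewrite ?n1_ge0 ?osgn_between ?n1_half_wave.
Qed.

(** The truncation to [[-T, T]] makes the bounds uniform over all times. *)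
Definition duh b (G : R -> P2 -> C) (t : R) (xi : P2) : C :=
  if `|t| <= T then cint leb (fun s => prop b t xi s * G s xi) else 0.

Lemma mC_half_wave b (phi : (mR * P2 * mR)%type -> R) :
  measurable_fun setT phi -> mC (fun z => half_wave b (phi z) z.1.2 : C).
Proof.
move=> mphi; apply: mC_cis; apply: measurable_funN; apply: measurable_funM.
  by apply: measurable_funM => //; exact: measurable_cst.
apply: (measurableT_comp measurable_enorm).
exact: (measurableT_comp measurable_snd measurable_fst).
Qed.

Lemma mC_prop b : mC (fun z : (mR * P2 * mR)%type => prop b z.1.1 z.1.2 z.2).
Proof.
have m11 : measurable_fun setT (fun z : (mR * P2 * mR)%type => z.1.1).
  exact: (measurableT_comp measurable_fst measurable_fst).
apply: mCM; last by apply: mC_half_wave; apply: measurable_funB => //; exact: measurable_snd.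
apply: mCR; apply: (measurableT_comp measurable_osgn
  (g := fun z : (mR * P2 * mR)%type => (z.1.1, z.2) : (mR * mR)%type)).
by apply: measurable_fun_pair => //; exact: measurable_snd.
Qed.

Lemma mC_prop_t b t xi : mC (prop b t xi : mR -> C).
Proof.
apply: (mC_comp (phi := fun s : mR => ((t, xi), s) : (mR * P2 * mR)%type) (mC_prop b)).
by apply: measurable_fun_pair.
Qed.

Lemma fld_mxi K u xi : fld K u -> mC (fun s : mR => u s xi).
Proof.
move=> [h _ _]; apply: (mC_comp (phi := fun s : mR => (s, xi) : (mR * P2)%type) h).
exact: measurable_fun_pair.
Qed.

Lemma duh_bound_pt b t xi (K : R) (G : R -> P2 -> C) s :
  wbound K (G s) -> n1 (prop b t xi s * G s xi) <= 2 * K * wt xi * between 0 t s.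
Proof.
move=> h; apply: (le_trans (n1M _ _)).
apply: (le_trans (ler_pM (n1_ge0 _) (n1_ge0 _) (n1_prop _ _ _ _) (h xi))).
by rewrite le_eqVlt; apply/orP; left; apply/eqP; ring.
Qed.

Lemma iC_duh b t xi K G : fld K G -> iC leb (fun s => prop b t xi s * G s xi).
Proof.
move=> hG; apply: (iC_le _ (rIZ (2 * K * wt xi) (rI_between 0 t).1)).
  by apply: mCM; [exact: mC_prop_t|exact: fld_mxi hG].
by move=> s; apply: duh_bound_pt; exact: fld_b hG s.
Qed.

Lemma duh_wbound b K G : (forall t, wbound K (G t)) ->
  (forall t xi, iC leb (fun s => prop b t xi s * G s xi)) ->
  forall t, wbound (2 * T * K) (duh b G t).
Proof.
move=> bG iG t xi; rewrite /duh; case: ifP => ht; last first.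
  by rewrite n1_0 mulr_ge0 ?wt_ge0// mulr_ge0 ?(wbound_ge0 (bG 0))// mulr_ge0// ltW.
apply: (le_trans (n1_cint_le (iG t xi) (rIZ (2 * K * wt xi) (rI_between 0 t).1) _)).
  by move=> s; exact: duh_bound_pt.
rewrite RintegralZl//; last exact: (rI_between 0 t).1.
rewrite (rI_between 0 t).2 subr0.
have k0 := wbound_ge0 (bG 0); have w0 := wt_ge0 xi.
apply: (@le_trans _ _ (2 * K * wt xi * T)).
  by rewrite ler_wpM2l// mulr_ge0// mulr_ge0.
by rewrite le_eqVlt; apply/orP; left; apply/eqP; ring.
Qed.

Lemma fld_duh b K G : fld K G -> fld (2 * T * K) (duh b G).
Proof.
move=> hG; split.
- have mF : mC (fun z : (mR * P2 * mR)%type => prop b z.1.1 z.1.2 z.2 * G z.2 z.1.2).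
    apply: mCM; first exact: mC_prop.
    apply: (mC_comp (phi := fun z : (mR * P2 * mR)%type => (z.2, z.1.2) : (mR * P2)%type) (fld_m hG)).
    apply: measurable_fun_pair; first exact: measurable_snd.
    exact: (measurableT_comp measurable_snd measurable_fst).
  have [m1 m2] := mC_cint2 leb mF.
  have mt : measurable_fun setT (fun z : (mR * P2)%type => `|z.1| <= T).
    apply: measurable_fun_ler => //.
    by apply: measurableT_comp => //; exact: measurable_fst.
  rewrite /duh; split.
    rewrite (_ : (fun z => _) = fun z : (mR * P2)%type => if `|z.1| <= T then
      complex.Re (cint leb (fun y => prop b (z, y).1.1 (z, y).1.2 (z, y).2 *
        G (z, y).2 (z, y).1.2)) else 0); last by apply/funext => z; case: ifP.
    by apply: measurable_fun_ifT => //; exact: measurable_cst.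
  rewrite (_ : (fun z => _) = fun z : (mR * P2)%type => if `|z.1| <= T then
      complex.Im (cint leb (fun y => prop b (z, y).1.1 (z, y).1.2 (z, y).2 *
        G (z, y).2 (z, y).1.2)) else 0); last by apply/funext => z; case: ifP.
  by apply: measurable_fun_ifT => //; exact: measurable_cst.
- apply: duh_wbound; first exact: fld_b hG.
  by move=> t xi; exact: iC_duh hG.
- move=> t xi hz x h1 h2; rewrite /duh; case: ifP => ht; last exact: ccvg_cst.
  have k0 := fld_ge0 hG.
  apply: (cint_dct _ _ _ (rIZ (2 * K) (rI_between 0 t).1)).
  + by move=> n; apply: mCM; [exact: mC_prop_t|exact: fld_mxi hG].
  + by apply: mCM; [exact: mC_prop_t|exact: fld_mxi hG].
  + apply: aeW => s; apply: ccvgM; last exact: fld_c hG s _ hz _ h1 h2.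
    apply: ccvgM; first exact: ccvg_cst.
    apply: ccvg_cis; apply: cvgN; apply: cvgM; first exact: cvg_cst.
    exact: cvg_enorm.
  + move=> n s; apply: (le_trans (duh_bound_pt b t (x n) (fld_b hG s))).
    have b0 : 0 <= between 0 t s by rewrite /between; case: ifP => // _; case: ifP.
    by rewrite ler_wpM2r// ler_piMr ?wt_le1// mulr_ge0.
Qed.

Lemma duhE b K G t xi : fld K G -> `|t| <= T ->
  duh b G t xi = Defs.Cint0 t (fun s => half_wave b (t - s) xi * G s xi).
Proof.
move=> hG ht; rewrite /duh ht (Cint0E t (M := 2 * K)).
- by apply: eq_cint => s; rewrite mulrA.
- apply: mCM; last exact: fld_mxi hG.
  have m : measurable_fun setT (fun z : (mR * P2 * mR)%type => t - z.2).
    by apply: measurable_funB; [exact: measurable_cst|exact: measurable_snd].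
  apply: (mC_comp (phi := fun s : mR => ((t, xi), s) : (mR * P2 * mR)%type) (mC_half_wave b m)).
  exact: measurable_fun_pair.
- move=> s; apply: (le_trans (n1M _ _)); apply: ler_pM; rewrite ?n1_ge0 ?n1_half_wave//.
  exact: wbound_le (fld_b hG s).
Qed.

Lemma duhB b K L G H t xi : fld K G -> fld L H ->
  duh b G t xi - duh b H t xi = duh b (fun s z => G s z - H s z) t xi.
Proof.
move=> hG hH; rewrite /duh; case: ifP => _; last by rewrite subrr.
rewrite -cintB; [|exact: iC_duh hG|exact: iC_duh hH].
by apply: eq_cint => s; rewrite mulrBr.
Qed.

(** ** Pairs of fields close to each other *)

(** [lp K d u v]: two fields of size [K] at distance [d].  The estimates on
    the nonlinearity and on its differences are the same statement about [lp],
    and bounds on a single field are the case [u = v]. *)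
Record lp (K d : R) (u v : R -> P2 -> C) : Prop := Lp {
  lp1 : fld K u;
  lp2 : fld K v;
  lpd : forall t, wbound d (fun xi => u t xi - v t xi) }.

Lemma lp_ge0 K d u v : lp K d u v -> 0 <= d.
Proof. by move=> [_ _ /(_ 0)]; exact: wbound_ge0. Qed.

Lemma lp_le K K' d d' u v : lp K d u v -> K <= K' -> d <= d' -> lp K' d' u v.
Proof.
move=> [h1 h2 h3] h h'; split; [exact: fld_le h1 h|exact: fld_le h2 h|].
move=> t xi; apply: (le_trans (h3 t xi)); by rewrite ler_wpM2r ?wt_ge0.
Qed.

Lemma lp_refl0 K u : fld K u -> lp K 0 u u.
Proof. by move=> h; split=> // t xi; rewrite subrr n1_0 mul0r. Qed.

Lemma fldB K L u v : fld K u -> fld L v -> fld (K + L) (fun t xi => u t xi - v t xi).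
Proof.
move=> hu hv.
have hc : symb 1 (fun=> -1 : C).
  by apply: (symb_le (symb_cst (-1))); rewrite n1N /n1 /= normr1 normr0 addr0.
have := fldD hu (fldM hc hv); rewrite mul1r.
congr fld; apply/funext => t; apply/funext => xi; by rewrite mulN1r.
Qed.

Lemma lpD K d u v K' d' u' v' : lp K d u v -> lp K' d' u' v' ->
  lp (K + K') (d + d') (fun t xi => u t xi + u' t xi) (fun t xi => v t xi + v' t xi).
Proof.
move=> [h1 h2 h3] [h4 h5 h6]; split; [exact: fldD|exact: fldD|].
move=> t xi; rewrite opprD addrACA (le_trans (n1D _ _))// mulrDl.
by apply: lerD; [exact: h3|exact: h6].
Qed.

Lemma lp0 : lp 0 0 (fun _ _ => 0) (fun _ _ => 0).
Proof. by apply: lp_refl0; exact: fld0. Qed.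

Lemma lp_sum (I : Type) (r : seq I) K d (u v : I -> R -> P2 -> C) :
  (forall i, lp K d (u i) (v i)) ->
  lp ((size r)%:R * K) ((size r)%:R * d)
     (fun t xi => \sum_(i <- r) u i t xi) (fun t xi => \sum_(i <- r) v i t xi).
Proof.
move=> h; elim: r => [|i r ih] /=.
  rewrite !mul0r; have := lp0; congr lp; apply/funext => t; apply/funext => xi;
  by rewrite big_nil.
rewrite -natr1 !mulrDl !mul1r ![_ + K]addrC ![_ + d]addrC.
have := lpD (h i) ih; congr lp; apply/funext => t; apply/funext => xi;
by rewrite big_cons.
Qed.

Lemma lpM M K d c u v : symb M c -> lp K d u v ->
  lp (M * K) (M * d) (fun t xi => c xi * u t xi) (fun t xi => c xi * v t xi).
Proof.
move=> hc [h1 h2 h3]; split; [exact: fldM|exact: fldM|].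
move=> t xi; rewrite -mulrBr (le_trans (n1M _ _))// -mulrA.
by apply: ler_pM; rewrite ?n1_ge0 ?(symb_b hc)//; exact: h3.
Qed.

Lemma lp_comb (I : finType) M K d (c : I -> P2 -> C) (u v : I -> R -> P2 -> C) :
  (forall i, symb M (c i)) -> (forall i, lp K d (u i) (v i)) ->
  lp (#|I|%:R * (M * K)) (#|I|%:R * (M * d))
     (fun t xi => \sum_i c i xi * u i t xi) (fun t xi => \sum_i c i xi * v i t xi).
Proof.
move=> hc h.
have := @lp_sum I (index_enum I) (M * K) (M * d) (fun i t xi => c i xi * u i t xi)
  (fun i t xi => c i xi * v i t xi) (fun i => lpM (hc i) (h i)).
by rewrite cardT enumT [index_enum I]unlock.
Qed.

Lemma lp_reflect K d u v : lp K d u v -> lp K d (fun t => refl (u t)) (fun t => refl (v t)).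
Proof.
move=> [h1 h2 h3]; split; [exact: fld_refl|exact: fld_refl|].
move=> t xi; rewrite /refl.
have -> : conjc (u t (- xi)) - conjc (v t (- xi)) = conjc (u t (- xi) - v t (- xi)).
  by apply: C_ext; rewrite !ReImE//; ring.
by rewrite n1J -(wtN xi); exact: h3.
Qed.

Lemma lp_conv K d u v L e u' v' : lp K d u v -> lp L e u' v' ->
  lp (cw * (K * L)) (cw * (K * e + L * d))
    (fun t => conv (u t) (u' t)) (fun t => conv (v t) (v' t)).
Proof.
move=> [h1 h2 h3] [h4 h5 h6]; split; [exact: fld_conv|exact: fld_conv|].
move=> t.
have m1 := fld_mt t h1; have m2 := fld_mt t h2; have m4 := fld_mt t h4; have m5 := fld_mt t h5.
have b1 := fld_b h1 t; have b2 := fld_b h2 t; have b4 := fld_b h4 t; have b5 := fld_b h5 t.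
have md : mC (fun xi => u t xi - v t xi) by exact: mCB.
have md' : mC (fun xi => u' t xi - v' t xi) by exact: mCB.
have w1 := wbound_conv md m4 (h3 t) b4.
have w2 := wbound_conv m2 md' b2 (h6 t).
move=> xi.
have -> : conv (u t) (u' t) xi - conv (v t) (v' t) xi =
  conv (fun xi => u t xi - v t xi) (u' t) xi + conv (v t) (fun xi => u' t xi - v' t xi) xi.
  rewrite /conv -cintB; [|exact: iC_conv m1 m4 b1 b4|exact: iC_conv m2 m5 b2 b5].
  rewrite -cintD; [|exact: iC_conv md m4 (h3 t) b4|exact: iC_conv m2 md' b2 (h6 t)].
  by apply: eq_cint => eta; ring.
apply: (le_trans (n1D _ _)); apply: (le_trans (lerD (w1 xi) (w2 xi))).
by rewrite le_eqVlt; apply/orP; left; apply/eqP; ring.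
Qed.

Lemma lp_duh b K d u v : lp K d u v -> lp (2 * T * K) (2 * T * d) (duh b u) (duh b v).
Proof.
move=> [h1 h2 h3]; split; [exact: fld_duh|exact: fld_duh|].
move=> t xi; rewrite (duhB b t xi h1 h2).
apply: (@duh_wbound b d (fun s z => u s z - v s z)); first exact: h3.
by move=> t' xi'; exact: (iC_duh b t' xi' (fldB h1 h2)).
Qed.

End Fields.

(** * Picard iteration *)
Section RealSequences.
Context {R : realType}.
Local Notation C := R[i].

Lemma cvg_of_geometric (x : nat -> R) (c : R) :
  (forall n, `|x n.+1 - x n| <= c / 2 ^+ n) -> exists l : R, x @ \oo --> l.
Proof.
move=> h; apply/cvg_ex.
have hs : cvgn (series (telescope x)).
  apply: normed_cvg; apply: (@series_le_cvg _ _ (geometric c 2^-1)) => //.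
  - by move=> n; exact: normr_ge0.
  - by move=> n; rewrite /geometric/= exprVn; exact: le_trans (normr_ge0 _) (h n).
  - by move=> n; rewrite /geometric/= exprVn; exact: h.
  - by apply: is_cvg_geometric_series; rewrite ger0_norm// invf_lt1// ltr1n.
have -> : x = fun n => series (telescope x) n + x 0%N.
  by apply/funext => n; rewrite telescopeK subrK.
by apply: is_cvgD => //; exact: is_cvg_cst.
Qed.

Lemma ccvg_of_geometric (z : nat -> C) (c : R) :
  (forall n, n1 (z n.+1 - z n) <= c / 2 ^+ n) -> exists l, ccvg z l.
Proof.
move=> h.
have [a ha] : exists l : R, (fun n => complex.Re (z n)) @ \oo --> l.
  by apply: (cvg_of_geometric (c := c)) => n; rewrite -cReN -cReD (le_trans (Re_n1 _)).
have [b hb] : exists l : R, (fun n => complex.Im (z n)) @ \oo --> l.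
  by apply: (cvg_of_geometric (c := c)) => n; rewrite -cImN -cImD (le_trans (Im_n1 _)).
by exists (a +i* b).
Qed.

Lemma ccvg_shiftn n (z : nat -> C) l : ccvg z l -> ccvg (fun k => z (k + n)%N) l.
Proof.
case=> h1 h2; split.
  by have := h1; rewrite -(cvg_shiftn n).
by have := h2; rewrite -(cvg_shiftn n).
Qed.

Lemma geometric_tail (z : nat -> C) (c : R) l :
  (forall n, n1 (z n.+1 - z n) <= c / 2 ^+ n) -> ccvg z l ->
  forall n, n1 (l - z n) <= 2 * c / 2 ^+ n.
Proof.
move=> h hl n.
have hk k : n1 (z (k + n)%N - z n) <= 2 * c / 2 ^+ n - 2 * c / 2 ^+ (k + n).
  elim: k => [|k ih]; first by rewrite add0n !subrr n1_0.
  rewrite addSn -(subrK (z (k + n)%N) (z _)) -addrA.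
  apply: (le_trans (n1D _ _)); apply: (le_trans (lerD (h _) ih)).
  rewrite le_eqVlt; apply/orP; left; apply/eqP.
  by rewrite exprS invfM; move: ((2 ^+ (k + n))^-1) ((2 ^+ n)^-1) => q q'; field.
apply: (@ccvg_le _ (fun k => z (k + n)%N - z n)).
  apply: ccvgB; last exact: ccvg_cst.
  exact: ccvg_shiftn.
move=> k; apply: (le_trans (hk k)); rewrite lerBlDr lerDl.
have c0 : 0 <= c.
  by have := le_trans (n1_ge0 _) (h 0%N); rewrite expr0 divr1.
by rewrite mulr_ge0 ?invr_ge0 ?exprn_ge0// mulr_ge0.
Qed.

Lemma cvg_geo0 (c : R) : (fun n => c / 2 ^+ n) @ \oo --> (0 : R).
Proof.
rewrite -[X in _ --> X](mulr0 c); apply: cvgM; first exact: cvg_cst.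
under eq_fun do rewrite -exprVn.
by apply: cvg_expr; rewrite ger0_norm ?invr_ge0// invf_lt1// ltr1n.
Qed.

Lemma cos_lip (a b : R) : `|cos a - cos b| <= `|a - b|.
Proof.
wlog ba : a b / b <= a => [hw|].
  by have [/hw//|/ltW/hw h] := leP b a; rewrite distrC (distrC a).
have cc : {within `[b, a], continuous (@cos R)}.
  by apply: continuous_subspaceT => x; exact: continuous_cos.
have [c _ ->] := MVT_segment ba (fun x _ => is_derive_cos x) cc.
by rewrite normrM normrN ler_piMl// ler_norml sin_geN1 sin_le1.
Qed.

Lemma sin_lip (a b : R) : `|sin a - sin b| <= `|a - b|.
Proof.
wlog ba : a b / b <= a => [hw|].
  by have [/hw//|/ltW/hw h] := leP b a; rewrite distrC (distrC a).
have cc : {within `[b, a], continuous (@sin R)}.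
  by apply: continuous_subspaceT => x; exact: continuous_sin.
have [c _ ->] := MVT_segment ba (fun x _ => is_derive_sin x) cc.
by rewrite normrM ler_piMl// ler_norml cos_geN1 cos_le1.
Qed.

Lemma cis_lip (a b : R) : n1 (cis a - cis b) <= 2 * `|a - b|.
Proof. by rewrite /n1 !ReImE mulrDl !mul1r lerD ?cos_lip ?sin_lip. Qed.

End RealSequences.

Section PicardIteration.
Context {R : realType}.
Local Notation C := R[i].
Local Notation leb := (@lebesgue_measure R).
Local Notation mu2 := (@mu2 R).
Local Notation P2 := (measurableTypeR R * measurableTypeR R)%type.
Local Notation mR := (measurableTypeR R).
Variable Z : P2 -> Prop.
Hypothesis Z_ae : forall xi, {ae mu2, forall eta, ~ Z (psub xi eta)}.
Hypothesis Z_opp : forall xi, Z (- xi) -> Z xi.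
Variable T : R.
Hypothesis T0 : 0 < T.
Local Notation fld := (fld Z).
Local Notation lp := (lp Z).

Lemma scont_unif (f_ : nat -> P2 -> C) (f : P2 -> C) (e : nat -> R) xi :
  (forall n xi, n1 (f xi - f_ n xi) <= e n) -> e @ \oo --> (0 : R) ->
  (forall n, scont (f_ n) xi) -> scont f xi.
Proof.
move=> h he hc x h1 h2; apply/ccvg_n1.
apply/cvgrPdist_le => eps e0.
have [N _ /(_ N (leqnn N)) hN] : \forall n \near \oo, `|0 - e n| <= eps / 4.
  by move/cvgrPdist_le : he; apply; rewrite divr_gt0.
have e4 : e N <= eps / 4 by move: hN; rewrite sub0r normrN; exact: le_trans (ler_norm _).
have /ccvg_n1 := hc N x h1 h2; move/cvgrPdist_le => /(_ (eps / 4)) H.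
have /H : 0 < eps / 4 by rewrite divr_gt0.
apply: filterS => k; rewrite !sub0r !normrN !(ger0_norm (n1_ge0 _)) => hk.
have -> : f (x k) - f xi = (f (x k) - f_ N (x k)) + ((f_ N (x k) - f_ N xi) +
   (f_ N xi - f xi)) by ring.
apply: (le_trans (n1D _ _)); have := n1D (f_ N (x k) - f_ N xi) (f_ N xi - f xi).
have := h N (x k); have := h N xi; rewrite (n1BC (f xi)) => *; lra.
Qed.

(** The limit is uniform in frequency, the weight being bounded, so continuity
    survives. *)
Lemma fld_lim (u_ : nat -> R -> P2 -> C) (u : R -> P2 -> C) K c :
  (forall n, fld K (u_ n)) ->
  (forall n t xi, n1 (u_ n.+1 t xi - u_ n t xi) <= c / 2 ^+ n * wt xi) ->
  (forall t xi, ccvg (fun n => u_ n t xi) (u t xi)) ->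
  0 <= c -> fld K u.
Proof.
move=> hf hd hl c0; split.
- apply: (@mC_lim _ _ _ (fun n (z : (mR * P2)%type) => u_ n z.1 z.2)).
    by move=> n; exact: fld_m (hf n).
  by move=> z; exact: hl.
- move=> t xi; apply: (ccvg_le (hl t xi)) => n; exact: fld_b (hf n) t xi.
- move=> t xi hz.
  apply: (@scont_unif (fun n => u_ n t) (u t) (fun n => 2 * c / 2 ^+ n)).
  + move=> n xi'; apply: (geometric_tail _ (hl t xi')) => m.
    apply: (le_trans (hd m t xi')); rewrite ler_piMr ?wt_le1//.
    by rewrite mulr_ge0// invr_ge0 exprn_ge0.
  + exact: cvg_geo0.
  + by move=> n; exact: fld_c (hf n) t _ hz.
Qed.

(** The condition on [k] makes the map a contraction of ratio 1/2 on the fields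
    of size [2 k]. *)
Lemma picard (I : Type) (N : (I -> R -> P2 -> C) -> I -> R -> P2 -> C) (Cn k : R)
    (f0 : I -> R -> P2 -> C) :
  0 <= Cn -> 0 < k -> 8 * Cn * k ^+ 2 <= 1 ->
  (forall K d U V, (forall i, lp K d (U i) (V i)) ->
     forall i, lp (Cn * K ^+ 3) (Cn * K ^+ 2 * d) (N U i) (N V i)) ->
  (forall i, fld k (f0 i)) ->
  exists U : I -> R -> P2 -> C, (forall i, fld (2 * k) (U i)) /\
    forall i t xi, U i t xi = f0 i t xi + N U i t xi.
Proof.
move=> C0 k0 hk HN Hf0.
pose Phi U i t xi := f0 i t xi + N U i t xi.
pose it n := iter n Phi f0.
have k3 : Cn * (2 * k) ^+ 3 <= k.
  have -> : Cn * (2 * k) ^+ 3 = (8 * Cn * k ^+ 2) * k by ring.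
  by rewrite ler_piMl// ltW.
have hPhi U : (forall i, fld (2 * k) (U i)) -> forall i, fld (2 * k) (Phi U i).
  move=> hU i; have h := lp1 (HN _ _ _ _ (fun j => lp_refl0 (hU j)) i).
  apply: (fld_le (fldD (Hf0 i) h)); lra.
have hf n : forall i, fld (2 * k) (it n i).
  elim: n => [|n ih] i; last exact: hPhi.
  by apply: (fld_le (Hf0 i)); lra.
(* Successive differences are halved at each step. *)
have hd n : forall i t, wbound (k / 2 ^+ n) (fun xi => it n.+1 i t xi - it n i t xi).
  elim: n => [|n ih] i t xi.
    rewrite /it /= /Phi addrAC subrr add0r expr0 divr1.
    have h := lp1 (HN _ _ _ _ (fun j => lp_refl0 (hf 0%N j)) i).
    by apply: (le_trans (fld_b h t xi)); rewrite ler_wpM2r ?wt_ge0.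
  have hl j : lp (2 * k) (k / 2 ^+ n) (it n.+1 j) (it n j) by split.
  have h := lpd (HN _ _ _ _ hl i) t xi.
  have -> : it n.+2 i t xi - it n.+1 i t xi = N (it n.+1) i t xi - N (it n) i t xi.
    by rewrite /it /= /Phi; ring.
  apply: (le_trans h); rewrite ler_wpM2r ?wt_ge0//.
  have p : 0 < (2 : R) ^+ n by rewrite exprn_gt0.
  have -> : Cn * (2 * k) ^+ 2 * (k / 2 ^+ n) = (8 * Cn * k ^+ 2) * (k / 2 ^+ n.+1).
    by rewrite [2 ^+ n.+1]exprS invfM; move: ((2 ^+ n)^-1) => q; field.
  by rewrite ler_piMl// divr_ge0 ?(ltW k0)// exprn_ge0.
have hgeo i t xi n : n1 (it n.+1 i t xi - it n i t xi) <= (k * wt xi) / 2 ^+ n.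
  by apply: (le_trans (hd n i t xi)); rewrite mulrAC.
have /choice[U1 hU1] : forall p : I * R * P2, exists l, ccvg (fun n => it n p.1.1 p.1.2 p.2) l.
  by move=> p; apply: (ccvg_of_geometric (c := k * wt p.2)) => n; exact: hgeo.
pose U i t xi := U1 (i, t, xi).
have hU i t xi : ccvg (fun n => it n i t xi) (U i t xi) by exact: (hU1 (i, t, xi)).
have fU i : fld (2 * k) (U i).
  apply: (@fld_lim (fun n => it n i) (U i) _ k) => //; last exact: ltW.
  by move=> n t xi; exact: hd.
exists U; split=> // i t xi.
have hlp n j : lp (2 * k) (2 * k / 2 ^+ n) (U j) (it n j).
  split=> // t' xi'; apply: (le_trans (geometric_tail (hgeo j t' xi') (hU j t' xi') n)).
  by rewrite le_eqVlt; apply/orP; left; apply/eqP; ring.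
have l1 : ccvg (fun n => it n.+1 i t xi) (U i t xi).
  have := ccvg_shiftn 1 (hU i t xi); congr ccvg.
  by apply/funext => n; rewrite addn1.
apply: (ccvg_unique l1); apply: ccvgD; first exact: ccvg_cst.
apply: (@ccvg_squeeze _ _ _ (fun n => Cn * (2 * k) ^+ 2 * (2 * k) * wt xi / 2 ^+ n)); last exact: cvg_geo0.
move=> n; rewrite n1BC; apply: (le_trans (lpd (HN _ _ _ _ (hlp n) i) t xi)).
by rewrite le_eqVlt; apply/orP; left; apply/eqP; ring.
Qed.

Lemma half_waveD b t s xi : half_wave b (t + s) xi = half_wave b t xi * half_wave b s xi :> C.
Proof. by rewrite /half_wave -cisD; congr cis; ring. Qed.

Lemma half_wave_lip b t s xi :
  n1 (half_wave b t xi - half_wave b s xi : C) <= 2 * (`|t - s| * enorm xi).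
Proof.
apply: (le_trans (cis_lip _ _)); rewrite ler_wpM2l//.
have -> : - (sg R b * t * enorm xi) - - (sg R b * s * enorm xi) =
  - (sg R b * ((t - s) * enorm xi)) by ring.
rewrite normrN !normrM (ger0_norm (enorm_ge0 xi)) /sg normrX normrN1 expr1n mul1r//.
Qed.

(** The propagator is a group, so the Duhamel integral is the propagator at time
    [t] applied to an integral of a function independent of [t].  The integral
    is Lipschitz in its end point, and the propagator in time at the cost of one
    derivative. *)
Lemma duh_lip b K G t s xi : fld K G -> `|t| <= T -> `|s| <= T ->
  n1 (duh T b G t xi - duh T b G s xi) <=
  (4 * T + 8) * K * `|t - s| * ((1 + enorm xi) * wt xi).
Proof.
move=> hG ht hs.
have K0 := fld_ge0 hG; have w0 := wt_ge0 xi; have e0 := enorm_ge0 xi.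
pose H r : C := half_wave b (- r) xi * G r xi.
have mH : mC (H : mR -> C).
  apply: mCM; last exact: fld_mxi hG.
  apply: mC_cis; apply: measurable_funN; apply: measurable_funM; last exact: measurable_cst.
  by apply: measurable_funM; [exact: measurable_cst|exact: measurable_funN].
have bH r : n1 (H r) <= 2 * K * wt xi.
  apply: (le_trans (n1M _ _)); rewrite -mulrA.
  apply: ler_pM; rewrite ?n1_ge0 ?n1_cis//; exact: fld_b hG r xi.
have iH c : iC leb (fun r => (osgn c r)%:C * H r).
  apply: (iC_le _ (rIZ (2 * K * wt xi) (rI_between 0 c).1)) => [|r].
    by apply: mCM => //; apply: mCR; exact: measurable_osgn_t.
  by apply: (le_trans (n1M _ _)); rewrite n1R mulrC ler_pM ?n1_ge0 ?osgn_between.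
pose J c := cint leb (fun r => (osgn c r)%:C * H r).
have dE c : `|c| <= T -> duh T b G c xi = half_wave b c xi * J c.
  move=> hc; rewrite /duh hc /J -cintZ//; apply: eq_cint => r.
  by rewrite /prop half_waveD /H; ring.
have bJ c : `|c| <= T -> n1 (J c) <= 2 * K * wt xi * T.
  move=> hc; apply: (le_trans (n1_cint_le (iH c) (rIZ (2 * K * wt xi) (rI_between 0 c).1) _)).
    by move=> r; apply: (le_trans (n1M _ _)); rewrite n1R mulrC ler_pM ?n1_ge0 ?osgn_between.
  rewrite RintegralZl//; last exact: (rI_between 0 c).1.
  by rewrite (rI_between 0 c).2 subr0 ler_wpM2l// mulr_ge0// mulr_ge0.
have dJ : n1 (J t - J s) <= 4 * K * wt xi * `|t - s|.
  rewrite /J -cintB//.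
  have b4 r : n1 ((osgn t r)%:C * H r - (osgn s r)%:C * H r) <= 4 * K * wt xi * between s t r.
    have -> : (osgn t r)%:C * H r - (osgn s r)%:C * H r = (osgn t r - osgn s r)%:C * H r.
      by rewrite rcD mulrDl; congr (_ + _); apply: C_ext; rewrite !ReImE; ring.
    apply: (le_trans (n1M _ _)); rewrite n1R.
    apply: (le_trans (ler_pM (normr_ge0 _) (n1_ge0 _) (osgnB_between s t r) (bH r))).
    by rewrite le_eqVlt; apply/orP; left; apply/eqP; ring.
  apply: (le_trans (n1_cint_le _ (rIZ (4 * K * wt xi) (rI_between s t).1) b4)).
    apply: (iC_le _ (rIZ (4 * K * wt xi) (rI_between s t).1) b4).
    by apply: mCB; [exact: iC_m (iH t)|exact: iC_m (iH s)].
  rewrite RintegralZl//; last exact: (rI_between s t).1.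
  by rewrite (rI_between s t).2.
rewrite !dE//.
have -> : half_wave b t xi * J t - half_wave b s xi * J s =
  (half_wave b t xi - half_wave b s xi) * J t + half_wave b s xi * (J t - J s) by ring.
apply: (le_trans (n1D _ _)).
have a1 := le_trans (n1M (half_wave b t xi - half_wave b s xi) (J t))
  (ler_pM (n1_ge0 _) (n1_ge0 _) (half_wave_lip b t s xi) (bJ t ht)).
have a2 := le_trans (n1M (half_wave b s xi) (J t - J s))
  (ler_pM (n1_ge0 _) (n1_ge0 _) (n1_half_wave b s xi) dJ).
apply: (le_trans (lerD a1 a2)).
have -> : (4 * T + 8) * K * `|t - s| * ((1 + enorm xi) * wt xi) =
  2 * (`|t - s| * enorm xi) * (2 * K * wt xi * T) + 2 * (4 * K * wt xi * `|t - s|) +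
  (K * `|t - s| * wt xi * (4 * T + 8 * enorm xi)) by ring.
have p : 0 <= 4 * T + 8 * enorm xi by rewrite addr_ge0// mulr_ge0// ltW.
by rewrite lerDl; apply: mulr_ge0 => //; apply: mulr_ge0 => //; exact: mulr_ge0.
Qed.

End PicardIteration.

(** * The nonlinearity of the Chern-Simons-Dirac system *)
Section Coefficients.
Context {R : realType}.
Local Notation C := R[i].
Local Notation P2 := (measurableTypeR R * measurableTypeR R)%type.

Lemma cJK (z : C) : conjc (conjc z) = z.
Proof. by apply: C_ext; rewrite !ReImE ?opprK. Qed.

Lemma enorm_eq0 (xi : R * R) : enorm xi = 0 -> xi = 0.
Proof.
move/eqP; rewrite /enorm sqrtr_eq0 => h.
have := sqr_ge0 xi.1; have := sqr_ge0 xi.2 => h1 h2.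
have e1 : xi.1 ^+ 2 = 0 by lra.
have e2 : xi.2 ^+ 2 = 0 by lra.
by case: xi {h h1 h2} e1 e2 => a b /= /eqP; rewrite sqrf_eq0 => /eqP -> /eqP;
  rewrite sqrf_eq0 => /eqP ->.
Qed.

Lemma crd_le_enorm j (xi : R * R) : `|crd xi j| <= enorm xi.
Proof.
rewrite -sqrtr_sqr /enorm; rewrite ler_sqrt; last by rewrite addr_ge0 ?sqr_ge0.
by rewrite /crd; case: ifP => _; rewrite ?lerDl ?lerDr sqr_ge0.
Qed.

Lemma riesz_le1 j (xi : R * R) : `|riesz j xi| <= 1.
Proof.
rewrite /riesz normrM normfV (ger0_norm (enorm_ge0 xi)).
have [->|n0] := eqVneq (enorm xi) 0; first by rewrite invr0 mulr0.
by rewrite ler_pdivrMr ?mul1r ?crd_le_enorm// lt_neqAle eq_sym n0 enorm_ge0.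
Qed.

Lemma measurable_crd j : measurable_fun setT (fun xi : P2 => crd xi j).
Proof. by rewrite /crd; case: (j == ord0); [exact: measurable_fst|exact: measurable_snd]. Qed.

Lemma measurable_inv_enorm : measurable_fun setT (fun xi : P2 => (enorm xi)^-1).
Proof.
rewrite (_ : (fun xi => _) = (fun xi : P2 => enorm xi `^ (-1))).
  exact: (measurableT_comp (f := fun x : R => x `^ (-1)) (measurable_powR (-1)) measurable_enorm).
by apply/funext => xi; rewrite powR_inv1// enorm_ge0.
Qed.

Lemma n1_alpha mu k l : n1 (alpha R mu k l) <= 1.
Proof.
rewrite /alpha mxE; case: (val mu) => [|[|n]].
- by rewrite /n1; case: eqP => _; rewrite !ReImE ?normr1 ?normr0 ?addr0 ?ler01.
- by rewrite /n1; case: eqP => _; rewrite !ReImE ?normr1 ?normr0 ?addr0 ?ler01.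
- case: ifP => _; first by rewrite n1_0.
  by case: ifP => _; rewrite /n1 !ReImE ?normrN ?oppr0 ?normr1 ?normr0 ?add0r.
Qed.

Lemma normr_sg b : `|sg R b| = 1.
Proof. by rewrite /sg normrX normrN1 expr1n. Qed.

Lemma Pi_E b (xi : R * R) k l : Pi_ b xi k l =
  2^-1 * ((k == l)%:R + (sg R b)%:C * ((riesz ord0 xi)%:C * alpha R (spatial ord0) k l +
    (riesz (lift ord0 ord0) xi)%:C * alpha R (spatial (lift ord0 ord0)) k l)).
Proof.
by rewrite !mxE summxE 2!big_ord_recl big_ord0 addr0 !mxE.
Qed.

Lemma n1_half : n1 (2^-1 : C) = 2^-1.
Proof.
have -> : (2^-1 : C) = (2^-1 : R)%:C.
  have h : (2 : C) != 0 by rewrite pnatr_eq0.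
  by apply: (mulfI h); rewrite mulfV//; apply: C_ext; rewrite !ReImE /=; field.
by rewrite n1R ger0_norm// invr_ge0.
Qed.

Lemma n1_bool (b : bool) : n1 (b%:R : C) <= 1.
Proof. by case: b; rewrite /n1 !ReImE ?normr1 ?normr0 ?addr0 ?ler01. Qed.

Lemma kappa0_ge0 : 0 <= @kappa0 R.
Proof. by rewrite mulr_ge0 ?sqr_ge0// mulr_ge0// Irho_ge0. Qed.

Lemma eps_le mu nu la : `|eps R mu nu la| <= 4.
Proof.
have h (a b : 'I_3) : `|((a : nat)%:R - (b : nat)%:R : R)| <= 2.
  have ha : ((a : nat)%:R : R) <= 2 by rewrite ler_nat -ltnS.
  have hb : ((b : nat)%:R : R) <= 2 by rewrite ler_nat -ltnS.
  have ha0 : 0 <= ((a : nat)%:R : R) by rewrite ler0n.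
  have hb0 : 0 <= ((b : nat)%:R : R) by rewrite ler0n.
  by rewrite ler_norml; apply/andP; split; lra.
rewrite /eps !normrM.
have := ler_pM (mulr_ge0 (normr_ge0 _) (normr_ge0 _)) (normr_ge0 _)
  (ler_pM (normr_ge0 _) (normr_ge0 _) (h nu mu) (h la mu)) (h la nu).
rewrite (ger0_norm (_ : 0 <= 2^-1 :> R)) ?invr_ge0//; lra.
Qed.

Lemma conjc_alpha mu k l : conjc (alpha R mu k l) = alpha R mu l k.
Proof.
rewrite /alpha !mxE eq_sym; case: (val mu) => [|[|n]].
- by case: eqP => _; apply: C_ext; rewrite !ReImE ?oppr0.
- by case: eqP => _; apply: C_ext; rewrite !ReImE ?oppr0.
- by case: k => [[|[|//]] ?]; case: l => [[|[|//]] ?];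
    rewrite -!val_eqE /=; apply: C_ext; rewrite /= ?oppr0 ?opprK.
Qed.

Lemma conjc_sum (I : Type) (r : seq I) (F : I -> C) :
  conjc (\sum_(i <- r) F i) = \sum_(i <- r) conjc (F i).
Proof. by rewrite rmorph_sum. Qed.

Lemma enormN (xi : R * R) : enorm (- xi) = enorm xi.
Proof. by rewrite /enorm /= !sqrrN. Qed.

Lemma R_opp b mu (xi : R * R) : R_ b mu (- xi) = R_ (~~ b) mu xi.
Proof.
rewrite /R_; case: (unlift _ _) => // j; rewrite /riesz enormN.
have -> : crd (- xi) j = - crd xi j by rewrite /crd; case: ifP.
have -> : sg R (~~ b) = - sg R b by rewrite /sg; case: b; rewrite ?opprK.
by ring.
Qed.

Lemma conjc_half_wave b t (xi : R * R) : conjc (half_wave b t xi) = half_wave (~~ b) t (- xi).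
Proof.
rewrite /half_wave -cisN enormN.
have -> : sg R (~~ b) = - sg R b by rewrite /sg; case: b; rewrite ?opprK.
by congr cis; ring.
Qed.

Lemma cJ0 : conjc 0 = 0 :> C. Proof. by apply: C_ext; rewrite !ReImE ?oppr0. Qed.
Lemma cJ_R (x : R) : conjc x%:C = x%:C. Proof. by apply: C_ext; rewrite !ReImE ?oppr0. Qed.

Lemma current_sum (a : 'I_2 -> C) mu nu :
  - 2 * \sum_(la < 3) (eps R mu nu la)%:C *
    ((map_mx conjc (\col_k a k))^T *m alpha R la *m (\col_k a k)) ord0 ord0 =
  \sum_(p : 'I_3 * ('I_2 * 'I_2)) - 2 * (eps R mu nu p.1)%:C * alpha R p.1 p.2.1 p.2.2 *
     (conjc (a p.2.1) * a p.2.2).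
Proof.
rewrite -(pair_big xpredT xpredT (fun la (q : 'I_2 * 'I_2) =>
  - 2 * (eps R mu nu la)%:C * alpha R la q.1 q.2 * (conjc (a q.1) * a q.2))) /=.
rewrite big_distrr /=; apply: eq_bigr => la _.
rewrite -(pair_big xpredT xpredT (fun k l =>
  - 2 * (eps R mu nu la)%:C * alpha R la k l * (conjc (a k) * a l))) /=.
rewrite mxE exchange_big /= 2!big_distrr /=; apply: eq_bigr => l _.
rewrite ![in LHS]mxE big_distrl 2!big_distrr /=; apply: eq_bigr => k _.
by rewrite 2!mxE [(\col_k a k) _ _]mxE; ring.
Qed.

(** The matrices [alpha] are Hermitian: conjugation exchanges the indices of the
    spinor components. *)
Lemma current_sum_real (a : 'I_2 -> C) mu nu :
  conjc (\sum_(p : 'I_3 * ('I_2 * 'I_2)) - 2 * (eps R mu nu p.1)%:C *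
     alpha R p.1 p.2.1 p.2.2 * (conjc (a p.2.1) * a p.2.2)) =
  \sum_(p : 'I_3 * ('I_2 * 'I_2)) - 2 * (eps R mu nu p.1)%:C * alpha R p.1 p.2.1 p.2.2 *
     (conjc (a p.2.1) * a p.2.2).
Proof.
rewrite conjc_sum (reindex_inj (h := fun p : 'I_3 * ('I_2 * 'I_2) => (p.1, (p.2.2, p.2.1)))) /=;
  last by move=> [x [b c]] [x' [b' c']] /= [-> -> ->].
apply: eq_bigr => -[la [k l]] _ /=; rewrite !cJM conjc_alpha cJK cJ_R.
have -> : conjc (- 2 : C) = - 2 by apply: C_ext; rewrite !ReImE; ring.
by move: (conjc (a k)) (a l) => x y; ring.
Qed.

End Coefficients.

Section Symbols.
Context {R : realType}.
Local Notation C := R[i].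
Local Notation P2 := (measurableTypeR R * measurableTypeR R)%type.
Variable Z : P2 -> Prop.
Hypothesis Z_0 : Z 0.
Local Notation symb := (symb Z).

Lemma symbD M M' c c' : symb M c -> symb M' c' -> symb (M + M') (fun xi => c xi + c' xi).
Proof.
move=> [h1 h2 h3] [h4 h5 h6]; split; first exact: mCD.
  by move=> xi; rewrite (le_trans (n1D _ _))// lerD.
by move=> xi hz; apply: scontD; [exact: h3|exact: h6].
Qed.

Lemma symbM M M' c c' : symb M c -> symb M' c' -> symb (M * M') (fun xi => c xi * c' xi).
Proof.
move=> [h1 h2 h3] [h4 h5 h6]; split; first exact: mCM.
  by move=> xi; rewrite (le_trans (n1M _ _))// ler_pM ?n1_ge0.
by move=> xi hz; apply: scontM; [exact: h3|exact: h6].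
Qed.

Lemma symb_cst_le c M : n1 c <= M -> symb M (fun=> c).
Proof. by move=> h; apply: symb_le h; exact: symb_cst. Qed.

Lemma symb_riesz j : symb 1 (fun xi => (riesz j xi)%:C).
Proof.
split.
- apply: mCR; apply: measurable_funM; [exact: measurable_crd|exact: measurable_inv_enorm].
- by move=> xi; rewrite n1R riesz_le1.
- move=> xi hz x h1 h2; apply: ccvgR; rewrite /riesz; apply: cvgM.
    by rewrite /crd; case: ifP.
  apply: cvgV; last exact: cvg_enorm.
  by apply/eqP => /enorm_eq0 e; apply: hz; rewrite e.
Qed.

(** The Riesz symbols are homogeneous of degree 0: they are continuous except at
    the origin, which belongs to [Z]. *)
Lemma symb_R b mu : symb 1 (fun xi => (R_ b mu xi)%:C).
Proof.
rewrite /R_; case: (unlift _ _) => [j|]; last first.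
  by apply: symb_cst_le; rewrite n1R normrN normr1.
rewrite (_ : (fun xi => _) = fun xi => (- sg R b)%:C * (riesz j xi)%:C); last first.
  by apply/funext => xi; rewrite -rcM mulNr.
rewrite -(mul1r 1); apply: symbM; last exact: symb_riesz.
by apply: symb_cst_le; rewrite n1R normrN normr_sg.
Qed.

Lemma symb_Pi b k l : symb 2 (fun xi => Pi_ b xi k l).
Proof.
rewrite (_ : (fun xi => _) = fun xi => 2^-1 * ((k == l)%:R + (sg R b)%:C *
  ((riesz ord0 xi)%:C * alpha R (spatial ord0) k l +
    (riesz (lift ord0 ord0) xi)%:C * alpha R (spatial (lift ord0 ord0)) k l))); last first.
  by apply/funext => xi; exact: Pi_E.
apply: (@symb_le _ _ (2^-1 * (1 + 1 * (1 * 1 + 1 * 1)))); last by lra.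
apply: symbM; first by apply: symb_cst_le; rewrite n1_half.
apply: symbD; first by apply: symb_cst_le; exact: n1_bool.
apply: symbM; first by apply: symb_cst_le; rewrite n1R normr_sg.
by apply: symbD; apply: symbM; do ?exact: symb_riesz; apply: symb_cst_le; exact: n1_alpha.
Qed.

End Symbols.

Section Nonlinearity.
Context {R : realType}.
Local Notation C := R[i].
Local Notation mu2 := (@mu2 R).
Local Notation P2 := (measurableTypeR R * measurableTypeR R)%type.
Variable Z : P2 -> Prop.
Hypothesis Z_ae : forall xi, {ae mu2, forall eta, ~ Z (psub xi eta)}.
Hypothesis Z_opp : forall xi, Z (- xi) -> Z xi.
Hypothesis Z_0 : Z 0.
Variable T : R.
Hypothesis T0 : 0 < T.
Local Notation symb := (symb Z).
Local Notation fld := (fld Z).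
Local Notation lp := (lp Z).

Definition ccoef (mu nu la : 'I_3) (k l : 'I_2) : C :=
  - 2 * (eps R mu nu la)%:C * alpha R la k l * kappa0%:C.

(** The Fourier transform of the current. *)
Definition Jmap (psi : 'I_2 -> R -> P2 -> C) (mu nu : 'I_3) (t : R) (xi : P2) : C :=
  \sum_(p : 'I_3 * ('I_2 * 'I_2)) ccoef mu nu p.1 p.2.1 p.2.2 *
     conv (refl (psi p.2.1 t)) (psi p.2.2 t) xi.

(** The potential driven by the current of [psi]; it is all of [A] when the
    initial potential vanishes. *)
Definition Amap (psi : 'I_2 -> R -> P2 -> C) (nu : 'I_3) (t : R) (xi : P2) : C :=
  \sum_(b : bool) (- 2^-1) *
    duh T b (fun t xi => \sum_(mu < 3) (R_ b mu xi)%:C * Jmap psi mu nu t xi) t xi.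

(** The Fourier transform of [A_mu alpha^mu psi]. *)
Definition Smap (A : 'I_3 -> R -> P2 -> C) (psi : 'I_2 -> R -> P2 -> C) (l : 'I_2)
    (t : R) (xi : P2) : C :=
  \sum_(p : 'I_3 * 'I_2) (alpha R p.1 l p.2 * kappa0%:C) * conv (A p.1 t) (psi p.2 t) xi.

(** The part of [psi] driven by the potential that [psi] itself creates. *)
Definition Nmap (psi : 'I_2 -> R -> P2 -> C) (k : 'I_2) (t : R) (xi : P2) : C :=
  \sum_(b : bool) Ci R *
    duh T b (fun t xi => \sum_(l < 2) Pi_ b xi k l * Smap (Amap psi) psi l t xi) t xi.

Definition cJ : R := 12 * (8 * kappa0 * cw).
Definition cA : R := 6 * T * cJ.
Definition cS : R := 6 * (kappa0 * cw).
Definition cN : R := 48 * T * cS * cA.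

Lemma cJ_ge0 : 0 <= cJ.
Proof. by rewrite /cJ mulr_ge0// mulr_ge0 ?cw_ge0// mulr_ge0 ?kappa0_ge0. Qed.
Lemma cA_ge0 : 0 <= cA.
Proof. by rewrite /cA mulr_ge0 ?cJ_ge0// mulr_ge0// ltW. Qed.
Lemma cS_ge0 : 0 <= cS.
Proof. by rewrite /cS mulr_ge0// mulr_ge0 ?cw_ge0 ?kappa0_ge0. Qed.
Lemma cN_ge0 : 0 <= cN.
Proof. by rewrite /cN mulr_ge0 ?cA_ge0// mulr_ge0 ?cS_ge0// mulr_ge0// ltW. Qed.

Lemma n1_ccoef mu nu la k l : n1 (ccoef mu nu la k l) <= 8 * kappa0.
Proof.
have -> : ccoef mu nu la k l = (- 2 * eps R mu nu la * kappa0)%:C * alpha R la k l.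
  have -> : (- 2 * eps R mu nu la * kappa0)%:C = - 2 * (eps R mu nu la)%:C * kappa0%:C :> C.
    by apply: C_ext; rewrite !ReImE; ring.
  by rewrite /ccoef; ring.
apply: (le_trans (n1M _ _)); rewrite n1R -[leRHS]mulr1.
apply: ler_pM; [exact: normr_ge0|exact: n1_ge0| |exact: n1_alpha].
rewrite (normrM _ kappa0) (normrM (- 2)) [`|kappa0|]ger0_norm ?kappa0_ge0// ler_wpM2r ?kappa0_ge0// normrN (ger0_norm (_ : 0 <= 2))//.
by have := eps_le (R := R) mu nu la; lra.
Qed.

Lemma lp_Jmap K d psi psi' : (forall k, lp K d (psi k) (psi' k)) ->
  forall mu nu, lp (cJ * K ^+ 2) (2 * cJ * K * d) (Jmap psi mu nu) (Jmap psi' mu nu).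
Proof.
move=> h mu nu.
have hc (p : 'I_3 * ('I_2 * 'I_2)) : symb (8 * kappa0) (fun=> ccoef mu nu p.1 p.2.1 p.2.2).
  by apply: symb_cst_le; exact: n1_ccoef.
have hl (p : 'I_3 * ('I_2 * 'I_2)) := lp_conv Z_ae (lp_reflect Z_opp (h p.2.1)) (h p.2.2).
have := lp_comb hc hl; rewrite !card_prod !card_ord => H.
by apply: (lp_le H); rewrite le_eqVlt; apply/orP; left; apply/eqP; rewrite /cJ; ring.
Qed.

Lemma lp_Amap K d psi psi' : (forall k, lp K d (psi k) (psi' k)) ->
  forall nu, lp (cA * K ^+ 2) (2 * cA * K * d) (Amap psi nu) (Amap psi' nu).
Proof.
move=> h nu.
have h1 (b : bool) := lp_duh T0 b (lp_comb (symb_R Z_0 b) (fun mu => lp_Jmap h mu nu)).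
have hc (b : bool) : symb 2^-1 (fun=> - 2^-1 : C).
  by apply: symb_cst_le; rewrite n1N n1_half.
have := lp_comb hc h1; rewrite card_bool card_ord => H.
by apply: (lp_le H); rewrite le_eqVlt; apply/orP; left; apply/eqP; rewrite /cA; field.
Qed.

Lemma lp_Smap K d L e A A' psi psi' : (forall mu, lp L e (A mu) (A' mu)) ->
  (forall k, lp K d (psi k) (psi' k)) ->
  forall l, lp (cS * (L * K)) (cS * (L * d + K * e)) (Smap A psi l) (Smap A' psi' l).
Proof.
move=> hA h l.
have hc (p : 'I_3 * 'I_2) : symb kappa0 (fun=> alpha R p.1 l p.2 * kappa0%:C).
  apply: symb_cst_le; apply: (le_trans (n1M _ _)); rewrite n1R (ger0_norm kappa0_ge0).
  by rewrite ler_piMl ?kappa0_ge0 ?n1_alpha.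
have hl (p : 'I_3 * 'I_2) := lp_conv Z_ae (hA p.1) (h p.2).
have := lp_comb hc hl; rewrite card_prod !card_ord => H.
by apply: (lp_le H); rewrite le_eqVlt; apply/orP; left; apply/eqP; rewrite /cS; ring.
Qed.

Lemma lp_Nmap K d psi psi' : (forall k, lp K d (psi k) (psi' k)) ->
  forall k, lp (cN * K ^+ 3) (cN * K ^+ 2 * d) (Nmap psi k) (Nmap psi' k).
Proof.
move=> h k.
have h1 (b : bool) := lp_duh T0 b (lp_comb (symb_Pi Z_0 b k) (lp_Smap (lp_Amap h) h)).
have hc (b : bool) : symb 1 (fun=> Ci R).
  by apply: symb_cst_le; rewrite /n1 !ReImE normr0 normr1 add0r.
have := lp_comb hc h1; rewrite card_bool card_ord => H.
have d0 := lp_ge0 (h k); have K0 := fld_ge0 (lp1 (h k)).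
have c0 : 0 <= T * cS * cA by rewrite /cN mulr_ge0 ?cA_ge0// mulr_ge0 ?cS_ge0// ltW.
apply: (lp_le H); last first.
  by rewrite le_eqVlt; apply/orP; left; apply/eqP; rewrite /cN; ring.
rewrite -subr_ge0 /cN.
rewrite (_ : _ - _ = 32 * (T * cS * cA) * K ^+ 3); last by ring.
by rewrite mulr_ge0 ?exprn_ge0// mulr_ge0.
Qed.

(** ** Physical space *)

Definition to_state (A : 'I_3 -> R -> P2 -> C) (psi : 'I_2 -> R -> P2 -> C) (t : R) : state R :=
  (fun nu => A nu t, fun xi => \col_k psi k t xi).

Lemma component_to_state A psi t k : component (to_state A psi t).2 k = psi k t.
Proof. by apply/funext => xi; rewrite /component /= mxE. Qed.

Lemma physpsi_to_state A psi t x :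
  physpsi (to_state A psi t) x = \col_k inv_fourier (psi k t) x.
Proof. by apply/colP => k; rewrite [LHS]mxE [RHS]mxE component_to_state. Qed.

Lemma currentE A psi t mu nu x : current (to_state A psi t) mu nu x =
  \sum_(p : 'I_3 * ('I_2 * 'I_2)) - 2 * (eps R mu nu p.1)%:C * alpha R p.1 p.2.1 p.2.2 *
     (conjc (inv_fourier (psi p.2.1 t) x) * inv_fourier (psi p.2.2 t) x).
Proof.
rewrite /current physpsi_to_state; exact: (current_sum (fun k => inv_fourier (psi k t) x)).
Qed.

Lemma dirac_sourceE A psi t x l : dirac_source (to_state A psi t) x l ord0 =
  \sum_(p : 'I_3 * 'I_2) alpha R p.1 l p.2 *
     (inv_fourier (A p.1 t) x * inv_fourier (psi p.2 t) x).
Proof.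
rewrite /dirac_source summxE -(pair_big xpredT xpredT (fun mu m =>
  alpha R mu l m * (inv_fourier (A mu t) x * inv_fourier (psi m t) x))) /=.
apply: eq_bigr => mu _; rewrite !mxE big_distrr /=; apply: eq_bigr => m _.
by rewrite [physpsi _ _ _ _]mxE component_to_state /physA mulrCA.
Qed.

Lemma fourier_comb (I : finType) (c : I -> C) (f : I -> P2 -> C) xi :
  (forall i, iC mu2 (f i)) ->
  fourier (fun x => \sum_i c i * f i x) xi = \sum_i c i * fourier (f i) xi.
Proof.
move=> hf.
have h i : iC mu2 (fun x => cis (- dot2 x xi) * f i x).
  by apply: iC_cisM => //; apply: measurable_funN; exact: measurable_dot2l.
rewrite /fourier Cint2E.
transitivity (cint mu2 (fun x : P2 => \sum_i c i * (cis (- dot2 x xi) * f i x))).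
  by apply: eq_cint => x; rewrite big_distrr; apply: eq_bigr => i _; rewrite /= mulrCA.
rewrite cint_sum; last by move=> i; exact: iCZ.
by apply: eq_bigr => i _; rewrite cintZ// Cint2E.
Qed.

(** The current is a combination of products of inverse transforms, so the
    product formula applies term by term. *)
Lemma fourier_current K A psi t mu nu xi : (forall k, fld K (psi k)) ->
  fourier (current (to_state A psi t) mu nu) xi = Jmap psi mu nu t xi.
Proof.
move=> h.
have m k : mC (psi k t) := fld_mt t (h k).
have b k : wbound K (psi k t) := fld_b (h k) t.
rewrite (_ : current _ _ _ = fun x => \sum_(p : 'I_3 * ('I_2 * 'I_2))
   (- 2 * (eps R mu nu p.1)%:C * alpha R p.1 p.2.1 p.2.2) *
     (inv_fourier (refl (psi p.2.1 t)) x * inv_fourier (psi p.2.2 t) x)); last first.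
  apply/funext => x; rewrite currentE; apply: eq_bigr => p _.
  by rewrite (inv_fourier_refl x (m _) (b _)).
rewrite fourier_comb.
  apply: eq_bigr => p _.
  rewrite (fourier_inv_fourier_mul xi (mC_refl (m _)) (wbound_refl (b _)) (m _) (b _)
    (fld_ae Z_ae t (h _))).
  by rewrite /ccoef mulrA.
by move=> p; apply: iC_inv_fourier_mul; [exact: mC_refl|exact: wbound_refl (b _)|exact: m|exact: b].
Qed.

Lemma fourier_dirac_source K L A psi t xi l :
  (forall mu, fld L (A mu)) -> (forall k, fld K (psi k)) ->
  fourier_spinor (dirac_source (to_state A psi t)) xi l ord0 = Smap A psi l t xi.
Proof.
move=> hA h; rewrite mxE.
rewrite (_ : component _ _ = fun x => \sum_(p : 'I_3 * 'I_2) alpha R p.1 l p.2 *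
     (inv_fourier (A p.1 t) x * inv_fourier (psi p.2 t) x)); last first.
  by apply/funext => x; rewrite /component dirac_sourceE.
have mA mu : mC (A mu t) := fld_mt t (hA mu).
have bA mu : wbound L (A mu t) := fld_b (hA mu) t.
have m k : mC (psi k t) := fld_mt t (h k).
have b k : wbound K (psi k t) := fld_b (h k) t.
rewrite fourier_comb.
  apply: eq_bigr => p _.
  rewrite (fourier_inv_fourier_mul xi (mA _) (bA _) (m _) (b _) (fld_ae Z_ae t (h _))).
  by rewrite mulrA.
by move=> p; apply: iC_inv_fourier_mul; [exact: mA|exact: bA|exact: m|exact: b].
Qed.

(** ** Reality of the gauge field *)

Lemma conjc_current A psi t mu nu x :
  conjc (current (to_state A psi t) mu nu x) = current (to_state A psi t) mu nu x.
Proof.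
rewrite currentE; exact: (current_sum_real (fun k => inv_fourier (psi k t) x)).
Qed.

Lemma iC_current K A psi t mu nu : (forall k, fld K (psi k)) ->
  iC mu2 (current (to_state A psi t) mu nu).
Proof.
move=> h.
rewrite (_ : current _ _ _ = fun x => \sum_(p : 'I_3 * ('I_2 * 'I_2))
   (- 2 * (eps R mu nu p.1)%:C * alpha R p.1 p.2.1 p.2.2) *
     (inv_fourier (refl (psi p.2.1 t)) x * inv_fourier (psi p.2.2 t) x)); last first.
  apply/funext => x; rewrite currentE; apply: eq_bigr => p _.
  by rewrite (inv_fourier_refl x (fld_mt t (h _)) (fld_b (h _) t)).
apply: iC_sum => p; apply: iCZ; apply: iC_inv_fourier_mul.
- by apply: mC_refl; exact: fld_mt t (h _).
- by apply: wbound_refl; exact: fld_b (h _) t.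
- exact: fld_mt t (h _).
- exact: fld_b (h _) t.
Qed.

Lemma Jmap_opp K psi mu nu t xi : (forall k, fld K (psi k)) ->
  Jmap psi mu nu t (- xi) = conjc (Jmap psi mu nu t xi).
Proof.
move=> h; pose A : 'I_3 -> R -> P2 -> C := fun _ _ _ => 0.
rewrite -!(fourier_current A t mu nu _ h) /fourier !Cint2E -cintJ; last first.
  by apply: iC_cisM; [apply: measurable_funN; exact: measurable_dot2l|exact: iC_current h].
apply: eq_cint => x; rewrite cJM conjc_current -cisN opprK; congr (cis _ * _).
by rewrite /dot2 /=; ring.
Qed.

(** Reflection in frequency and conjugation exchange the two half waves. *)
Lemma duh_opp b K G G' t xi : fld K G -> (forall s, G' s (- xi) = conjc (G s xi)) ->
  duh T (~~ b) G' t (- xi) = conjc (duh T b G t xi).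
Proof.
move=> hG h; rewrite /duh; case: ifP => _; last by rewrite cJ0.
rewrite -cintJ; last exact: iC_duh hG.
by apply: eq_cint => s; rewrite h /prop 2!cJM cJ_R conjc_half_wave.
Qed.

Lemma Amap_opp K psi nu t xi : (forall k, fld K (psi k)) ->
  Amap psi nu t (- xi) = conjc (Amap psi nu t xi).
Proof.
move=> h; rewrite /Amap conjc_sum (reindex_inj (h := negb)); last exact: can_inj negbK.
apply: eq_bigr => b _; rewrite cJM; congr (_ * _).
  have -> : (- 2^-1 : C) = (- 2^-1 : R)%:C.
    have h2 : (2 : C) != 0 by rewrite pnatr_eq0.
    by apply: (mulfI h2); rewrite mulrN mulfV//; apply: C_ext; rewrite !ReImE /=; field.
  by rewrite cJ_R.
have hJ mu := lp1 (lp_Jmap (fun k => lp_refl0 (h k)) mu nu).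
have hR := lp1 (lp_comb (symb_R Z_0 b) (fun mu => lp_refl0 (hJ mu))).
apply: (@duh_opp b _ _ (fun t xi => \sum_(mu < 3) (R_ (~~ b) mu xi)%:C * Jmap psi mu nu t xi) t xi hR).
move=> s; rewrite conjc_sum; apply: eq_bigr => mu _.
by rewrite cJM (Jmap_opp mu nu s xi h) R_opp negbK cJ_R.
Qed.

End Nonlinearity.

(** * Sobolev norms of fields dominated by the weight *)
Section SobolevNorms.
Context {R : realType}.
Local Notation C := R[i].
Local Notation mu2 := (@mu2 R).
Local Notation P2 := (measurableTypeR R * measurableTypeR R)%type.
Local Notation normc := (@Normc.normc R).

Lemma L2_le (f q : P2 -> R) : measurable_fun setT f -> rI mu2 q ->
  (forall xi, f xi ^+ 2 <= q xi) ->
  (Lnorm mu2 2%:E (fun xi => (f xi)%:E) <= (Num.sqrt (Rintegral mu2 setT q))%:E)%E.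
Proof.
move=> mf iq h.
have q0 xi : 0 <= q xi by rewrite (le_trans _ (h xi))// sqr_ge0.
have I0 : 0 <= Rintegral mu2 setT q by apply: Rintegral_ge0 => x _.
rewrite unlock -powR12_sqrt// -poweR_EFin.
have hI : (\int[mu2]_xi (`|(f xi)%:E| `^ 2) <= (Rintegral mu2 setT q)%:E)%E.
  rewrite /Rintegral fineK; last by apply: integrable_fin_num.
  apply: ge0_le_integral => //.
  - by move=> x _; exact: poweR_ge0.
  - rewrite (_ : (fun x => _) = fun x : P2 => (`|f x| `^ 2)%:E); last first.
      by apply/funext => x; rewrite poweR_EFin.
    apply/measurable_EFinP.
    apply: (measurableT_comp (f := fun x : R => x `^ 2) (measurable_powR 2)).
    exact: measurableT_comp.
  - by apply/measurable_EFinP; exact: rI_m iq.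
  - move=> x _; rewrite poweR_EFin lee_fin.
    by rewrite (powR_mulrn 2) ?normr_ge0// real_normK ?num_real.
apply: gt0_ler_poweR => //.
- by rewrite in_itv/= leey integral_ge0// => x _; exact: poweR_ge0.
- by rewrite in_itv/= leey lee_fin I0.
Qed.

Lemma normc_ge0 (z : C) : 0 <= normc z.
Proof. by case: z => a b; exact: sqrtr_ge0. Qed.

Lemma measurable_normc (g : P2 -> C) : mC g -> measurable_fun setT (fun xi => normc (g xi)).
Proof.
move=> [m1 m2].
rewrite (_ : (fun xi => _) = fun xi => Num.sqrt (complex.Re (g xi) ^+ 2 + complex.Im (g xi) ^+ 2)).
  apply: (measurableT_comp (f := @Num.sqrt R)).
    by apply: continuous_measurable_fun; exact: sqrt_continuous.
  by apply: measurable_funD; apply: measurable_funX.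
by apply/funext => xi; case: (g xi).
Qed.

Lemma measurable_bracket (r : R) : measurable_fun setT (fun xi : P2 => (1 + enorm xi) `^ r).
Proof.
apply: (measurableT_comp (f := fun x : R => x `^ r) (measurable_powR r)).
by apply: measurable_funD; [exact: measurable_cst|exact: measurable_enorm].
Qed.

Lemma Hs_norm_le r (g : P2 -> C) (q : P2 -> R) : mC g -> rI mu2 q ->
  (forall xi, ((1 + enorm xi) `^ r * n1 (g xi)) ^+ 2 <= q xi) ->
  (Hs_norm r g <= (Num.sqrt (Rintegral mu2 setT q))%:E)%E.
Proof.
move=> mg iq h.
apply: (L2_le (f := fun xi => (1 + enorm xi) `^ r * normc (g xi))) => //.
  by apply: measurable_funM; [exact: measurable_bracket|exact: measurable_normc].
move=> xi; apply: le_trans (h xi).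
rewrite ler_sqr ?nnegrE ?mulr_ge0 ?powR_ge0 ?normc_ge0 ?n1_ge0//.
by rewrite ler_wpM2l ?powR_ge0// normc_le_n1.
Qed.

Lemma powR_le_expR (p : R) : exists2 M : R, 0 <= M &
  forall z : R, 1 <= z -> z `^ p <= M * expR z.
Proof.
pose q := `|p| + 1.
have q0 : 0 < q by rewrite ltr_wpDl.
(* From z <= q exp (z / q), raised to the power q. *)
exists (q `^ q); first exact: powR_ge0.
move=> z z1; have z0 : 0 <= z := le_trans ler01 z1.
have pq : p <= q by rewrite (le_trans (ler_norm p))// lerDl.
apply: (le_trans (ler_powR z1 pq)).
have -> : expR z = expR (z / q) `^ q by rewrite -expRM divfK ?gt_eqF.
rewrite -powRM ?(ltW q0) ?expR_ge0//.
apply: ge0_ler_powR; rewrite ?nnegrE ?mulr_ge0 ?expR_ge0 ?(ltW q0)//.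
rewrite mulrC -ler_pdivrMr//; apply: le_trans (expR_ge1Dx _).
by rewrite lerDr.
Qed.

Lemma enorm_le_l1 (xi : R * R) : enorm xi <= `|xi.1| + `|xi.2|.
Proof.
rewrite /enorm -[leRHS]ger0_norm ?addr_ge0// -sqrtr_sqr ler_sqrt ?sqr_ge0//.
rewrite sqrrD !real_normK ?num_real// addrAC lerDl mulrn_wge0//.
Qed.

(** One of the two factors [wt] of the square absorbs all powers of the frequency
    by its exponential decay; the other one remains, for integrability. *)
Lemma bracket_wt (r : R) : exists2 M : R, 0 <= M &
  forall xi : P2, ((1 + enorm xi) `^ r * ((1 + enorm xi) * wt xi)) ^+ 2 <= M * wt xi.
Proof.
have [M M0 h] := powR_le_expR (2 * r + 2).
exists (M * expR 1); first by rewrite mulr_ge0 ?expR_ge0.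
move=> xi; set z := 1 + enorm xi.
have z1 : 1 <= z by rewrite lerDl enorm_ge0.
have z0 : 0 < z by rewrite (lt_le_trans ltr01).
have -> : (z `^ r * (z * wt xi)) ^+ 2 = z `^ (2 * r + 2) * wt xi * wt xi.
  rewrite powRD; last by rewrite (gt_eqF z0) implybT.
  rewrite (powR_mulrn 2 (ltW z0)) (mulrC 2 r) powRrM (powR_mulrn 2 (powR_ge0 _ _)).
  by ring.
apply: (@le_trans _ _ (M * expR z * wt xi * wt xi)).
  by rewrite !ler_wpM2r ?wt_ge0// h.
rewrite ler_wpM2r ?wt_ge0// -mulrA ler_wpM2l//.
apply: (@le_trans _ _ (expR 1 * (expR (`|xi.1| + `|xi.2|) * wt xi))).
  rewrite mulrA ler_wpM2r ?wt_ge0// -expRD ler_expR /z lerD2l; exact: enorm_le_l1.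
rewrite ler_piMr ?expR_ge0//.
have -> : expR (`|xi.1| + `|xi.2|) * wt xi = rho xi.
  rewrite /wt /w1 /rho expRD !expRN.
  by move: (expR_gt0 `|xi.1|) (expR_gt0 `|xi.2|) => p1 p2; field; rewrite !gt_eqF.
exact: rho_le1.
Qed.

(** The spare factor [1 + |xi|] accommodates the derivative lost in [duh_lip]. *)
Lemma Hs_norm_wt (r : R) : exists2 W : R, 0 <= W & forall K (g : P2 -> C), 0 <= K ->
  mC g -> (forall xi, n1 (g xi) <= K * ((1 + enorm xi) * wt xi)) ->
  (Hs_norm r g <= (K * W)%:E)%E.
Proof.
have [M M0 h] := bracket_wt r.
exists (Num.sqrt (Rintegral mu2 setT (fun xi => M * wt xi))); first exact: sqrtr_ge0.
move=> K g K0 mg hg.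
have i : rI mu2 (fun xi => M * wt xi) by exact: (rIZ M rI_wt).
have -> : K * Num.sqrt (Rintegral mu2 setT (fun xi => M * wt xi)) =
  Num.sqrt (Rintegral mu2 setT (fun xi => K ^+ 2 * (M * wt xi))).
  have E : Rintegral mu2 setT (fun xi => K ^+ 2 * (M * wt xi)) =
      K ^+ 2 * Rintegral mu2 setT (fun xi => M * wt xi).
    by apply: RintegralZl; [exact: measurableT|exact: i].
  by rewrite E sqrtrM ?sqr_ge0// sqrtr_sqr ger0_norm.
apply: (Hs_norm_le mg (rIZ (K ^+ 2) i)) => xi.
apply: (@le_trans _ _ (K ^+ 2 * ((1 + enorm xi) `^ r * ((1 + enorm xi) * wt xi)) ^+ 2)).
  have p1 : 0 <= (1 + enorm xi) `^ r * n1 (g xi) by rewrite mulr_ge0 ?powR_ge0 ?n1_ge0.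
  have p2 : 0 <= K * ((1 + enorm xi) `^ r * ((1 + enorm xi) * wt xi)).
    rewrite mulr_ge0// mulr_ge0 ?powR_ge0//; apply: mulr_ge0; last exact: wt_ge0.
    by rewrite addr_ge0 ?enorm_ge0.
  rewrite -exprMn ler_sqr ?nnegrE//.
  by rewrite mulrCA ler_wpM2l ?powR_ge0.
by rewrite ler_wpM2l ?sqr_ge0.
Qed.

End SobolevNorms.

(** * Smooth solutions with small data *)
Section SmoothSolutions.
Context {R : realType}.
Local Notation C := R[i].
Local Notation mu2 := (@mu2 R).
Local Notation P2 := (measurableTypeR R * measurableTypeR R)%type.
Local Notation mR := (measurableTypeR R).
Variable Z : P2 -> Prop.
Hypothesis Z_ae : forall xi, {ae mu2, forall eta, ~ Z (psub xi eta)}.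
Hypothesis Z_opp : forall xi, Z (- xi) -> Z xi.
Hypothesis Z_0 : Z 0.
Variable T : R.
Hypothesis T0 : 0 < T.
Local Notation fld := (fld Z).
Local Notation lp := (lp Z).

Lemma fld_half_wave b K u : fld K u -> fld (2 * K) (fun t xi => half_wave b t xi * u t xi).
Proof.
move=> hu; split.
- apply: mCM; last exact: fld_m hu.
  apply: (mC_comp (phi := fun z : (mR * P2)%type => (z, z.1) : (mR * P2 * mR)%type)
    (mC_half_wave b measurable_snd)).
  by apply: measurable_fun_pair => //; exact: measurable_fst.
- move=> t xi; apply: (le_trans (n1M _ _)); rewrite -mulrA.
  by apply: ler_pM; rewrite ?n1_ge0 ?n1_half_wave//; exact: fld_b hu t xi.
- move=> t xi hz x h1 h2; apply: ccvgM; last exact: fld_c hu t _ hz _ h1 h2.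
  apply: ccvg_cis; apply: cvgN; apply: cvgM; first exact: cvg_cst.
  exact: cvg_enorm.
Qed.

(** The free evolution of the spinor. *)
Definition freemap (g : 'I_2 -> P2 -> C) (k : 'I_2) (t : R) (xi : P2) : C :=
  \sum_(b : bool) half_wave b t xi * \sum_(l < 2) Pi_ b xi k l * g l xi.

Lemma fld_static K (g : P2 -> C) : mC g -> wbound K g ->
  (forall xi, ~ Z xi -> scont g xi) -> fld K (fun _ => g).
Proof. by move=> h1 h2 h3; split=> //; exact: (mC_comp h1 measurable_snd). Qed.

Lemma fld_freemap K g : (forall k, fld K (fun _ => g k)) -> forall k, fld (16 * K) (freemap g k).
Proof.
move=> hg k.
have h1 (b : bool) := fld_half_wave b (lp1 (lp_comb (symb_Pi Z_0 b k) (fun l => lp_refl0 (hg l)))).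
have := lp1 (lp_sum (index_enum bool) (fun b => lp_refl0 (h1 b))).
rewrite (_ : size _ = #|{: bool}|); last by rewrite cardT enumT [index_enum bool]unlock.
rewrite card_bool card_ord => H.
by apply: (fld_le H); rewrite le_eqVlt; apply/orP; left; apply/eqP; ring.
Qed.

(** Frequency by frequency form of Lipschitz continuity in time with values in
    every Sobolev space. *)
Definition tlip (K : R) (u : R -> P2 -> C) := forall t s xi, `|t| <= T -> `|s| <= T ->
  n1 (u t xi - u s xi) <= K * `|t - s| * ((1 + enorm xi) * wt xi).

Lemma tlip_le K K' u : tlip K u -> K <= K' -> tlip K' u.
Proof.
move=> h hK t s xi ht hs; apply: (le_trans (h t s xi ht hs)).
apply: ler_wpM2r; first by rewrite mulr_ge0 ?wt_ge0// addr_ge0 ?enorm_ge0.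
exact: ler_wpM2r.
Qed.

Lemma tlipD K K' u v : tlip K u -> tlip K' v -> tlip (K + K') (fun t xi => u t xi + v t xi).
Proof.
move=> hu hv t s xi ht hs; rewrite opprD addrACA (le_trans (n1D _ _))//.
apply: (le_trans (lerD (hu t s xi ht hs) (hv t s xi ht hs))).
by rewrite le_eqVlt; apply/orP; left; apply/eqP; ring.
Qed.

Lemma tlipZ K c u : tlip K u -> tlip (n1 c * K) (fun t xi => c * u t xi).
Proof.
move=> hu t s xi ht hs; rewrite -mulrBr (le_trans (n1M _ _))// -!mulrA.
by rewrite ler_wpM2l ?n1_ge0// mulrA hu.
Qed.

Lemma tlip_bool K u : (forall b : bool, tlip K (u b)) ->
  tlip (K + K) (fun t xi => \sum_(b : bool) u b t xi).
Proof.
move=> h; have := tlipD (h true) (h false); congr tlip.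
by apply/funext => t; apply/funext => xi; rewrite big_bool.
Qed.

Lemma tlip_duh b K G : fld K G -> tlip ((4 * T + 8) * K) (duh T b G).
Proof. by move=> hG t s xi ht hs; exact: (duh_lip T0 b xi hG ht hs). Qed.

Lemma tlip_half_wave b K (g : P2 -> C) : wbound K g ->
  tlip (2 * K) (fun t xi => half_wave b t xi * g xi).
Proof.
move=> hg t s xi _ _; rewrite -mulrBl (le_trans (n1M _ _))//.
apply: (le_trans (ler_pM (n1_ge0 _) (n1_ge0 _) (half_wave_lip b t s xi) (hg xi))).
have -> : 2 * (`|t - s| * enorm xi) * (K * wt xi) =
  2 * K * `|t - s| * (enorm xi * wt xi) by ring.
rewrite ler_wpM2l ?mulr_ge0 ?(wbound_ge0 hg)// ler_wpM2r ?wt_ge0//.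
by rewrite lerDr.
Qed.

Lemma tlip_Amap K psi nu : (forall k, fld K (psi k)) -> exists L, tlip L (Amap T psi nu).
Proof.
move=> h.
have hJ mu := lp1 (lp_Jmap Z_ae Z_opp (fun k => lp_refl0 (h k)) mu nu).
have hR (b : bool) := lp1 (lp_comb (symb_R Z_0 b) (fun mu => lp_refl0 (hJ mu))).
by eexists; apply: tlip_bool => b; apply: tlipZ; exact: (tlip_duh b (hR b)).
Qed.

Lemma tlip_Nmap K psi k : (forall k, fld K (psi k)) -> exists L, tlip L (Nmap T psi k).
Proof.
move=> h.
have hA := lp_Amap Z_ae Z_opp Z_0 T0 (fun k => lp_refl0 (h k)).
have hS l := lp_refl0 (lp1 (lp_Smap Z_ae hA (fun k => lp_refl0 (h k)) l)).
have hP (b : bool) := lp1 (lp_comb (symb_Pi Z_0 b k) hS).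
by eexists; apply: tlip_bool => b; apply: tlipZ; exact: (tlip_duh b (hP b)).
Qed.

Lemma tlip_freemap K g k : (forall k, fld K (fun _ => g k)) -> exists L, tlip L (freemap g k).
Proof.
move=> h.
have hP (b : bool) := fld_b (lp1 (lp_comb (symb_Pi Z_0 b k) (fun l => lp_refl0 (h l)))) 0.
by eexists; apply: tlip_bool => b; exact: (tlip_half_wave b (hP b)).
Qed.

Lemma state_norm_wt (r : R) : exists2 W : R, 0 <= W & forall K (u : state R), 0 <= K ->
  (forall nu, mC (u.1 nu)) -> (forall k, mC (component u.2 k)) ->
  (forall nu xi, n1 (u.1 nu xi) <= K * ((1 + enorm xi) * wt xi)) ->
  (forall k xi, n1 (component u.2 k xi) <= K * ((1 + enorm xi) * wt xi)) ->
  (state_norm r u <= (K * W)%:E)%E.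
Proof.
have [W W0 h] := Hs_norm_wt r.
exists (5 * W); first by rewrite mulr_ge0.
move=> K u K0 m1 m2 b1 b2.
rewrite /state_norm !big_ord_recl !big_ord0 !adde0.
have -> : K * (5 * W) = K * W + (K * W + K * W) + (K * W + K * W) by ring.
have h1 nu := h K _ K0 (m1 nu) (b1 nu).
have h2 k := h K _ K0 (m2 k) (b2 k).
rewrite !EFinD; apply: leeD; first by apply: leeD; [exact: h1|apply: leeD; exact: h1].
by apply: leeD; exact: h2.
Qed.

Lemma state_norm_ge0 r (u : state R) : (0 <= state_norm r u)%E.
Proof. by rewrite adde_ge0// sume_ge0// => i _; exact: Lnorm_ge0. Qed.

Lemma wbound_bracket K (g : P2 -> C) xi : wbound K g -> n1 (g xi) <= K * ((1 + enorm xi) * wt xi).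
Proof.
move=> h; apply: (le_trans (h xi)); rewrite ler_wpM2l ?(wbound_ge0 h)//.
by rewrite ler_peMl ?wt_ge0// lerDl enorm_ge0.
Qed.

(** The weight controls all Sobolev norms, so the bounds on size and the
    Lipschitz bounds in time pass to [H^r]. *)
Lemma CT_to_state r K A psi : (forall nu, fld K (A nu)) -> (forall k, fld K (psi k)) ->
  (forall nu t xi, A nu t (- xi) = conjc (A nu t xi)) ->
  (forall nu, exists L, tlip L (A nu)) -> (forall k, exists L, tlip L (psi k)) ->
  CT r T (to_state A psi).
Proof.
move=> hA hpsi hopp /choice[LA lA] /choice[Lp lp'] t0 ht0.
have [W W0 hW] := state_norm_wt r.
have K0 := fld_ge0 (hA ord0).
split.
  have mk k : mC (component (to_state A psi t0).2 k).
    by rewrite component_to_state; exact: fld_mt t0 (hpsi k).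
  have bk k xi : n1 (component (to_state A psi t0).2 k xi) <= K * ((1 + enorm xi) * wt xi).
    by rewrite component_to_state; apply: wbound_bracket; exact: fld_b (hpsi k) t0.
  have [W' W'0 hW'] := Hs_norm_wt r.
  split=> [nu|k]; last first.
    split; first exact: mk.
    exact: le_lt_trans (hW' K _ K0 (mk k) (bk k)) (ltry _).
  split; last by apply: aeW => xi; exact: hopp.
  split; first exact: fld_mt t0 (hA nu).
  apply: le_lt_trans (hW' K _ K0 (fld_mt t0 (hA nu)) _) (ltry _) => xi.
  by apply: wbound_bracket; exact: fld_b (hA nu) t0.
pose L := \sum_(nu < 3) `|LA nu| + \sum_(k < 2) `|Lp k|.
have lA' nu : tlip L (A nu).
  apply: (tlip_le (lA nu)); rewrite /L (bigD1 nu)//= -addrA (le_trans (ler_norm _))//.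
  by rewrite lerDl addr_ge0 ?sumr_ge0.
have lp2 k : tlip L (psi k).
  apply: (tlip_le (lp' k)); rewrite /L addrC (bigD1 k)//= -addrA (le_trans (ler_norm _))//.
  by rewrite lerDl addr_ge0 ?sumr_ge0.
have L0 : 0 <= L by rewrite addr_ge0 ?sumr_ge0.
have hb t : t \in `[- T, T] -> (0 <= state_norm r (to_state A psi t - to_state A psi t0)%R <=
    (L * `|t - t0| * W)%:E)%E.
  rewrite in_itv /= -ler_norml => ht; rewrite state_norm_ge0 /=.
  move: ht0; rewrite in_itv /= -ler_norml => ht0.
  have E k : component (to_state A psi t - to_state A psi t0).2 k =
      fun xi => psi k t xi - psi k t0 xi.
    by apply/funext => xi; rewrite /component /= !mxE.
  apply: hW.
  - by rewrite mulr_ge0.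
  - move=> nu; exact: (mCB (fld_mt t (hA nu)) (fld_mt t0 (hA nu))).
  - move=> k; rewrite E; exact: (mCB (fld_mt t (hpsi k)) (fld_mt t0 (hpsi k))).
  - by move=> nu xi; exact: lA'.
  - by move=> k xi; rewrite E; exact: lp2.
apply: (squeeze_cvge (f := fun=> 0%E) (h := fun t => (L * `|t - t0| * W)%:E)).
- by rewrite near_withinE; apply: nearW => t; exact: hb.
- exact: cvg_cst.
- apply: cvg_within_filter.
  have -> : (0%E : \bar R) = (L * `|t0 - t0| * W)%:E by rewrite subrr normr0 mulr0 mul0r.
  apply: cvg_EFin; first exact: nearW.
  apply: cvgM; last exact: cvg_cst.
  apply: cvgM; first exact: cvg_cst.
  by apply: cvg_norm; apply: cvgB; [exact: cvg_id|exact: cvg_cst].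
Qed.

Lemma A_hom0 b t nu xi : A_hom b (fun _ _ => 0) t nu xi = 0 :> C.
Proof.
rewrite /A_hom; case: (unlift _ _) => [j|].
  by rewrite mulr0 subr0 mulr0.
by rewrite big1 ?mulr0 ?addr0 ?mulr0// => j _; rewrite mulr0.
Qed.

Lemma sum_bool2 (F G : bool -> C) :
  \sum_(b : bool) F b + \sum_(b : bool) G b = (F false + G false) + (F true + G true).
Proof. by rewrite 2!big_bool /= addrACA addrC. Qed.

(** With zero initial potential, [A] is an explicit quadratic function of [psi];
    substituting it leaves a fixed point equation for [psi] alone, with cubic
    nonlinearity.  The first conclusion records that [psi] is the free wave up to
    third order in the data. *)
Lemma smooth_solution_exists K k (g : 'I_2 -> P2 -> C) : 0 < K ->
  (forall k, fld K (fun _ => g k)) -> k = 16 * K -> 8 * cN T * k ^+ 2 <= 1 ->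
  exists psi : 'I_2 -> R -> P2 -> C,
  [/\ forall i, lp (2 * k) (8 * cN T * k ^+ 3) (psi i) (freemap g i) &
      smooth_solution T ((fun _ _ => 0), fun xi => \col_i g i xi)
        (to_state (Amap T psi) psi)].
Proof.
move=> K0 hg kE hk.
have k0 : 0 < k by rewrite kE mulr_gt0.
have hf : forall i, fld k (freemap g i) by rewrite kE; exact: fld_freemap.
have HN := lp_Nmap Z_ae Z_opp Z_0 T0.
have [psi [fpsi Epsi]] := picard (cN_ge0 T0) k0 hk HN hf.
exists psi.
have hA := lp_Amap Z_ae Z_opp Z_0 T0 (fun i => lp_refl0 (fpsi i)).
have hNp := HN _ _ _ _ (fun i => lp_refl0 (fpsi i)).
split.
  move=> i; split; [exact: fpsi|by apply: (fld_le (hf i)); lra|].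
  move=> t xi; rewrite Epsi addrAC subrr add0r.
  apply: (le_trans (fld_b (lp1 (hNp i)) t xi)).
  by rewrite le_eqVlt; apply/orP; left; apply/eqP; ring.
split.
  move=> r.
  pose K' := Num.max (cA T * (2 * k) ^+ 2) (2 * k).
  apply: (@CT_to_state r K').
  - by move=> nu; apply: (fld_le (lp1 (hA nu))); rewrite le_max lexx.
  - by move=> i; apply: (fld_le (fpsi i)); rewrite le_max lexx orbT.
  - by move=> nu t xi; exact: (Amap_opp Z_ae Z_opp Z_0 T nu t xi fpsi).
  - by move=> nu; exact: tlip_Amap fpsi.
  - move=> i.
    have [L1 h1] := tlip_freemap i hg; have [L2 h2] := tlip_Nmap i fpsi.
    exists (L1 + L2); have := tlipD h1 h2; congr tlip.
    by apply/funext => t; apply/funext => xi; rewrite Epsi.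
move=> t; rewrite in_itv /= -ler_norml => ht.
apply: aeW => xi; split.
  move=> nu.
  have hJ mu := lp1 (lp_Jmap Z_ae Z_opp (fun k => lp_refl0 (fpsi k)) mu nu).
  have hR (b : bool) := lp1 (lp_comb (symb_R Z_0 b) (fun mu => lp_refl0 (hJ mu))).
  have E b : A_rhs b ((fun _ _ => 0), fun xi => \col_i g i xi) (to_state (Amap T psi) psi) t nu xi =
      (- 2^-1) * duh T b (fun t xi => \sum_(mu < 3) (R_ b mu xi)%:C * Jmap psi mu nu t xi) t xi.
    rewrite /A_rhs A_hom0 sub0r mulNr; congr (- (_ * _)).
    rewrite (duhE b xi (hR b) ht); congr Defs.Cint0; apply/funext => s; congr (_ * _).
    by apply: eq_bigr => mu _; rewrite (fourier_current Z_ae _ s mu nu xi fpsi).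
  by rewrite !E /= /Amap big_bool addrC.
apply/matrixP => i j.
have hS l := lp_refl0 (lp1 (lp_Smap Z_ae hA (fun k => lp_refl0 (fpsi k)) l)).
have hP (b : bool) := lp1 (lp_comb (symb_Pi Z_0 b i) hS).
have E b : psi_rhs b ((fun _ _ => 0), fun xi => \col_i g i xi) (to_state (Amap T psi) psi) t xi i j =
    half_wave b t xi * (\sum_(l < 2) Pi_ b xi i l * g l xi) +
    Ci R * duh T b (fun t xi => \sum_(l < 2) Pi_ b xi i l * Smap (Amap T psi) psi l t xi) t xi.
  rewrite /psi_rhs !mxE; congr (_ * _ + _ * _).
    by apply: eq_bigr => l _; rewrite /= mxE.
  rewrite (duhE b xi (hP b) ht); congr Defs.Cint0; apply/funext => s.
  rewrite !mxE; congr (_ * _); apply: eq_bigr => l _.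
  by rewrite (fourier_dirac_source Z_ae s xi l (fun mu => lp1 (hA mu)) fpsi).
transitivity (psi i t xi); first by rewrite mxE.
rewrite [RHS]mxE.
apply: etrans (esym (congr2 +%R (E false) (E true))).
rewrite Epsi.
rewrite /freemap /Nmap; exact: sum_bool2.
Qed.

End SmoothSolutions.

(** * Second-order expansions along a line *)
Lemma is_derive_quadratic (R : realType) (a b c s : R) :
  is_derive s 1 (fun s : R => a + b * s + c / 2 * s ^+ 2) (b + c * s).
Proof.
have h1 : is_derive s 1 (id : R -> R) 1 by exact: is_derive_id.
have h2 := is_deriveD (is_deriveD (is_derive_cst a s 1) (is_deriveM (is_derive_cst b s 1) h1))
  (is_deriveM (is_derive_cst (c / 2) s 1) (is_deriveM h1 h1)).
by apply: (is_derive_eq h2); rewrite /GRing.scale /=; field.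
Qed.

Section Taylor.
Context {R : realType} {X Y : lmodType R[i]}.
Variables (DX : set X) (nX : X -> \bar R) (DY : set Y) (nY : Y -> \bar R).

(** Real-linear functionals on a domain larger than [DY]: remainders such as
    [Phi (x + h) - Phi x - L h] need not lie in [DY]. *)
Record functional (K : R) (D : set Y) (l : Y -> R) : Prop := Functional {
  functional_ge0 : 0 <= K;
  functional_sub : DY `<=` D;
  functional_dom : forall a u v, D u -> D v -> D (a%:C *: u + v);
  functional_lin : forall a u v, D u -> D v -> l (a%:C *: u + v) = a * l u + l v;
  functional_le : forall u, D u -> (`|l u|%:E <= K%:E * nY u)%E }.

Variables (K : R) (D : set Y) (l : Y -> R).
Hypothesis hl : functional K D l.

Lemma subr_scale (u v : Y) : u - v = (-1)%:C *: v + u.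
Proof.
have -> : (-1)%:C = -1 :> R[i] by apply: C_ext; rewrite !ReImE ?oppr0.
by rewrite scaleN1r addrC.
Qed.

Lemma functionalB_dom u v : D u -> D v -> D (u - v).
Proof. by move=> hu hv; rewrite subr_scale; exact: functional_dom hl _ _ _ hv hu. Qed.

Lemma functionalB u v : D u -> D v -> l (u - v) = l u - l v.
Proof.
by move=> hu hv; rewrite subr_scale (functional_lin hl _ hv hu) mulN1r addrC.
Qed.

Lemma functional_bound u (c : R) : D u -> (nY u <= c%:E)%E -> `|l u| <= K * c.
Proof.
move=> hu hc; rewrite -lee_fin EFinM (le_trans (functional_le hl hu))//.
by rewrite lee_wpmul2l// lee_fin; exact: functional_ge0 hl.
Qed.

(** The derivatives are additive only up to elements of seminorm 0; on those the
    functional vanishes. *)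
Lemma functional_real_linear L a h : real_linear DX DY nY L -> DX 0 -> DX h -> DX (a%:C *: h) ->
  l (L (a%:C *: h)) = a * l (L h).
Proof.
move=> [L1 L2] D0 Dh Dah.
have hD u : DX u -> D (L u) by move=> hu; apply: (functional_sub hl); exact: L1.
have z (u v : Y) : D u -> D v -> nY (u - v) = 0%E -> l u = l v.
  move=> hu hv e; apply/eqP; rewrite -subr_eq0 -functionalB// -normr_eq0 eq_le normr_ge0 andbT.
  by rewrite -(mulr0 K); apply: functional_bound; [exact: functionalB_dom|rewrite e].
have e0 : l (L 0) = 0.
  have := z _ _ _ _ (L2 1 0 0 D0 D0).
  rewrite scaler0 addr0 (functional_lin hl)//; [|exact: hD..].
  rewrite mul1r => /(_ (hD _ D0)) H.
  have {H} := H (functional_dom hl _ (hD _ D0) (hD _ D0)); lra.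
have := z _ _ _ _ (L2 a h 0 Dh D0); rewrite addr0 (functional_lin hl)//; [|exact: hD..].
by rewrite e0 addr0; apply; [exact: hD|apply: functional_dom hl _ _ _ _ _; exact: hD].
Qed.

Variables (f : X) (kappa : R).
Hypothesis kappa0 : 0 <= kappa.
Hypothesis Df : forall t : R, DX (t%:C *: f).
Hypothesis nf : forall t : R, nX (t%:C *: f) = (`|t| * kappa)%:E.

Local Notation x_ t := ((t : R)%:C *: f).

Lemma lineD t s : x_ t + x_ s = x_ (t + s).
Proof. by rewrite rcD scalerDl. Qed.

Lemma line0 : x_ 0 = 0.
Proof. by rewrite (_ : 0%:C = 0 :> R[i])// scale0r. Qed.

Lemma line1 : x_ 1 = f.
Proof. by rewrite (_ : 1%:C = 1 :> R[i])// scale1r. Qed.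

Lemma DX0 : DX 0. Proof. by rewrite -line0. Qed.
Lemma DXf : DX f. Proof. by rewrite -line1. Qed.
Lemma nXf : nX f = kappa%:E. Proof. by rewrite -[in LHS]line1 nf normr1 mul1r. Qed.

Lemma is_derive_line (Phi : X -> Y) (L : X -> Y) (r t : R) :
  0 < r -> (forall s, `|s| * kappa < r -> DY (Phi (x_ s))) -> `|t| * kappa < r ->
  frechet_derivative DX nX DY nY Phi (x_ t) L ->
  is_derive t 1 (fun s => l (Phi (x_ s))) (l (L f)).
Proof.
move=> r0 hD ht [[hL _] hF].
suff H : (fun h : R => h^-1 *: (l (Phi (x_ (h *: (1 : R) + t))) - l (Phi (x_ t)))) @ 0^' --> l (L f).
  apply: DeriveDef; first by apply/cvg_ex; exists (l (L f)).
  exact: (cvg_lim (@Rhausdorff R) H).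
apply/cvgrPdist_le => e e0.
have K0 := functional_ge0 hl.
(* The summand 1 keeps the denominator positive when K kappa = 0. *)
pose e' := e / (K * kappa + 1).
have p : 0 < K * kappa + 1 by rewrite ltr_wpDl// mulr_ge0.
have e'0 : 0 < e' by rewrite divr_gt0.
have [d d0 hd] := hF _ e'0.
have k1 : 0 < kappa + 1 by rewrite ltr_wpDl.
have d1 : 0 < d / (kappa + 1) by rewrite divr_gt0.
have d2 : 0 < (r - `|t| * kappa) / (kappa + 1) by rewrite divr_gt0// subr_gt0.
near=> h.
have h0 : h != 0 by near: h; exact: nbhs_dnbhs_neq.
have hn : `|h| < d / (kappa + 1) by near: h; exact: dnbhs0_lt.
have hn2 : `|h| < (r - `|t| * kappa) / (kappa + 1) by near: h; exact: dnbhs0_lt.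
have b1 : `|h| * kappa < d.
  move: hn; rewrite ltr_pdivlMr// mulrDr mulr1; apply: le_lt_trans.
  by rewrite lerDl.
have b2 : `|t + h| * kappa < r.
  have : `|h| * kappa < r - `|t| * kappa.
    move: hn2; rewrite ltr_pdivlMr// mulrDr mulr1; apply: le_lt_trans.
    by rewrite lerDl.
  have := ler_wpM2r kappa0 (ler_normD t h); rewrite mulrDl; lra.
have D1 : D (Phi (x_ (t + h))) by apply: (functional_sub hl); exact: hD.
have D2 : D (Phi (x_ t)) by apply: (functional_sub hl); exact: hD.
have D3 : D (L (x_ h)) by apply: (functional_sub hl); exact: (proj1 hL).
have := hd _ (Df h); rewrite nf lte_fin => /(_ b1).
rewrite lineD -EFinM => /(functional_bound (functionalB_dom (functionalB_dom D1 D2) D3)).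
rewrite functionalB//; last exact: functionalB_dom.
rewrite functionalB// (functional_real_linear hL DX0 DXf (Df h)) => H.
rewrite /= [h *: 1]mulr1 [h + t]addrC distrC.
rewrite -[X in `|_ - X|](mulKf h0) -mulrBr normrM normfV.
rewrite ler_pdivrMl ?normr_gt0//; apply: (le_trans H).
have -> : K * (e' * (`|h| * kappa)) = `|h| * (e' * (K * kappa)) by ring.
rewrite ler_wpM2l//; rewrite /e' mulrAC ler_pdivrMr// ler_wpM2l ?(ltW e0)//.
by rewrite lerDl.
Unshelve. all: by end_near. Qed.

(** The composition with a functional is a real function of one variable, whose
    second derivative at 0 is the functional of [B f f]; the bound on this number
    depends on the line and on the functional only through their norms. *)
Lemma taylor_line (Phi : X -> Y) (D1 : X -> X -> Y) (B : X -> X -> Y) (r M : R) :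
  0 < r -> (forall s, `|s| * kappa < r -> DY (Phi (x_ s))) ->
  (forall x, DX x -> (nX x < r%:E)%E -> frechet_derivative DX nX DY nY Phi x (D1 x)) ->
  frechet_derivative2 DX nX DY nY D1 0 B ->
  (forall h k, DX h -> DX k -> (nY (B h k) <= M%:E * nX h * nX k)%E) ->
  exists c0 c1 c : R, `|c| <= K * (M * kappa * kappa) /\
    forall e, 0 < e -> exists2 d, 0 < d & forall t, `|t| < d ->
      `|l (Phi (x_ t)) - (c0 + c1 * t + c / 2 * t ^+ 2)| <= e * t ^+ 2.
Proof.
move=> r0 hD hF [[_ [hB2 _]] hB] hM.
have K0 := functional_ge0 hl.
pose h (t : R) : R := l (Phi (x_ t)); pose h' (t : R) : R := l (D1 (x_ t) f); pose c := l (B f f).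
have DL (t : R) u : `|t| * kappa < r -> DX u -> DY (D1 (x_ t) u).
  move=> ht hu; have ht' : (nX (x_ t) < r%:E)%E by rewrite nf lte_fin.
  by have [[[H _] _] _] := hF _ (Df t) ht'; exact: H.
have DB u : DX u -> D (B u f).
  by move=> hu; apply: (functional_sub hl); have [H _] := hB2 f DXf; exact: H.
exists (h 0), (h' 0), c; split.
  apply: functional_bound; first exact: DB DXf.
  by apply: (le_trans (hM _ _ DXf DXf)); rewrite nXf -!EFinM.
move=> e e0.
pose e' := e / (K * (kappa * kappa) + 1).
have p : 0 < K * (kappa * kappa) + 1 by rewrite ltr_wpDl// !mulr_ge0.
have e'0 : 0 < e' by rewrite divr_gt0.
have [d d0 hd] := hB _ e'0.
have k1 : 0 < kappa + 1 by rewrite ltr_wpDl.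
exists (Num.min (r / (kappa + 1)) (d / (kappa + 1))).
  by rewrite lt_min !divr_gt0.
have small (a t : R) : `|t| < a / (kappa + 1) -> `|t| * kappa < a.
  by rewrite ltr_pdivlMr// mulrDr mulr1; apply: le_lt_trans; rewrite lerDl.
have hh (t : R) : `|t| * kappa < r -> is_derive t 1 h (h' t).
  move=> ht; apply: (is_derive_line r0 hD ht).
  by apply: hF; [exact: Df|rewrite nf lte_fin].
have h't (t : R) : `|t| * kappa < r -> `|t| * kappa < d -> `|h' t - (h' 0 + c * t)| <= e * `|t|.
  move=> h1 h2.
  have D1t : D (D1 (x_ t) f) by apply: (functional_sub hl); exact: DL DXf.
  have D10 : D (D1 0 f).
    apply: (functional_sub hl); rewrite -line0; apply: DL DXf.
    by rewrite normr0 mul0r.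
  have DBt : D (B (x_ t) f) by exact: DB.
  have := hd _ (Df t); rewrite nf lte_fin => /(_ h2 _ DXf).
  rewrite add0r nXf -!EFinM => /(functional_bound (functionalB_dom (functionalB_dom D1t D10) DBt)).
  rewrite functionalB//; last exact: functionalB_dom.
  rewrite functionalB// (functional_real_linear (hB2 f DXf) DX0 DXf (Df t)) => H.
  rewrite /h' line0 opprD addrA (mulrC c); apply: (le_trans H).
  have -> : K * (e' * (`|t| * kappa) * kappa) = `|t| * (e' * (K * (kappa * kappa))) by ring.
  rewrite mulrC ler_wpM2r//; rewrite /e' mulrAC ler_pdivrMr// ler_wpM2l ?(ltW e0)//.
  by rewrite lerDl.
move=> t; rewrite lt_min => /andP[/small t1 /small t2].
(* The remainder vanishes at 0 and its derivative at s is o(s), so it is o(t^2)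
   by the mean value theorem. *)
pose g (s : R) : R := h s - (h 0 + h' 0 * s + c / 2 * s ^+ 2).
have g0 : g 0 = 0 by rewrite /g; ring.
have in_r (s : R) : `|s| <= `|t| -> `|s| * kappa < r /\ `|s| * kappa < d.
  by move=> hs; split; apply: (le_lt_trans _ t1) || apply: (le_lt_trans _ t2); rewrite ler_wpM2r.
have hg (s : R) : `|s| <= `|t| -> is_derive s 1 g (h' s - (h' 0 + c * s)).
  move=> /in_r[hs _]; have Hh := hh s hs.
  have Hq : is_derive s 1 (fun s : R => h 0 + h' 0 * s + c / 2 * s ^+ 2) (h' 0 + c * s).
    exact: is_derive_quadratic.
  exact: (@is_deriveB _ _ _ h _ s 1 _ _ Hh Hq).
have cg : {in `[- `|t|, `|t|], continuous g}.
  move=> s; rewrite in_itv /= -ler_norml => /hg [H _].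
  exact/differentiable_continuous/derivable1_diffP.
have key (a b : R) : a <= b -> `|a| <= `|t| -> `|b| <= `|t| -> `|g b - g a| <= e * `|t| * (b - a).
  move=> ab ha hb.
  have sub (s : R) : s \in `[a, b] -> `|s| <= `|t|.
    rewrite in_itv /= => /andP[sa sb]; move: ha hb; rewrite !ler_norml => /andP[? ?] /andP[? ?].
    by apply/andP; split; lra.
  have cab : {within `[a, b], continuous g}.
    apply: continuous_in_subspaceT => s; rewrite inE => /sub hs; apply: cg.
    by rewrite in_itv /= -ler_norml.
  have hd' (s : R) : s \in `]a, b[ -> is_derive s 1 g (h' s - (h' 0 + c * s)).
    by move=> hs; apply: hg; apply: sub; exact: subset_itv_oo_cc hs.
  have [s hs ->] := MVT_segment ab hd' cab.
  have hs' := sub _ hs; have [r1 r2] := in_r _ hs'.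
  rewrite normrM (ger0_norm (_ : 0 <= b - a)) ?subr_ge0// ler_wpM2r ?subr_ge0//.
  by apply: (le_trans (h't s r1 r2)); rewrite ler_wpM2l// ltW.
have -> : l (Phi (x_ t)) - (h 0 + h' 0 * t + c / 2 * t ^+ 2) = g t by [].
have [t0|t0] := leP 0 t.
  have := key 0 t t0; rewrite normr0 g0 !subr0 (ger0_norm t0) => H.
  by rewrite expr2 mulrA; apply: H.
have := key t 0 (ltW t0); rewrite normr0 g0 !sub0r normrN => H.
rewrite (_ : t ^+ 2 = `|t| * - t); last by rewrite ltr0_norm//; ring.
by rewrite mulrA; apply: H.
Qed.

End Taylor.

(** * Boxes in frequency space *)
Section Boxes.
Context {R : realType}.
Local Notation C := R[i].
Local Notation leb := (@lebesgue_measure R).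
Local Notation mu2 := (@mu2 R).
Local Notation P2 := (measurableTypeR R * measurableTypeR R)%type.

Definition box (a b c d : R) (xi : P2) : R := between a b xi.1 * between c d xi.2.

Lemma betweenE (a b x : R) : a <= b -> between a b x = (a <= x <= b)%R%:R.
Proof.
move=> ab; rewrite /between; have -> : Num.min a b = a by apply/min_idPl.
have -> : Num.max a b = b by apply/max_idPr.
by case: (a <= x) => //; case: (x <= b).
Qed.

Lemma boxE a b c d xi : a <= b -> c <= d ->
  box a b c d xi = ((a <= xi.1 <= b)%R && (c <= xi.2 <= d)%R)%:R.
Proof. by move=> ab cd; rewrite /box !betweenE// -natrM mulnb. Qed.

Lemma between_ge0 (a b x : R) : 0 <= between a b x.
Proof. by rewrite /between; case: ifP => // _; case: ifP. Qed.

Lemma box_ge0 a b c d xi : 0 <= box a b c d xi.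
Proof. by rewrite mulr_ge0 ?between_ge0. Qed.

Lemma rI_box a b c d : rI mu2 (box a b c d).
Proof. exact: (rI_prod (rI_between a b).1 (rI_between c d).1). Qed.

Lemma int_box a b c d : Rintegral mu2 setT (box a b c d) = `|b - a| * `|d - c|.
Proof.
have E := @Rintegral_prod R _ _ _ _ leb leb (box a b c d) (between a b) (between c d).
rewrite [LHS]E.
- transitivity (Rintegral leb setT (fun x => `|d - c| * between a b x)).
    apply: eq_Rintegral => x _; rewrite /box /= RintegralZl//; last exact: (rI_between c d).1.
    by rewrite (rI_between c d).2 mulrC.
  by rewrite RintegralZl//; [rewrite (rI_between a b).2 mulrC|exact: (rI_between a b).1].
- exact: rI_m (rI_box a b c d).
- exact: (rI_between a b).1.
- exact: (rI_between c d).1.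
- by move=> x y; rewrite ger0_norm ?box_ge0.
Qed.

Lemma wt_box_le (A B : R) (xi : P2) : `|xi.1| <= A -> `|xi.2| <= B -> wt (A, B) <= wt xi.
Proof.
have h (x a : R) : `|x| <= a -> w1 a <= w1 x.
  move=> xa; have a0 : 0 <= a := le_trans (normr_ge0 x) xa.
  rewrite /w1 (ger0_norm a0) ler_pM ?expR_ge0 ?(ltW (rho1_gt0 _))// ?ler_expR ?lerN2//.
  rewrite lef_pV2 ?posrE ?oneDsqr_gt0// lerD2l -(real_normK (num_real x)).
  by rewrite ler_sqr ?nnegrE.
by move=> h1 h2; rewrite /wt ler_pM ?h// ltW ?w1_gt0.
Qed.

Lemma n1_box_le (f : P2 -> C) (K A B : R) : 0 <= K -> (forall xi, n1 (f xi) <= K) ->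
  (forall xi, f xi != 0 -> `|xi.1| <= A /\ `|xi.2| <= B) ->
  wbound (K / wt (A, B)) f.
Proof.
move=> K0 bf sf xi; have [->|/sf[h1 h2]] := eqVneq (f xi) 0.
  by rewrite n1_0 mulr_ge0 ?wt_ge0// divr_ge0// wt_ge0.
apply: (le_trans (bf xi)); rewrite mulrAC ler_pdivlMr ?wt_gt0//.
by rewrite ler_wpM2l// wt_box_le.
Qed.

Lemma between_scont (a b : R) (x : nat -> R) (y : R) : a <= b -> y != a -> y != b ->
  x @ \oo --> y -> (fun n => between a b (x n)) @ \oo --> between a b y.
Proof.
move=> ab ya yb hx.
suff H : \forall n \near \oo, between a b y = between a b (x n).
  by apply: cvg_trans (near_eq_cvg H) _; exact: cvg_cst.
have lo : \forall n \near \oo, (a <= x n) = (a <= y).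
  have [lt|lt|e] := ltgtP a y; last by rewrite e eqxx in ya.
    by apply: filterS (cvgr_gt y hx _ lt) => n h; rewrite ltW.
  by apply: filterS (cvgr_lt y hx _ lt) => n h; apply/negbTE; rewrite -ltNge.
have hi : \forall n \near \oo, (x n <= b) = (y <= b).
  have [lt|lt|e] := ltgtP y b; last by rewrite e eqxx in yb.
    by apply: filterS (cvgr_lt y hx _ lt) => n h; rewrite ltW.
  by apply: filterS (cvgr_gt y hx _ lt) => n h; apply/negbTE; rewrite -ltNge.
apply: filterS2 lo hi => n h1 h2.
by rewrite !betweenE// h1 h2.
Qed.

(** The lines that carry the edges of the boxes, symmetric under [xi -> - xi]
    because fields get reflected. *)
Definition lines (s1 s2 : seq R) (xi : P2) : Prop := (`|xi.1| \in s1) || (`|xi.2| \in s2).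

Lemma lines_opp s1 s2 xi : lines s1 s2 (- xi) -> lines s1 s2 xi.
Proof. by rewrite /lines /= !normrN. Qed.

Lemma lebesgue_translates (s : seq R) (a : R) :
  leb [set x | `|a - x| \in s] = 0%E.
Proof.
apply: countable_lebesgue_measure0.
apply: (@sub_countable _ _ _ [set` [seq a - y | y <- s] ++ [seq a + y | y <- s]]).
  apply: subset_card_le => x /= hx; rewrite mem_cat; apply/orP.
  have [h|h] := leP 0 (a - x).
    left; apply/mapP; exists `|a - x| => //; rewrite ger0_norm//; ring.
  right; apply/mapP; exists `|a - x| => //; rewrite ltr0_norm//; ring.
exact: finite_set_countable.
Qed.

Lemma measurable_translates (s : seq R) (a : R) :
  measurable ([set x | `|a - x| \in s] : set (measurableTypeR R)).
Proof.
have -> : [set x | `|a - x| \in s] = \big[setU/set0]_(y <- s) ((fun x : R => `|a - x|) @^-1` [set y]).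
  apply/seteqP; split=> x /=.
    by move=> h; rewrite -bigcup_seq; exists `|a - x|.
  by rewrite -bigcup_seq => -[y ys /= ->].
apply: bigsetU_measurable => y _.
rewrite -[X in measurable X]setTI.
have m : measurable_fun setT (fun x : measurableTypeR R => `|a - x|).
  by apply: measurableT_comp => //; apply: measurable_funB.
by apply: m => //; exact: measurable_set1.
Qed.

Lemma lines_ae s1 s2 xi : {ae mu2, forall eta, ~ lines s1 s2 (psub xi eta)}.
Proof.
pose A1 : set (measurableTypeR R) := [set x | `|xi.1 - x| \in s1].
pose A2 : set (measurableTypeR R) := [set x | `|xi.2 - x| \in s2].
have m1 : measurable A1 := measurable_translates s1 xi.1.
have m2 : measurable A2 := measurable_translates s2 xi.2.
have n1 : mu2 (A1 `*` setT) = 0%E.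
  by rewrite /mu2 product_measure1E// [X in (X * _)%E](lebesgue_translates s1 xi.1) mul0e.
have n2 : mu2 (setT `*` A2) = 0%E.
  by rewrite /mu2 product_measure1E// [X in (_ * X)%E](lebesgue_translates s2 xi.2) mule0.
have neg : mu2.-negligible ((A1 `*` setT) `|` (setT `*` A2)).
  apply: negligibleU.
    by exists (A1 `*` setT); split=> //; exact: measurableX.
  by exists (setT `*` A2); split=> //; exact: measurableX.
apply: (negligibleS _ neg) => eta /= /contrapT; rewrite /lines /=.
by case/orP => h; [left|right].
Qed.

End Boxes.

(** * Positive-energy waves *)
Section Polarisation.
Context {R : realType}.
Local Notation C := R[i].
Local Notation P2 := (measurableTypeR R * measurableTypeR R)%type.

(** The tangent of half the angle of [xi], when [xi_1 > 0]. *)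
Definition kap (xi : P2) : R := xi.2 / (enorm xi + `|xi.1|).

(** The eigenvector of [xi_j alpha^j] for the eigenvalue [|xi|], when [xi_1 > 0]. *)
Definition pol (k : 'I_2) (xi : P2) : C := 
  if k == ord0 then 1 - Ci R * (kap xi)%:C else 1 + Ci R * (kap xi)%:C.

Lemma enorm_sqr (xi : R * R) : enorm xi ^+ 2 = xi.1 ^+ 2 + xi.2 ^+ 2.
Proof. by rewrite sqr_sqrtr// addr_ge0 ?sqr_ge0. Qed.

Lemma enorm_ge1 (xi : R * R) : `|xi.1| <= enorm xi.
Proof. exact: (crd_le_enorm ord0 xi). Qed.

Lemma enorm_ge2 (xi : R * R) : `|xi.2| <= enorm xi.
Proof. exact: (crd_le_enorm (lift ord0 ord0) xi). Qed.

Lemma kap_le1 xi : `|kap xi| <= 1.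
Proof.
rewrite /kap normrM normfV; have [e0|e0] := eqVneq (enorm xi + `|xi.1|) 0.
  by rewrite e0 normr0 invr0 mulr0.
have p : 0 < enorm xi + `|xi.1| by rewrite lt_neqAle eq_sym e0 addr_ge0 ?enorm_ge0.
rewrite (gtr0_norm p) ler_pdivrMr// mul1r (le_trans (enorm_ge2 xi))//.
by rewrite lerDl.
Qed.

Lemma n1_pol k xi : n1 (pol k xi) <= 2.
Proof.
have h : n1 (Ci R * (kap xi)%:C) <= 1.
  by rewrite /n1 !ReImE !mul0r !mul1r ?mulr0 ?subr0 ?oppr0 ?addr0 ?add0r ?normr0 ?add0r kap_le1.
have h1 : n1 (1 : C) = 1 by rewrite /n1 !ReImE normr1 normr0 addr0.
rewrite /pol; case: ifP => _.
  by apply: (le_trans (n1B _ _)); rewrite h1; lra.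
by apply: (le_trans (n1D _ _)); rewrite h1; lra.
Qed.

(** The half-angle formulas, which express that [pol] is an eigenvector. *)
Lemma riesz_kap (xi : P2) : 0 < xi.1 ->
  riesz ord0 xi + riesz (lift ord0 ord0) xi * kap xi = 1 /\
  riesz (lift ord0 ord0) xi - riesz ord0 xi * kap xi = kap xi.
Proof.
move=> h; have e0 : 0 < enorm xi by rewrite (lt_le_trans _ (enorm_ge1 xi))// gtr0_norm.
have := enorm_sqr xi; rewrite /riesz /kap /crd /= (gtr0_norm h).
move: (enorm xi) e0 xi.1 xi.2 h => e e0 a b h E.
have n0 : e + a != 0 by rewrite gt_eqF// addr_gt0.
have n1 : e != 0 by rewrite gt_eqF.
have E' : b ^+ 2 = (e - a) * (e + a) by rewrite mulrDr !mulrBl -expr2 E; ring.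
split; first have -> : a / e + b / e * (b / (e + a)) = (a * (e + a) + b ^+ 2) / (e * (e + a)).
- by field; rewrite n0 n1.
- by rewrite E'; field; rewrite n0 n1.
by field; rewrite n0 n1.
Qed.

Lemma ord2 (k : 'I_2) : k = ord0 \/ k = lift ord0 ord0.
Proof. by case: k => [[|[|//]] h]; [left|right]; apply/val_inj. Qed.

Lemma alpha1E : (alpha R (spatial ord0) ord0 ord0 = 0) *
  (alpha R (spatial ord0) ord0 (lift ord0 ord0) = 1) *
  (alpha R (spatial ord0) (lift ord0 ord0) ord0 = 1) *
  (alpha R (spatial ord0) (lift ord0 ord0) (lift ord0 ord0) = 0).
Proof. by rewrite /alpha !mxE /=. Qed.

Lemma alpha2E : (alpha R (spatial (lift ord0 ord0)) ord0 ord0 = 0) *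
  (alpha R (spatial (lift ord0 ord0)) ord0 (lift ord0 ord0) = - Ci R) *
  (alpha R (spatial (lift ord0 ord0)) (lift ord0 ord0) ord0 = Ci R) *
  (alpha R (spatial (lift ord0 ord0)) (lift ord0 ord0) (lift ord0 ord0) = 0).
Proof. by rewrite /alpha !mxE /=. Qed.

Lemma pol0 xi : pol ord0 xi = 1 - Ci R * (kap xi)%:C.
Proof. by rewrite /pol eqxx. Qed.
Lemma pol1 xi : pol (lift ord0 ord0) xi = 1 + Ci R * (kap xi)%:C.
Proof. by []. Qed.

Lemma half_sg b (z : C) : 2^-1 * (z + (sg R b)%:C * z) = if b then 0 else z.
Proof.
have h : (2 : C) != 0 by rewrite pnatr_eq0.
rewrite /sg; case: b; rewrite ?expr1 ?expr0.
  have -> : (-1)%:C = -1 :> C by apply: C_ext; rewrite !ReImE ?oppr0.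
  by rewrite mulN1r subrr mulr0.
by rewrite mul1r -mulr2n -(mulr_natl z) mulrA mulVf// mul1r.
Qed.

Lemma Pi_pol b (xi : P2) k : 0 < xi.1 ->
  \sum_(l < 2) Pi_ b xi k l * pol l xi = if b then 0 else pol k xi.
Proof.
move=> /riesz_kap; rewrite !big_ord_recl big_ord0 addr0 !Pi_E.
move: (riesz ord0 xi) (riesz (lift ord0 ord0) xi) => r1 r2; rewrite pol0 pol1.
case: (ord2 k) => ->; rewrite ?pol0 ?pol1; move: (kap xi) => x [h1 h2];
  rewrite !alpha1E !alpha2E -half_sg.
- have E : (r1%:C - Ci R * r2%:C) * (1 + Ci R * x%:C) = 1 - Ci R * x%:C.
    by apply: C_ext; rewrite !ReImE; lra.
  transitivity (2^-1 * ((1 - Ci R * x%:C) + (sg R b)%:C *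
    ((r1%:C - Ci R * r2%:C) * (1 + Ci R * x%:C)))); last by rewrite E.
  by rewrite eqxx (_ : (ord0 == lift ord0 ord0 :> 'I_2) = false)// mulr0n mulr1n; ring.
- have E : (r1%:C + Ci R * r2%:C) * (1 - Ci R * x%:C) = 1 + Ci R * x%:C.
    by apply: C_ext; rewrite !ReImE; lra.
  transitivity (2^-1 * ((1 + Ci R * x%:C) + (sg R b)%:C *
    ((r1%:C + Ci R * r2%:C) * (1 - Ci R * x%:C)))); last by rewrite E.
  by rewrite eqxx (_ : (lift ord0 ord0 == ord0 :> 'I_2) = false)// mulr0n mulr1n; ring.
Qed.

(** ** The current of two positive-energy waves *)

Definition o1 : 'I_3 := spatial ord0.
Definition o2 : 'I_3 := spatial (lift ord0 ord0).

Lemma eps0 la : eps R ord0 ord0 la = 0.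
Proof. by rewrite /eps subrr !mul0r. Qed.
Lemma eps1 : (eps R o1 ord0 ord0 = 0) * (eps R o1 ord0 o1 = 0) * (eps R o1 ord0 o2 = -1).
Proof. by do 2?split; rewrite /eps /o1 /o2 /spatial /= /bump /=; field. Qed.
Lemma eps2 : (eps R o2 ord0 ord0 = 0) * (eps R o2 ord0 o1 = 1) * (eps R o2 ord0 o2 = 0).
Proof. by do 2?split; rewrite /eps /o1 /o2 /spatial /= /bump /=; field. Qed.

Lemma sum_ccoef mu nu (x y : 'I_2 -> C) :
  \sum_(p : 'I_3 * ('I_2 * 'I_2)) ccoef mu nu p.1 p.2.1 p.2.2 * (x p.2.1 * y p.2.2) =
  - 2 * kappa0%:C * \sum_(la < 3) (eps R mu nu la)%:C *
     \sum_(k < 2) \sum_(l < 2) alpha R la k l * (x k * y l).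
Proof.
rewrite -(pair_big xpredT xpredT (fun la (q : 'I_2 * 'I_2) =>
  ccoef mu nu la q.1 q.2 * (x q.1 * y q.2))) /= big_distrr /=.
apply: eq_bigr => la _.
rewrite -(pair_big xpredT xpredT (fun k l => ccoef mu nu la k l * (x k * y l))) /=.
rewrite 2!big_distrr /=; apply: eq_bigr => k _; rewrite 2!big_distrr /=.
by apply: eq_bigr => l _; rewrite /ccoef; ring.
Qed.

Lemma sum3 (F : 'I_3 -> C) : \sum_(i < 3) F i = F ord0 + F o1 + F o2.
Proof. by rewrite !big_ord_recl big_ord0 addr0 addrA. Qed.
Lemma sum2 (F : 'I_2 -> C) : \sum_(i < 2) F i = F ord0 + F (lift ord0 ord0).
Proof. by rewrite !big_ord_recl big_ord0 addr0. Qed.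

Lemma sum_ccoef1 (x y : 'I_2 -> C) :
  \sum_(p : 'I_3 * ('I_2 * 'I_2)) ccoef o1 ord0 p.1 p.2.1 p.2.2 * (x p.2.1 * y p.2.2) =
  2 * kappa0%:C * (Ci R * (x (lift ord0 ord0) * y ord0 - x ord0 * y (lift ord0 ord0))).
Proof.
rewrite sum_ccoef sum3 !eps1 !sum2 !alpha2E.
have -> : (-1)%:C = -1 :> C by apply: C_ext; rewrite !ReImE ?oppr0.
by rewrite (_ : (0 : R)%:C = 0 :> C)//; ring.
Qed.

Lemma sum_ccoef2 (x y : 'I_2 -> C) :
  \sum_(p : 'I_3 * ('I_2 * 'I_2)) ccoef o2 ord0 p.1 p.2.1 p.2.2 * (x p.2.1 * y p.2.2) =
  - 2 * kappa0%:C * (x (lift ord0 ord0) * y ord0 + x ord0 * y (lift ord0 ord0)).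
Proof.
rewrite sum_ccoef sum3 !eps2 !sum2 !alpha1E.
by rewrite (_ : (0 : R)%:C = 0 :> C)// (_ : (1 : R)%:C = 1 :> C)//; ring.
Qed.

Lemma sum_ccoef0 (x y : 'I_2 -> C) :
  \sum_(p : 'I_3 * ('I_2 * 'I_2)) ccoef ord0 ord0 p.1 p.2.1 p.2.2 * (x p.2.1 * y p.2.2) = 0.
Proof.
by rewrite sum_ccoef big1 ?mulr0// => la _; rewrite eps0 (_ : (0 : R)%:C = 0 :> C)// mul0r.
Qed.

Lemma R_E b (xi : R * R) : (R_ b ord0 xi = -1) * (R_ b o1 xi = - (sg R b * riesz ord0 xi)) *
  (R_ b o2 xi = - (sg R b * riesz (lift ord0 ord0) xi)).
Proof.
by rewrite /R_ unlift_none /o1 /o2 /spatial !liftK.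
Qed.

(** The null form: the symbol of [R_mu] applied to the current of a pair of
    waves at frequencies [eta] and [zeta]. *)
Definition qform (xi eta zeta : P2) : R :=
  2 * (riesz (lift ord0 ord0) xi * (1 - kap eta * kap zeta) - riesz ord0 xi * (kap eta + kap zeta)).

(** By antisymmetry only the components [mu <> lambda] in [{1, 2}] of the current
    enter in [A_0].  On the eigenvectors [pol] they are a sum and a product of
    tangents of half angles. *)
Lemma sum_R_ccoef b xi eta zeta (c d : C) :
  \sum_(mu < 3) (R_ b mu xi)%:C *
    \sum_(p : 'I_3 * ('I_2 * 'I_2)) ccoef mu ord0 p.1 p.2.1 p.2.2 *
      (conjc (c * pol p.2.1 eta) * (d * pol p.2.2 zeta)) =
  (sg R b * (2 * kappa0))%:C * ((qform xi eta zeta)%:C * (conjc c * d)).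
Proof.
rewrite sum3 (sum_ccoef0 (fun k => conjc (c * pol k eta)) (fun k => d * pol k zeta)).
rewrite (sum_ccoef1 (fun k => conjc (c * pol k eta)) (fun k => d * pol k zeta)).
rewrite (sum_ccoef2 (fun k => conjc (c * pol k eta)) (fun k => d * pol k zeta)).
rewrite !R_E mulr0 add0r !cJM.
have j0 : conjc (pol ord0 eta) = pol (lift ord0 ord0) eta.
  by rewrite pol0 pol1; apply: C_ext; rewrite !ReImE; ring.
have j1 : conjc (pol (lift ord0 ord0) eta) = pol ord0 eta.
  by rewrite pol0 pol1; apply: C_ext; rewrite !ReImE; ring.
rewrite j0 j1.
move: (conjc c) => c'.
have E1 : Ci R * (pol ord0 eta * pol ord0 zeta - pol (lift ord0 ord0) eta * pol (lift ord0 ord0) zeta) =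
    (2 * (kap eta + kap zeta))%:C.
  rewrite !pol0 !pol1; apply: C_ext; rewrite !ReImE; ring.
have E2 : pol ord0 eta * pol ord0 zeta + pol (lift ord0 ord0) eta * pol (lift ord0 ord0) zeta =
    (2 * (1 - kap eta * kap zeta))%:C.
  rewrite !pol0 !pol1; apply: C_ext; rewrite !ReImE; ring.
have E3 : Ci R * (c' * pol ord0 eta * (d * pol ord0 zeta) -
    c' * pol (lift ord0 ord0) eta * (d * pol (lift ord0 ord0) zeta)) =
    (c' * d) * (2 * (kap eta + kap zeta))%:C by rewrite -E1; ring.
have E4 : c' * pol ord0 eta * (d * pol ord0 zeta) +
    c' * pol (lift ord0 ord0) eta * (d * pol (lift ord0 ord0) zeta) =
    (c' * d) * (2 * (1 - kap eta * kap zeta))%:C by rewrite -E2; ring.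
rewrite E3 E4 /qform.
move: (riesz ord0 xi) (riesz (lift ord0 ord0) xi) (kap eta) (kap zeta) (sg R b) (@kappa0 R) (c' * d) => r1 r2 x y s k0 cd.
have -> : (s * (2 * k0))%:C * ((2 * (r2 * (1 - x * y) - r1 * (x + y)))%:C * cd) =
  (s * (2 * k0) * (2 * (r2 * (1 - x * y) - r1 * (x + y))))%:C * cd by rewrite mulrA -rcM.
have -> : (- (s * r1))%:C * (2 * k0%:C * (cd * (2 * (x + y))%:C)) +
  (- (s * r2))%:C * (- 2 * k0%:C * (cd * (2 * (1 - x * y))%:C)) =
  ((- (s * r1))%:C * (2 * k0)%:C * (2 * (x + y))%:C -
   (- (s * r2))%:C * (2 * k0)%:C * (2 * (1 - x * y))%:C) * cd.
  rewrite (_ : (2 * k0)%:C = 2 * k0%:C); first by ring.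
  by apply: C_ext; rewrite !ReImE /=; ring.
by congr (_ * _); apply: C_ext; rewrite !ReImE; ring.
Qed.

End Polarisation.

(** * The gauge field generated by a positive-energy wave *)
Section Oscillation.
Context {R : realType}.
Local Notation C := R[i].
Local Notation leb := (@lebesgue_measure R).
Local Notation mR := (measurableTypeR R).

Lemma Rintegral_FTC (f F : R -> R) (t : R) : 0 < t -> (forall x : R, is_derive x 1 F (f x)) ->
  continuous f -> Rintegral leb `[0, t] f = F t - F 0.
Proof.
move=> t0 hF cf.
have dF (x : R) : derivable F x (1 : R) by case: (hF x).
have cF : continuous F.
  by move=> x; exact/differentiable_continuous/derivable1_diffP.
rewrite /Rintegral (@continuous_FTC2 _ f F)//.
- exact: continuous_subspaceT.
- split; [|exact/cvg_at_right_filter/cF|exact/cvg_at_left_filter/cF].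
  by move=> x _; have := dF x; exact: id.
- by move=> x _; rewrite derive1E; exact: derive_val.
Qed.

Definition osc (t phi : R) : C := cint leb (fun s => (osgn t s)%:C * cis (s * phi)).

Lemma is_derive_scale (f df : R -> R) (phi x : R) : (forall y : R, is_derive y 1 f (df y)) ->
  is_derive x 1 (fun s => f (s * phi)) (df (x * phi) * phi).
Proof.
move=> hf; have h1 : is_derive x 1 (id : R -> R) 1 by exact: is_derive_id.
have h2 : is_derive x 1 (fun s : R => s * phi) phi.
  apply: (is_derive_eq (is_deriveM h1 (is_derive_cst phi x 1))).
  by rewrite /GRing.scale /=; ring.
exact: (@is_derive1_comp _ f (fun s => s * phi) x _ _ (hf (x * phi)) h2).
Qed.

Lemma measurable_scale_cos (phi : R) : measurable_fun setT (fun s : mR => cos (s * phi)).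
Proof.
apply: (measurableT_comp (f := @cos R)); last exact: measurable_funM.
by apply: continuous_measurable_fun; exact: continuous_cos.
Qed.

Lemma measurable_scale_sin (phi : R) : measurable_fun setT (fun s : mR => sin (s * phi)).
Proof.
apply: (measurableT_comp (f := @sin R)); last exact: measurable_funM.
by apply: continuous_measurable_fun; exact: continuous_sin.
Qed.

Lemma cos_norm_le1 (x : R) : `|cos x| <= 1.
Proof. by rewrite ler_norml cos_geN1 cos_le1. Qed.
Lemma sin_norm_le1 (x : R) : `|sin x| <= 1.
Proof. by rewrite ler_norml sin_geN1 sin_le1. Qed.

Lemma Re_osc t phi : 0 < t ->
  complex.Re (osc t phi) = Rintegral leb `[0, t] (fun s => cos (s * phi)).
Proof.
move=> t0; rewrite Re_cint.
transitivity (Rintegral leb setT (fun s => osgn t s * cos (s * phi))).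
  by apply: eq_Rintegral => s _; rewrite !ReImE mul0r subr0.
rewrite -(Rint0E t (measurable_scale_cos phi) (fun s => cos_norm_le1 _)).
by rewrite /Defs.Rint0 (ltW t0).
Qed.

Lemma Im_osc t phi : 0 < t ->
  complex.Im (osc t phi) = Rintegral leb `[0, t] (fun s => sin (s * phi)).
Proof.
move=> t0; rewrite Im_cint.
transitivity (Rintegral leb setT (fun s => osgn t s * sin (s * phi))).
  by apply: eq_Rintegral => s _; rewrite !ReImE mul0r addr0.
rewrite -(Rint0E t (measurable_scale_sin phi) (fun s => sin_norm_le1 _)).
by rewrite /Defs.Rint0 (ltW t0).
Qed.

(** The antiderivatives [sin (s phi) / phi] and [- cos (s phi) / phi] are at most
    [1 / |phi|] in size. *)
Lemma n1_osc_le t phi : 0 < t -> phi != 0 -> n1 (osc t phi) <= 3 / `|phi|.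
Proof.
move=> t0 p0.
have cs : continuous (fun s : R => sin (s * phi)).
  by move=> x; apply: continuous_comp; [exact: mulrr_continuous|exact: continuous_sin].
have cc : continuous (fun s : R => cos (s * phi)).
  by move=> x; apply: continuous_comp; [exact: mulrr_continuous|exact: continuous_cos].
have E1 : complex.Re (osc t phi) = sin (t * phi) / phi.
  have h (x : R) : is_derive x 1 (fun s : R => phi^-1 * sin (s * phi)) (cos (x * phi)).
    have h := is_deriveZ phi^-1 (is_derive_scale phi x (@is_derive_sin R)).
    by apply: (is_derive_eq h); rewrite /GRing.scale /= mulrC mulfK.
  by rewrite Re_osc// (Rintegral_FTC t0 h cc) mul0r sin0 mulr0 subr0 mulrC.
have E2 : complex.Im (osc t phi) = (1 - cos (t * phi)) / phi.
  have h (x : R) : is_derive x 1 (fun s : R => - phi^-1 * cos (s * phi)) (sin (x * phi)).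
    have h := is_deriveZ (- phi^-1) (is_derive_scale phi x (@is_derive_cos R)).
    by apply: (is_derive_eq h); rewrite /GRing.scale /=; field.
  by rewrite Im_osc// (Rintegral_FTC t0 h cs) mul0r cos0; field.
rewrite /n1 E1 E2 !normrM !normfV -mulrDl ler_wpM2r ?invr_ge0//.
have := sin_norm_le1 (t * phi); have := cos_norm_le1 (t * phi).
have := ler_normB 1 (cos (t * phi)); rewrite normr1; lra.
Qed.

(** The argument of the cosine does not leave the interval where it is at least
    1/2. *)
Lemma Re_osc_ge t phi : 0 < t -> t * `|phi| <= 1 / 2 -> t / 2 <= complex.Re (osc t phi).
Proof.
move=> t0 h.
have hc (s : R) : 0 <= s -> s <= t -> 1 / 2 <= cos (s * phi).
  move=> s0 st.
  have b : `|s * phi| <= 1 / 2.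
    by rewrite normrM (ger0_norm s0) (le_trans _ h)// ler_wpM2r.
  have := cos_lip (s * phi) 0; rewrite cos0 subr0 => /le_trans/(_ b).
  by rewrite ler_norml => /andP[+ _]; lra.
have i1 : rI leb (fun s => osgn t s * cos (s * phi)).
  exact: rI_osgn (measurable_scale_cos phi) (fun s => cos_norm_le1 _).
have -> : complex.Re (osc t phi) = Rintegral leb setT (fun s => osgn t s * cos (s * phi)).
  by rewrite Re_cint; apply: eq_Rintegral => s _; rewrite !ReImE mul0r subr0.
have -> : t / 2 = Rintegral leb setT (fun s => 1 / 2 * between 0 t s).
  rewrite RintegralZl//; last exact: (rI_between 0 t).1.
  by rewrite (rI_between 0 t).2 subr0 (gtr0_norm t0); field.
apply: le_Rintegral => //; first exact: (rIZ (1 / 2) (rI_between 0 t).1).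
move=> s _; rewrite betweenE ?(ltW t0)// /osgn (ltW t0).
case: (leP 0 s) => s0 /=; last by rewrite mulr0 mul0r.
case: (leP s t) => st /=; last by rewrite mulr0 mul0r.
by rewrite mulr1 [1 * cos _]mul1r; exact: hc.
Qed.

End Oscillation.

Section PositiveEnergy.
Context {R : realType}.
Local Notation C := R[i].
Local Notation leb := (@lebesgue_measure R).
Local Notation mu2 := (@mu2 R).
Local Notation P2 := (measurableTypeR R * measurableTypeR R)%type.
Local Notation mR := (measurableTypeR R).
Variable Z : P2 -> Prop.
Hypothesis Z_ae : forall xi, {ae mu2, forall eta, ~ Z (psub xi eta)}.
Hypothesis Z_opp : forall xi, Z (- xi) -> Z xi.
Hypothesis Z_0 : Z 0.
Variable T : R.
Hypothesis T0 : 0 < T.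
Variables (chi : P2 -> R) (K : R).

Definition wave (k : 'I_2) (t : R) (xi : P2) : C :=
  half_wave false t xi * ((chi xi)%:C * pol k xi).

Hypothesis hw : forall k, fld Z K (wave k).
Hypothesis mchi : measurable_fun setT chi.

(** The amplitude of the interaction of the frequencies [eta] and [xi + eta]. *)
Definition Q (xi eta : P2) : R := chi eta * chi (xi + eta) * qform xi eta (xi + eta).

Lemma conv_refl (f g : P2 -> C) xi : mC f -> wbound K f -> mC g -> wbound K g ->
  iC mu2 (fun eta => conjc (f eta) * g (xi + eta)) /\
  conv (refl f) g xi = cint mu2 (fun eta => conjc (f eta) * g (xi + eta)).
Proof.
move=> mf bf mg bg.
have i := iC_conv xi (mC_refl mf) mg (wbound_refl bf) bg.
have E : (fun x => refl f (0 - x.1, 0 - x.2) * g (psub xi (0 - x.1, 0 - x.2))) =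
    (fun eta : P2 => conjc (f eta) * g (xi + eta)).
  apply/funext => -[a b]; rewrite /refl /psub /= !sub0r; congr (conjc (f _) * g _).
    by rewrite -[RHS]opprK.
  by case: xi {i} => c d /=; rewrite !opprK.
split; last by rewrite /conv (cint_reflect (0, 0) i) -E.
by rewrite -E; have [i1 i2] := i; split; [exact: (rI_reflect (0, 0) i1)|exact: (rI_reflect (0, 0) i2)].
Qed.

Lemma sum_R_Jmap b t xi :
  \sum_(mu < 3) (R_ b mu xi)%:C * Jmap wave mu ord0 t xi =
  (sg R b * (2 * kappa0))%:C *
    cint mu2 (fun eta => (Q xi eta)%:C * cis (t * (enorm eta - enorm (xi + eta)))).
Proof.
have m k : mC (wave k t) := fld_mt t (hw k).
have bd k : wbound K (wave k t) := fld_b (hw k) t.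
have h k l := conv_refl xi (m k) (bd k) (m l) (bd l).
pose F mu (p : 'I_3 * ('I_2 * 'I_2)) eta : C :=
  ccoef mu ord0 p.1 p.2.1 p.2.2 * (conjc (wave p.2.1 t eta) * wave p.2.2 t (xi + eta)).
have iF mu p : iC mu2 (F mu p) by apply: iCZ; exact: (h _ _).1.
have EJ mu : Jmap wave mu ord0 t xi = cint mu2 (fun eta => \sum_p F mu p eta).
  rewrite cint_sum//; apply: eq_bigr => p _; rewrite (h _ _).2 cintZ//; exact: (h _ _).1.
have iS mu : iC mu2 (fun eta => \sum_p F mu p eta) by exact: iC_sum.
have P eta : \sum_(mu < 3) (R_ b mu xi)%:C * (\sum_p F mu p eta) = (sg R b * (2 * kappa0))%:C *
   ((Q xi eta)%:C * cis (t * (enorm eta - enorm (xi + eta)))).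
  have := sum_R_ccoef b xi eta (xi + eta) (half_wave false t eta * (chi eta)%:C)
    (half_wave false t (xi + eta) * (chi (xi + eta))%:C).
  rewrite /F /wave => H.
  transitivity (\sum_(mu < 3) (R_ b mu xi)%:C *
    \sum_(p : 'I_3 * ('I_2 * 'I_2)) ccoef mu ord0 p.1 p.2.1 p.2.2 *
      (conjc (half_wave false t eta * (chi eta)%:C * pol p.2.1 eta) *
       (half_wave false t (xi + eta) * (chi (xi + eta))%:C * pol p.2.2 (xi + eta)))).
    by apply: eq_bigr => mu _; congr (_ * _); apply: eq_bigr => p _; rewrite !mulrA.
  rewrite H; congr (_ * _); rewrite /Q cJM cJ_R /half_wave -cisN !rcM.
  have -> : cis (t * (enorm eta - enorm (xi + eta))) =
    cis (- - (sg R false * t * enorm eta)) * cis (- (sg R false * t * enorm (xi + eta))) :> C.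
    by rewrite -cisD /sg expr0; congr cis; ring.
  by ring.
have iP : iC mu2 (fun eta => (sg R b * (2 * kappa0))%:C *
   ((Q xi eta)%:C * cis (t * (enorm eta - enorm (xi + eta))))).
  rewrite (_ : (fun eta => _) = fun eta => \sum_(mu < 3) (R_ b mu xi)%:C * (\sum_p F mu p eta));
    last by apply/funext => eta; rewrite P.
  by apply: iC_sum => mu; exact: iCZ.
transitivity (cint mu2 (fun eta => \sum_(mu < 3) (R_ b mu xi)%:C * (\sum_p F mu p eta))).
  rewrite cint_sum; last by move=> mu; exact: iCZ.
  by apply: eq_bigr => mu _; rewrite cintZ// EJ.
rewrite (eq_cint _ P).
have [s0|s0] := eqVneq (sg R b * (2 * kappa0)) 0.
  rewrite s0 (_ : (0 : R)%:C = 0 :> C)// mul0r (eq_cint _ (g := fun=> 0)) ?cint0//.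
  by move=> eta; rewrite mul0r.
rewrite cintZ//.
have := iCZ ((sg R b * (2 * kappa0))^-1)%:C iP; congr iC; apply/funext => eta.
by rewrite mulrA -rcM mulVf// (_ : (1 : R)%:C = 1 :> C)// mul1r.
Qed.

Lemma measurable_padd (xi : P2) : measurable_fun setT (fun eta : P2 => xi + eta : P2).
Proof. by apply: measurable_fun_pair; apply: measurable_funD. Qed.

Lemma measurable_kap : measurable_fun setT (@kap R).
Proof.
apply: measurable_funM => //.
rewrite (_ : (fun xi => _) = (fun xi : P2 => (enorm xi + `|xi.1|) `^ (-1))).
  apply: (measurableT_comp (f := fun x : R => x `^ (-1)) (measurable_powR (-1))).
  by apply: measurable_funD; [exact: measurable_enorm|apply: measurableT_comp].
by apply/funext => xi; rewrite powR_inv1// addr_ge0 ?enorm_ge0.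
Qed.

Lemma measurable_Q xi : measurable_fun setT (Q xi).
Proof.
have mk2 : measurable_fun setT (fun eta : P2 => kap (xi + eta)).
  exact: (measurableT_comp measurable_kap (measurable_padd xi)).
apply: measurable_funM.
  apply: measurable_funM => //; exact: (measurableT_comp mchi (measurable_padd xi)).
apply: measurable_funM => //; apply: measurable_funB; apply: measurable_funM => //.
  apply: measurable_funB => //; apply: measurable_funM => //; exact: measurable_kap.
by apply: measurable_funD => //; exact: measurable_kap.
Qed.

(** Fubini: the time integral is done first, at fixed frequencies.  The factor
    [cis (t |xi|)] undoes the propagation of the half wave [b = false]. *)
Lemma duh_wave b t xi : `|t| <= T -> rI mu2 (fun eta => `|Q xi eta|) ->
  cis (t * enorm xi) *
    duh T b (fun t xi => \sum_(mu < 3) (R_ b mu xi)%:C * Jmap wave mu ord0 t xi) t xi =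
  (sg R b * (2 * kappa0))%:C * cis (t * enorm xi * (1 - sg R b)) *
  cint mu2 (fun eta => (Q xi eta)%:C * osc t (sg R b * enorm xi + (enorm eta - enorm (xi + eta)))).
Proof.
move=> ht iQ; rewrite /duh ht.
pose ph eta := sg R b * enorm xi + (enorm eta - enorm (xi + eta)).
have mph : measurable_fun setT ph.
  apply: measurable_funD => //; apply: measurable_funB; first exact: measurable_enorm.
  exact: (measurableT_comp measurable_enorm (measurable_padd xi)).
pose F (z : (mR * P2)%type) : C := (Q xi z.2)%:C * ((osgn t z.1)%:C * cis (z.1 * ph z.2)).
have mF : mC F.
  apply: mCM; first by apply: mCR; exact: (measurableT_comp (measurable_Q xi) measurable_snd).
  apply: mCM; first by apply: mCR; exact: (measurableT_comp (measurable_osgn_t t) measurable_fst).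
  apply: mC_cis; apply: measurable_funM; first exact: measurable_fst.
  exact: (measurableT_comp mph measurable_snd).
have bF s eta : n1 (F (s, eta)) <= (2 * between 0 t s) * `|Q xi eta|.
  apply: (le_trans (n1M _ _)); rewrite n1R /= mulrC ler_wpM2r//.
  by apply: (le_trans (n1M _ _)); rewrite n1R mulrC ler_pM ?n1_ge0 ?n1_cis ?osgn_between.
have ib : rI leb (fun s => 2 * between 0 t s) by exact: (rIZ 2 (rI_between 0 t).1).
have fub := cfubini mF ib iQ bF.
have iF s : iC mu2 (fun eta => F (s, eta)).
  apply: (iC_le _ (rIZ (2 * between 0 t s) iQ) (bF s)).
  by apply: (mC_comp (phi := fun eta : P2 => (s, eta) : (mR * P2)%type) mF); exact: measurable_fun_pair.
have iF2 eta : iC leb (fun s => F (s, eta)).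
  have i := rIZ (`|Q xi eta|) ib.
  apply: (iC_le _ i) => [|s]; last by rewrite mulrC; exact: bF.
  by apply: (mC_comp (phi := fun s : mR => (s, eta) : (mR * P2)%type) mF); exact: measurable_fun_pair.
pose c : C := (sg R b * (2 * kappa0))%:C * cis (t * enorm xi * (1 - sg R b)).
have io : iC leb (fun s => cint mu2 (fun eta => F (s, eta))).
  have J0 : 0 <= Rintegral mu2 setT (fun eta => `|Q xi eta|) by exact: Rintegral_ge0.
  apply: (iC_le _ (rIZ (Rintegral mu2 setT (fun eta => `|Q xi eta|)) ib)) => [|s].
    exact: (mC_cint2 mu2 mF).
  apply: (le_trans (n1_cint_le (iF s) (rIZ (2 * between 0 t s) iQ) (bF s))).
  by rewrite RintegralZl// mulrC.
transitivity (c * cint leb (fun s => cint mu2 (fun eta => F (s, eta)))); last first.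
  rewrite fub /c; congr (_ * _); apply: eq_cint => eta.
  rewrite /osc -cintZ//.
  apply: (iC_le _ ib) => [|s].
    apply: mCM; first by apply: mCR; exact: measurable_osgn_t.
    by apply: mC_cis; apply: measurable_funM.
  by apply: (le_trans (n1M _ _)); rewrite n1R mulrC ler_pM ?n1_ge0 ?n1_cis ?osgn_between.
have cc : conjc (cis (t * enorm xi)) * cis (t * enorm xi) = 1 :> C.
  by rewrite -cisN -cisD addNr cis0.
have H s : prop b t xi s * (\sum_(mu < 3) (R_ b mu xi)%:C * Jmap wave mu ord0 s xi) =
    (conjc (cis (t * enorm xi)) * c) * cint mu2 (fun eta => F (s, eta)).
  rewrite sum_R_Jmap.
  have -> : cint mu2 (fun eta => F (s, eta)) = ((osgn t s)%:C * cis (s * (sg R b * enorm xi))) *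
     cint mu2 (fun eta => (Q xi eta)%:C * cis (s * (enorm eta - enorm (xi + eta)))).
    rewrite -cintZ; last first.
      apply: (iC_le _ (rIZ 2 iQ)) => [|eta].
        apply: mCM; first by apply: mCR; exact: measurable_Q.
        apply: mC_cis; apply: measurable_funM => //; apply: measurable_funB; first exact: measurable_enorm.
        exact: (measurableT_comp measurable_enorm (measurable_padd xi)).
      by apply: (le_trans (n1M _ _)); rewrite n1R mulrC ler_wpM2r ?n1_cis.
    by apply: eq_cint => eta; rewrite /F /ph /= mulrDr cisD; ring.
  rewrite /prop /c /half_wave -cisN.
  have -> : cis (- (sg R b * (t - s) * enorm xi)) =
     cis (- (t * enorm xi)) * cis (t * enorm xi * (1 - sg R b)) * cis (s * (sg R b * enorm xi)) :> C.
    by rewrite -!cisD; congr cis; ring.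
  by ring.
rewrite (_ : cint leb _ = conjc (cis (t * enorm xi)) * c *
  cint leb (fun s => cint mu2 (fun eta => F (s, eta)))).
  have G (a a' d e : C) : a * a' = 1 -> a' * (a * d * e) = d * e.
    by move=> h; rewrite !mulrA (mulrC a') h mul1r.
  exact: G.
by rewrite -cintZ//; apply: eq_cint => s; exact: H.
Qed.

(** Lower bound for [A_0]: the interactions with the phase
    [|xi| + |eta| - |xi + eta|] are resonant on a short time interval, those
    with the phase [|xi| + |xi + eta| - |eta|] are not. *)
Lemma Amap_wave_ge t (Om : R) xi : 0 < t <= T -> 0 < Om -> rI mu2 (Q xi) ->
  (forall eta, 0 <= Q xi eta) ->
  (forall eta, Q xi eta != 0 ->
     t * `|enorm xi + enorm eta - enorm (xi + eta)| <= 1 / 2 /\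
     Om <= enorm xi + enorm (xi + eta) - enorm eta) ->
  kappa0 * (t / 2 - 6 / Om) * Rintegral mu2 setT (Q xi) <=
  - complex.Re (cis (t * enorm xi) * Amap T wave ord0 t xi).
Proof.
move=> /andP[t0 tT] Om0 iQ Q0 hQ.
have ht : `|t| <= T by rewrite gtr0_norm.
have iQ' : rI mu2 (fun eta => `|Q xi eta|) by exact: rI_abs.
have k0 : 0 <= @kappa0 R by exact: kappa0_ge0.
pose f eta : C := (Q xi eta)%:C * osc t (enorm xi + (enorm eta - enorm (xi + eta))).
pose g eta : C := (Q xi eta)%:C * osc t (- enorm xi + (enorm eta - enorm (xi + eta))).
have mosc (ph : P2 -> R) : measurable_fun setT ph -> mC (fun eta => osc t (ph eta)).
  move=> mph; apply: (@mC_cint2 _ _ _ _ _ leb (fun z : (P2 * mR)%type => (osgn t z.2)%:C * cis (z.2 * ph z.1))).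
  apply: mCM; first by apply: mCR; exact: (measurableT_comp (measurable_osgn_t t) measurable_snd).
  apply: mC_cis; apply: measurable_funM; first exact: measurable_snd.
  exact: (measurableT_comp mph measurable_fst).
have mdiff : measurable_fun setT (fun eta : P2 => enorm eta - enorm (xi + eta)).
  apply: measurable_funB; first exact: measurable_enorm.
  exact: (measurableT_comp measurable_enorm (measurable_padd xi)).
have bosc ph : n1 (osc t ph) <= 2 * t.
  have ib : rI leb (fun s => 2 * between 0 t s) by exact: (rIZ 2 (rI_between 0 t).1).
  have b s : n1 ((osgn t s)%:C * cis (s * ph)) <= 2 * between 0 t s.
    by apply: (le_trans (n1M _ _)); rewrite n1R mulrC ler_pM ?n1_ge0 ?n1_cis ?osgn_between.
  have i : iC leb (fun s => (osgn t s)%:C * cis (s * ph)).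
    apply: (iC_le _ ib b); apply: mCM; first by apply: mCR; exact: measurable_osgn_t.
    by apply: mC_cis; apply: measurable_funM.
  apply: (le_trans (n1_cint_le i ib b)); rewrite RintegralZl//; last exact: (rI_between 0 t).1.
  by rewrite (rI_between 0 t).2 subr0 gtr0_norm.
have i1 ph : measurable_fun setT ph -> iC mu2 (fun eta => (Q xi eta)%:C * osc t (ph eta)).
  move=> mph; apply: (iC_le _ (rIZ (2 * t) iQ)) => [|eta].
    by apply: mCM; [apply: mCR; exact: measurable_Q|exact: mosc].
  by apply: (le_trans (n1M _ _)); rewrite n1R (ger0_norm (Q0 eta)) mulrC ler_wpM2r.
have iF : iC mu2 f by apply: i1; exact: measurable_funD.
have iG : iC mu2 g by apply: i1; exact: measurable_funD.
(* The half waves of A_0 yield f, which is resonant, and g, which is not. *)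
have EA : cis (t * enorm xi) * Amap T wave ord0 t xi =
   - (kappa0%:C * (cint mu2 f - cis (t * enorm xi * 2) * cint mu2 g)).
  rewrite /Amap big_bool mulrDr !(mulrCA (cis _)) !duh_wave//.
  rewrite /sg expr1 expr0 /f /g.
  under eq_cint do rewrite mulN1r.
  under [X in _ + _ * (_ * X)]eq_cint do rewrite mul1r.
  rewrite subrr mulr0 cis0 opprK mulr1 mulN1r mul1r (_ : 1 + 1 = 2)//.
  have h2 : (2 : C) != 0 by rewrite pnatr_eq0.
  have -> : (- (2 * kappa0))%:C = - (2 * kappa0%:C) :> C.
    by apply: C_ext; rewrite !ReImE /=; ring.
  have -> : (2 * kappa0)%:C = 2 * kappa0%:C :> C by apply: C_ext; rewrite !ReImE /=; ring.
  move: (kappa0%:C) (cint _ _) (cint _ _) (cis _) => k F G c.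
  by apply: (mulfI h2); field.
have ReG (k : R) (F G : C) : - complex.Re (- (k%:C * (F - G))) = k * (complex.Re F - complex.Re G).
  by rewrite !ReImE; ring.
rewrite EA ReG -mulrA ler_wpM2l//.
have h1 : t / 2 * Rintegral mu2 setT (Q xi) <= complex.Re (cint mu2 f).
  rewrite Re_cint -RintegralZl//; apply: le_Rintegral => //.
  - exact: (rIZ (t / 2) iQ).
  - exact: iF.1.
  move=> eta _; have -> : complex.Re (f eta) = Q xi eta *
      complex.Re (osc t (enorm xi + (enorm eta - enorm (xi + eta)))).
    by rewrite /f cReM cReR cImR mul0r subr0.
  apply: (@le_trans _ _ (Q xi eta * (t / 2))); first by rewrite mulrC.
  have [q0|q0] := eqVneq (Q xi eta) 0; first by rewrite q0 !mul0r.
  have [c1 _] := hQ eta q0; rewrite ler_wpM2l//; apply: Re_osc_ge => //.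
  by rewrite addrA.
have h2 : n1 (cint mu2 g) <= 3 / Om * Rintegral mu2 setT (Q xi).
  rewrite -RintegralZl//; apply: (n1_cint_le iG (rIZ (3 / Om) iQ)) => eta.
  apply: (le_trans (n1M _ _)); rewrite n1R (ger0_norm (Q0 eta)) mulrC.
  have [q0|q0] := eqVneq (Q xi eta) 0; first by rewrite q0 !mulr0.
  have [_ c2] := hQ eta q0; rewrite ler_wpM2r//.
  have E : - enorm xi + (enorm eta - enorm (xi + eta)) =
     - (enorm xi + enorm (xi + eta) - enorm eta) by ring.
  have n0 : - enorm xi + (enorm eta - enorm (xi + eta)) != 0.
    by rewrite E oppr_eq0 gt_eqF// (lt_le_trans Om0).
  apply: (le_trans (n1_osc_le t0 n0)); rewrite E normrN gtr0_norm ?(lt_le_trans Om0)//.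
  by rewrite ler_wpM2l// lef_pV2 ?posrE// (lt_le_trans Om0).
have h3 := le_trans (Re_n1 (cis (t * enorm xi * 2) * cint mu2 g)) (n1M _ _).
have h4 := le_trans h3 (ler_pM (n1_ge0 _) (n1_ge0 _) (n1_cis _) h2).
move: h4; rewrite ler_norml => /andP[_ h4].
rewrite mulrBl (_ : 6 / Om * _ = 2 * (3 / Om * Rintegral mu2 setT (Q xi))); last by ring.
by apply: lerB.
Qed.

End PositiveEnergy.

(** * The data *)
Section Data.
Context {R : realType}.
Local Notation C := R[i].
Local Notation mu2 := (@mu2 R).
Local Notation P2 := (measurableTypeR R * measurableTypeR R)%type.
Variable m : R.
Hypothesis m10 : 10 <= m.

Local Notation N := (m ^+ 2).

Definition box1 : P2 -> R := box N (11 / 10 * N) (- m) 0.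
Definition box2 : P2 -> R := box (2 * N) (11 / 5 * N) m (3 * m).
Definition boxX : P2 -> R := box N (11 / 10 * N) (2 * m) (3 * m).
Definition chi (xi : P2) : R := box1 xi + box2 xi.

Let m0 : 0 < m. Proof. by rewrite (lt_le_trans _ m10). Qed.
Let N100 : 100 <= N.
Proof.
have h : 0 <= (m - 10) * (m + 10) by have m10' := m10; apply: mulr_ge0; lra.
have -> : N = (m - 10) * (m + 10) + 100 by ring.
by rewrite lerDr.
Qed.

Lemma m_bounds : [/\ 10 <= m, 0 < m & 100 <= N].
Proof. by split. Qed.

Lemma box1E xi : box1 xi = (((N <= xi.1 <= 11 / 10 * N)%R && (- m <= xi.2 <= 0)%R))%:R.
Proof.
have [m10' m0' N100'] := m_bounds.
by apply: boxE; lra.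
Qed.
Lemma box2E xi : box2 xi = (((2 * N <= xi.1 <= 11 / 5 * N)%R && (m <= xi.2 <= 3 * m)%R))%:R.
Proof.
have [m10' m0' N100'] := m_bounds.
by apply: boxE; lra.
Qed.
Lemma boxXE xi : boxX xi = (((N <= xi.1 <= 11 / 10 * N)%R && (2 * m <= xi.2 <= 3 * m)%R))%:R.
Proof.
have [m10' m0' N100'] := m_bounds.
by apply: boxE; lra.
Qed.

Lemma chi_supp xi : chi xi != 0 -> [/\ N <= xi.1, xi.1 <= 11 / 5 * N & `|xi.2| <= 3 * m].
Proof.
have [m10' m0' N100'] := m_bounds.
rewrite /chi box1E box2E.
case: (boolP (_ && _)) => [/andP[/andP[h1 h2] /andP[h3 h4]] _|_].
  by split; rewrite ?ler_norml; [lra|lra|apply/andP; split; lra].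
rewrite add0r; case: (boolP (_ && _)) => [/andP[/andP[h1 h2] /andP[h3 h4]] _|_]; last by rewrite eqxx.
by split; rewrite ?ler_norml; [lra|lra|apply/andP; split; lra].
Qed.

Lemma chi_ge0 xi : 0 <= chi xi. Proof. by rewrite addr_ge0 ?box_ge0. Qed.

Lemma chi_le1 xi : chi xi <= 1.
Proof.
have [m10' m0' N100'] := m_bounds.
rewrite /chi box1E box2E; case: (boolP (_ && _)) => [/andP[/andP[h1 h2] _]|_].
  case: (boolP (_ && _)) => [/andP[/andP[h3 h4] _]|_]; last by rewrite addr0.
  by exfalso; lra.
by rewrite add0r; case: (_ && _).
Qed.

(** The sum of a frequency of [boxX] and one of the first box lies in the second
    box, and the sums with the second box lie beyond the data: there is only one
    interaction. *)
Lemma chi_chi xi eta : boxX xi != 0 -> chi eta * chi (xi + eta) = box1 eta.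
Proof.
have [m10' m0' N100'] := m_bounds.
rewrite boxXE; case: (boolP (_ && _)) => [/andP[/andP[h1 h2] /andP[h3 h4]] _|_]; last by rewrite eqxx.
have [e0|/chi_supp[z1 z2 z3]] := eqVneq (chi (xi + eta)) 0.
  rewrite e0 mulr0 box1E; case: (boolP (_ && _)) => // /andP[/andP[h5 h6] /andP[h7 h8]].
  move: e0; rewrite /chi box2E (_ : _ && _ = true) ?mulr1n => [|/=].
    have := box_ge0 N (11 / 10 * N) (- m) 0 (xi + eta); rewrite -/box1 /box1 => p q.
    by exfalso; lra.
  by apply/andP; split; apply/andP; split => /=; lra.
have b2 : box2 eta = 0.
  rewrite box2E; case: (boolP (_ && _)) => // /andP[/andP[h5 h6] /andP[h7 h8]].
  by exfalso; move: z2 => /=; lra.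
rewrite /chi b2 addr0.
have [->|n0] := eqVneq (box1 eta) 0; first by rewrite mul0r.
have [h5 h6 h7 h8] : [/\ N <= eta.1, eta.1 <= 11 / 10 * N, - m <= eta.2 & eta.2 <= 0].
  by move: n0; rewrite box1E; case: (boolP (_ && _)) => [/andP[/andP[? ?] /andP[? ?]] //|_]; rewrite eqxx.
have -> : box2 (xi + eta) = 1.
  by rewrite box2E (_ : _ && _ = true)//=; apply/andP; split; apply/andP; split => /=; lra.
have -> : box1 (xi + eta) = 0.
  rewrite box1E; case: (boolP (_ && _)) => // /andP[/andP[h9 h10] _].
  by exfalso; move: h10 => /=; lra.
by rewrite add0r mulr1.
Qed.

Lemma enorm_le_add (xi : R * R) (e : R) : 0 <= xi.1 -> 0 <= e -> xi.2 ^+ 2 <= 2 * xi.1 * e ->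
  enorm xi <= xi.1 + e.
Proof.
move=> h1 h2 h3; rewrite /enorm -[leRHS]ger0_norm ?addr_ge0// -sqrtr_sqr.
rewrite ler_sqrt ?sqr_ge0// sqrrD -addrA lerD2l (le_trans h3)//.
rewrite -[X in X <= _]addr0 (_ : 2 * xi.1 * e = xi.1 * e *+ 2) ?lerD2l ?sqr_ge0//.
by rewrite -mulr_natl; ring.
Qed.

Lemma sqr_le_box (x B : R) : `|x| <= B -> x ^+ 2 <= B ^+ 2.
Proof. by move=> h; rewrite -(real_normK (num_real x)) ler_sqr ?nnegrE// (le_trans _ h). Qed.

(** The geometry: frequencies in the boxes make an angle of order [1 / m] with
    the first axis, hence the bounds on the phases and on the null form. *)
Lemma box_geometry (xi eta : P2) : boxX xi != 0 -> box1 eta != 0 ->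
  [/\ `|enorm xi + enorm eta - enorm (xi + eta)| <= 6,
      N <= enorm xi + enorm (xi + eta) - enorm eta &
      m^-1 <= qform xi eta (xi + eta)].
Proof.
have [m10' m0' N100'] := m_bounds.
rewrite boxXE; case: (boolP (_ && _)) => [/andP[/andP[a1 a2] /andP[b1 b2]] _|_]; last by rewrite eqxx.
rewrite box1E; case: (boolP (_ && _)) => [/andP[/andP[c1 c2] /andP[d1 d2]] _|_]; last by rewrite eqxx.
pose zeta := xi + eta.
have z1 : zeta.1 = xi.1 + eta.1 by [].
have z2 : zeta.2 = xi.2 + eta.2 by [].
have xi0 : 0 < xi.1 by lra.
have eta0 : 0 < eta.1 by lra.
have zeta0 : 0 < zeta.1 by rewrite z1; lra.
have lo (x : R * R) : x.1 <= enorm x := le_trans (ler_norm _) (enorm_ge1 x).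
(* The norm exceeds the first coordinate by xi_2^2 / (2 xi_1) at most. *)
have u1 : enorm xi <= xi.1 + 5.
  apply: enorm_le_add; [lra|lra|].
  have : xi.2 ^+ 2 <= (3 * m) ^+ 2 by apply: sqr_le_box; rewrite ger0_norm; lra.
  by rewrite exprMn; lra.
have u2 : enorm eta <= eta.1 + 1.
  apply: enorm_le_add; [lra|lra|].
  have : eta.2 ^+ 2 <= m ^+ 2 by apply: sqr_le_box; rewrite ler_norml; apply/andP; split; lra.
  by lra.
have u3 : enorm zeta <= zeta.1 + 3.
  apply: enorm_le_add; [lra|lra|].
  have : zeta.2 ^+ 2 <= (3 * m) ^+ 2.
    by apply: sqr_le_box; rewrite z2 ler_norml; apply/andP; split; lra.
  by rewrite z1 exprMn; lra.
have l1 := lo xi; have l2 := lo eta; have l3 := lo zeta.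
split.
- by rewrite ler_norml -/zeta; apply/andP; split; lra.
- by rewrite -/zeta; lra.
rewrite -/zeta.
(* The slopes of eta and zeta have opposite signs, so only that of zeta can
   compensate the slope of xi in the null form; it is less than half as large. *)
have k1 : kap eta <= 0.
  by rewrite /kap pmulr_lle0// invr_gt0 (gtr0_norm eta0); lra.
have k2 : 0 <= kap zeta.
  by rewrite /kap (gtr0_norm zeta0); apply: divr_ge0; [rewrite z2|]; lra.
have k3 : kap zeta <= 3 / 4 / m.
  rewrite /kap (gtr0_norm zeta0) ler_pdivrMr; last lra.
  rewrite mulrAC ler_pdivlMr//.
  have : zeta.2 * m <= (3 * m) * m by rewrite ler_wpM2r ?(ltW m0)// z2; lra.
  by rewrite -mulrA -expr2; lra.
have r1 : 5 / 3 / m <= riesz (lift ord0 ord0) xi.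
  rewrite /riesz /crd /= ler_pdivlMr; last lra.
  rewrite mulrAC ler_pdivrMr//.
  have : (2 * m) * m <= xi.2 * m by rewrite ler_wpM2r ?(ltW m0).
  by rewrite -mulrA -expr2; lra.
have r2 : 0 <= riesz ord0 xi <= 1.
  apply/andP; split; first by rewrite /riesz /crd /= divr_ge0 ?enorm_ge0// ltW.
  exact: le_trans (ler_norm _) (riesz_le1 _ _).
case/andP: r2 => r2 r3.
have mi : 0 < m^-1 by rewrite invr_gt0.
have p1 : riesz (lift ord0 ord0) xi <= riesz (lift ord0 ord0) xi * (1 - kap eta * kap zeta).
  rewrite ler_peMr//; first by apply: le_trans r1; rewrite divr_ge0// ltW.
  by rewrite lerDl oppr_ge0 mulr_le0_ge0.
have p2 : riesz ord0 xi * (kap eta + kap zeta) <= kap zeta.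
  apply: (@le_trans _ _ (riesz ord0 xi * kap zeta)); first by rewrite ler_wpM2l//; lra.
  by rewrite ler_piMl.
rewrite /qform.
have -> : m^-1 = 2 * (5 / 3 / m - 3 / 4 / m) - 5 / 6 * m^-1 by field; rewrite gt_eqF.
lra.
Qed.

Lemma norm_qform_le (xi eta zeta : P2) : `|qform xi eta zeta| <= 8.
Proof.
have [m10' m0' N100'] := m_bounds.
have h1 : `|1 - kap eta * kap zeta| <= 2.
  apply: (le_trans (ler_normB _ _)); rewrite normr1 normrM.
  have := ler_pM (normr_ge0 _) (normr_ge0 _) (kap_le1 eta) (kap_le1 zeta); lra.
have h2 : `|kap eta + kap zeta| <= 2.
  by apply: (le_trans (ler_normD _ _)); have := kap_le1 eta; have := kap_le1 zeta; lra.
rewrite /qform normrM (ger0_norm (ler0n _ 2)).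
have h3 := ler_pM (normr_ge0 _) (normr_ge0 _) (riesz_le1 (lift ord0 ord0) xi) h1.
have h4 := ler_pM (normr_ge0 _) (normr_ge0 _) (riesz_le1 ord0 xi) h2.
rewrite -normrM in h3; rewrite -normrM in h4.
have := ler_normB (riesz (lift ord0 ord0) xi * (1 - kap eta * kap zeta))
  (riesz ord0 xi * (kap eta + kap zeta)); lra.
Qed.

Lemma measurable_chi : measurable_fun setT chi.
Proof. by apply: measurable_funD; exact: rI_m (rI_box _ _ _ _). Qed.

Lemma Q_boxX xi eta : boxX xi != 0 -> Q chi xi eta = box1 eta * qform xi eta (xi + eta).
Proof. by move=> h; rewrite /Q (chi_chi eta h). Qed.

Lemma rI_Q xi : boxX xi != 0 -> rI mu2 (Q chi xi).
Proof.
move=> h; apply: (rI_le _ (rIZ 8 (rI_box N (11 / 10 * N) (- m) 0))).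
  exact: measurable_Q measurable_chi xi.
move=> eta; rewrite Q_boxX// normrM (ger0_norm (box_ge0 _ _ _ _ _)) mulrC.
by rewrite ler_wpM2r ?box_ge0// norm_qform_le.
Qed.

Lemma Q_ge xi eta : boxX xi != 0 -> m^-1 * box1 eta <= Q chi xi eta.
Proof.
move=> h; rewrite Q_boxX// mulrC.
have [->|n0] := eqVneq (box1 eta) 0; first by rewrite !mul0r.
by rewrite ler_wpM2l ?box_ge0//; case: (box_geometry h n0).
Qed.

Lemma int_Q_ge xi : boxX xi != 0 -> N / 10 <= Rintegral mu2 setT (Q chi xi).
Proof.
move=> h.
have <- : Rintegral mu2 setT (fun eta => m^-1 * box1 eta) = N / 10.
  rewrite RintegralZl//; last exact: rI_box.
  rewrite int_box (_ : 11 / 10 * N - N = N / 10); last by field.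
  rewrite sub0r opprK (gtr0_norm m0) ger0_norm; last by rewrite divr_ge0// sqr_ge0.
  by rewrite mulrC mulfK ?gt_eqF.
apply: le_Rintegral => //; [exact: rIZ (rI_box _ _ _ _)|exact: rI_Q|].
by move=> eta _; exact: Q_ge.
Qed.

(** ** The data are piecewise continuous with compact support *)

(** Besides the edges of the boxes, the coordinate axes: the origin has to belong
    to the set, because the symbols of the system are not continuous there. *)
Definition Zset : P2 -> Prop :=
  lines [:: 0; N; 11 / 10 * N; 2 * N; 11 / 5 * N] [:: 0; m; 2 * m; 3 * m].

Lemma Zset_0 : Zset 0.
Proof. by rewrite /Zset /lines /= normr0 in_cons eqxx. Qed.

Lemma box_scont a b c d (xi : P2) : a <= b -> c <= d ->
  xi.1 != a -> xi.1 != b -> xi.2 != c -> xi.2 != d ->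
  scont (fun xi => (box a b c d xi)%:C) xi.
Proof.
by move=> ab cd h1 h2 h3 h4 x c1 c2; apply: ccvgR; apply: cvgM; apply: between_scont.
Qed.

Lemma kap_scont (xi : P2) : xi != 0 -> scont (fun xi => (kap xi)%:C) xi.
Proof.
have [m10' m0' N100'] := m_bounds.
move=> h x c1 c2; apply: ccvgR; apply: cvgM => //; apply: cvgV.
  apply/eqP => e; move/eqP : h; apply; apply: enorm_eq0.
  have := enorm_ge0 xi; have := normr_ge0 xi.1; lra.
by apply: cvgD; [exact: cvg_enorm|exact: cvg_norm].
Qed.

Lemma pol_scont k (xi : P2) : xi != 0 -> scont (pol k) xi.
Proof.
move=> h x c1 c2; rewrite /pol; case: ifP => _.
  by apply: ccvgB; [exact: ccvg_cst|apply: ccvgM; [exact: ccvg_cst|exact: kap_scont]].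
by apply: ccvgD; [exact: ccvg_cst|apply: ccvgM; [exact: ccvg_cst|exact: kap_scont]].
Qed.

Lemma mC_pol k : mC (@pol R k : P2 -> C).
Proof.
rewrite /pol; case: (k == ord0).
  by apply: mCB; [exact: mC_cst|apply: mCM; [exact: mC_cst|apply: mCR; exact: measurable_kap]].
by apply: mCD; [exact: mC_cst|apply: mCM; [exact: mC_cst|apply: mCR; exact: measurable_kap]].
Qed.

Lemma chi_scont xi : ~ Zset xi -> scont (fun xi => (chi xi)%:C) xi.
Proof.
have [g1 g2 g3 g4] : [/\ 0 <= N, 0 <= 11 / 10 * N, 0 <= 2 * N & 0 <= 11 / 5 * N].
  by have N100' := N100; split; lra.
have [g5 g6] : 0 <= m /\ 0 <= 3 * m by have m0' := m0; split; lra.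
have [g7 g8] : N <= 11 / 10 * N /\ 2 * N <= 11 / 5 * N by have N100' := N100; split; lra.
have [g9 g10] : - m <= 0 /\ m <= 3 * m by have m0' := m0; split; lra.
move=> /negP; rewrite /Zset /lines negb_or !inE !negb_or => /andP[/and5P[x0 x1 x2 x3 x4] /and4P[y0 y1 y2 y3]].
have N0 : 0 < N by rewrite exprn_gt0.
have ne (x a : R) : 0 <= a -> `|x| != a -> x != a.
  by move=> a0; apply: contra => /eqP ->; rewrite ger0_norm.
have neN (x a : R) : 0 <= a -> `|x| != a -> x != - a.
  by move=> a0; apply: contra => /eqP ->; rewrite normrN ger0_norm.
have E : (fun xi => (chi xi)%:C) = fun xi => (box1 xi)%:C + (box2 xi)%:C.
  by apply/funext => z; rewrite -rcD.
have p1 : xi.1 != N by apply: ne => //.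
have p2 : xi.1 != 11 / 10 * N by apply: ne => //.
have p3 : xi.1 != 2 * N by apply: ne => //.
have p4 : xi.1 != 11 / 5 * N by apply: ne => //.
have p5 : xi.2 != - m by apply: neN => //.
have p6 : xi.2 != 0 by apply: ne.
have p7 : xi.2 != m by apply: ne => //.
have p8 : xi.2 != 3 * m by apply: ne => //.
by rewrite E; apply: scontD; apply: box_scont => //.
Qed.

Lemma Zset_neq0 xi : ~ Zset xi -> xi != 0.
Proof. by move=> h; apply/eqP => e; apply: h; rewrite e; exact: Zset_0. Qed.

Definition dataC (tau : R) (k : 'I_2) (xi : P2) : C := tau%:C * ((chi xi)%:C * pol k xi).

Definition Kdata : R := 2 / wt (11 / 5 * N, 3 * m).

Lemma Kdata_gt0 : 0 < Kdata. Proof. by rewrite divr_gt0// wt_gt0. Qed.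

Lemma n1_chi_pol k xi : n1 ((chi xi)%:C * pol k xi) <= chi xi * 2.
Proof.
apply: (le_trans (n1M _ _)); rewrite n1R (ger0_norm (chi_ge0 _)).
by rewrite ler_wpM2l ?chi_ge0 ?n1_pol.
Qed.

Lemma fld_data tau k : fld Zset (`|tau| * Kdata) (fun _ => dataC tau k).
Proof.
have [m10' m0' N100'] := m_bounds.
apply: (fld_static (K := `|tau| * Kdata)).
- apply: mCM; first exact: mC_cst.
  by apply: mCM; [apply: mCR; exact: measurable_chi|exact: mC_pol].
- rewrite /Kdata mulrA; apply: n1_box_le; first by rewrite mulr_ge0.
    move=> xi; apply: (le_trans (n1M _ _)); rewrite n1R ler_wpM2l//.
    apply: (le_trans (n1_chi_pol k xi)).
    by rewrite -[leRHS]mul1r ler_wpM2r// chi_le1.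
  move=> xi h; have : chi xi != 0.
    by apply: contra h => /eqP e; rewrite /dataC e (_ : 0%:C = 0 :> C)// mul0r mulr0.
  by move=> /chi_supp[h1 h2 h3]; split=> //; rewrite ger0_norm//; lra.
- move=> xi hz; apply: scontM; first exact: scont_cst.
  by apply: scontM; [exact: chi_scont|apply: pol_scont; exact: Zset_neq0].
Qed.

Lemma freemap_data tau k t xi : freemap (dataC tau) k t xi = tau%:C * wave chi k t xi.
Proof.
have [m10' m0' N100'] := m_bounds.
have [e|/chi_supp[h1 _ _]] := eqVneq (chi xi) 0.
  have z : (chi xi)%:C = 0 :> C by rewrite e.
  rewrite /freemap /wave z mul0r !mulr0 big1// => b _.
  by rewrite big1 ?mulr0// => l _; rewrite /dataC z mul0r !mulr0.
have x0 : 0 < xi.1 by lra.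
have E b : \sum_(l < 2) Pi_ b xi k l * dataC tau l xi =
    tau%:C * (chi xi)%:C * (if b then 0 else pol k xi).
  rewrite -(Pi_pol b k x0) big_distrr /=; apply: eq_bigr => l _.
  by rewrite /dataC; ring.
have S (F : bool -> C) : \sum_(b : bool) F b = F true + F false by exact: big_bool.
transitivity (half_wave true t xi * (tau%:C * (chi xi)%:C * 0) +
    half_wave false t xi * (tau%:C * (chi xi)%:C * pol k xi)).
  by rewrite /freemap S; congr (_ * _ + _ * _); [exact: (E true)|exact: (E false)].
rewrite /wave; move: (half_wave _ _ _) (half_wave _ _ _) (chi xi)%:C (pol k xi) tau%:C => a b c d e.
by ring.
Qed.

Lemma fld_wave k : fld Zset (16 * Kdata) (wave chi k).
Proof.
have h := fld_freemap Zset_0 (fun k => fld_data 1 k) k.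
rewrite normr1 mul1r in h; congr fld: h.
by apply/funext => t; apply/funext => xi; rewrite freemap_data (_ : 1%:C = 1 :> C)// mul1r.
Qed.

Variables (T t0 : R).
Hypothesis T0 : 0 < T.
Hypothesis t0T : 0 < t0 <= T.
Hypothesis t012 : t0 <= 1 / 12.
Hypothesis Nt0 : 24 / t0 <= N.

(** The bounds on [t0] ensure that the resonant phase, at most 6, turns by 1/2
    at most, and that the non-resonant part is at most half of the resonant one. *)
Lemma Amap_data_ge xi : boxX xi != 0 ->
  kappa0 * (t0 / 40 * N) <= - complex.Re (cis (t0 * enorm xi) * Amap T (wave chi) ord0 t0 xi).
Proof.
have [m10' m0' N100'] := m_bounds.
move=> h.
have N0 : 0 < N by rewrite exprn_gt0.
have [t1 t2] := andP t0T; have t12 := t012.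
have q0 eta : 0 <= Q chi xi eta.
  by apply: le_trans (Q_ge eta h); rewrite mulr_ge0 ?box_ge0// invr_ge0 ltW.
have hq eta : Q chi xi eta != 0 ->
    t0 * `|enorm xi + enorm eta - enorm (xi + eta)| <= 1 / 2 /\
    N <= enorm xi + enorm (xi + eta) - enorm eta.
  rewrite Q_boxX// mulf_eq0 negb_or => /andP[n0 _].
  have [g1 g2 _] := box_geometry h n0; split=> //.
  have := ler_pM (ltW t1) (normr_ge0 _) t012 g1; lra.
have := Amap_wave_ge fld_wave measurable_chi
  t0T N0 (rI_Q h) q0 hq.
apply: le_trans; rewrite -[leRHS]mulrA ler_wpM2l ?kappa0_ge0//.
have c : t0 / 4 <= t0 / 2 - 6 / N.
  have : 6 / N <= t0 / 4; last by lra.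
  rewrite ler_pdivrMr//; move: Nt0; rewrite ler_pdivrMr// => H.
  by rewrite mulrAC ler_pdivlMr//; lra.
have i := int_Q_ge h.
have p1 : 0 <= t0 / 4 by lra.
have p2 : 0 <= N / 10 by lra.
by apply: le_trans (ler_pM p1 p2 c i); rewrite le_eqVlt; apply/orP; left; apply/eqP; field.
Qed.

End Data.

(** * Testing the gauge field *)
Section Functional.
Context {R : realType}.
Local Notation C := R[i].
Local Notation mu2 := (@mu2 R).
Local Notation P2 := (measurableTypeR R * measurableTypeR R)%type.
Local Notation normc := (@Normc.normc R).
Variables (s T t0 : R) (e : P2 -> R) (c0 : R).
Hypothesis ht0 : 0 < t0 <= T.
Hypothesis ie : rI mu2 e.
Hypothesis e01 : forall xi, e xi = 0 \/ e xi = 1.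
Hypothesis he : forall xi, e xi != 0 -> (1 + enorm xi) `^ (- s) <= c0.
Hypothesis c00 : 0 <= c0.

(** The phase undoes the propagation of one half wave of [A_0], so that the
    contributions add up instead of oscillating. *)
Definition testf (xi : P2) : C := (e xi)%:C * cis (t0 * enorm xi).

Definition ell (u : R -> state R) : R :=
  - complex.Re (cint mu2 (fun xi => testf xi * (u t0).1 ord0 xi)).

(** The remainders of a Taylor expansion need not lie in [CT], hence a domain that
    asks for no more than what makes [ell] linear. *)
Definition dom (u : R -> state R) : Prop :=
  mC ((u t0).1 ord0 : P2 -> C) /\ iC mu2 (fun xi => testf xi * (u t0).1 ord0 xi).

Let e0 xi : 0 <= e xi. Proof. by case: (e01 xi) => ->. Qed.

Lemma normc_cis (x : R) : normc (cis x) = 1.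
Proof. by rewrite /cis /= cos2Dsin2 sqrtr1. Qed.

Lemma normc_testf xi (z : C) : normc (testf xi * z) = e xi * normc z.
Proof.
rewrite /testf !Normc.normcM normc_cis mulr1; congr (_ * _).
by rewrite /= expr0n /= addr0 sqrtr_sqr ger0_norm.
Qed.

Lemma n1_le_normc (z : C) : n1 z <= 2 * normc z.
Proof.
have h1 := Re_normc z.
have h2 : `|complex.Im z| <= normc z.
  by case: z {h1} => a b /=; rewrite -sqrtr_sqr ler_sqrt ?lerDr ?addr_ge0 ?sqr_ge0.
by rewrite /n1; lra.
Qed.

Lemma mC_testf : mC testf.
Proof.
apply: mCM; first by apply: mCR; exact: rI_m ie.
by apply: mC_cis; apply: measurable_funM; [exact: measurable_cst|exact: measurable_enorm].
Qed.

Definition dualc : R := Num.sqrt (Rintegral mu2 setT (fun xi => c0 ^+ 2 * e xi)).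

(** Cauchy-Schwarz, with the weights of [H^s] and of its dual. *)
Lemma pairing_le (g : P2 -> C) : mC g ->
  (\int[mu2]_xi (e xi * normc (g xi))%:E <= dualc%:E * Hs_norm s g)%E.
Proof.
move=> mg.
pose f1 xi : R := e xi * (1 + enorm xi) `^ (- s).
pose f2 xi : R := (1 + enorm xi) `^ s * normc (g xi).
have m1 : measurable_fun setT f1.
  by apply: measurable_funM; [exact: rI_m ie|exact: measurable_bracket].
have m2 : measurable_fun setT f2.
  by apply: measurable_funM; [exact: measurable_bracket|exact: measurable_normc].
have half : 2^-1 + 2^-1 = 1 :> R by field.
have H := @hoelder _ _ _ mu2 f1 f2 2 2 m1 m2 (ltr0n _ 2) (ltr0n _ 2) half.
have E xi : f1 xi * f2 xi = e xi * normc (g xi).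
  have p : 0 < 1 + enorm xi by rewrite ltr_pwDl// enorm_ge0.
  rewrite /f1 /f2 powRN -!mulrA; congr (_ * _); rewrite mulKf// gt_eqF//.
  exact: powR_gt0.
have E1 : (\int[mu2]_xi (e xi * normc (g xi))%:E)%E = Lnorm mu2 1 (EFin \o (f1 \* f2)).
  rewrite Lnorm1; apply: eq_integral => xi _ /=; rewrite E ger0_norm//.
  by rewrite mulr_ge0 ?normc_ge0.
rewrite E1; apply: (le_trans H).
have L1 : (Lnorm mu2 2%:E (EFin \o f1) <= dualc%:E)%E.
  apply: (L2_le m1 (rIZ (c0 ^+ 2) ie)) => xi; rewrite /f1 exprMn mulrC.
  case: (e01 xi) => ex; first by rewrite ex expr0n /= !mulr0.
  rewrite ex expr1n !mulr1 ler_sqr ?nnegrE ?powR_ge0//.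
  by apply: he; rewrite ex oner_neq0.
by apply: lee_wpmul2r => //; exact: Lnorm_ge0.
Qed.

Lemma Hs_norm_le_CT u : (Hs_norm s ((u t0).1 ord0) <= CT_norm s T u)%E.
Proof.
have [t00 t0T] := andP ht0.
apply: (@le_trans _ _ (state_norm s (u t0))).
  rewrite /state_norm big_ord_recl -addeA leeDl// adde_ge0// sume_ge0// => i _; exact: Lnorm_ge0.
apply: ereal_sup_ubound; exists t0 => //.
by rewrite /= in_itv /= t0T andbT (le_trans _ (ltW t00))// oppr_le0 (le_trans (ltW t00)).
Qed.

Lemma ell_le u : dom u -> (`|ell u|%:E <= dualc%:E * CT_norm s T u)%E.
Proof.
move=> [mu iu].
apply: (@le_trans _ _ (dualc%:E * Hs_norm s ((u t0).1 ord0))%E); last first.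
  by rewrite lee_wpmul2l// ?lee_fin ?sqrtr_ge0// Hs_norm_le_CT.
apply: le_trans (pairing_le mu).
have ia := rI_abs iu.1.
apply: (@le_trans _ _ (Rintegral mu2 setT (fun xi => `|complex.Re (testf xi * (u t0).1 ord0 xi)|))%:E).
  by rewrite lee_fin /ell normrN Re_cint; exact: le_normr_Rintegral iu.1.
rewrite /Rintegral fineK; last exact: integrable_fin_num.
apply: ge0_le_integral => //.
- by apply/measurable_EFinP; exact: rI_m ia.
- apply/measurable_EFinP; apply: measurable_funM; first exact: rI_m ie.
  exact: measurable_normc.
- by move=> xi _; rewrite lee_fin -normc_testf Re_normc.
Qed.

Lemma CT_dom u : CT s T u -> dom u.
Proof.
move=> hu; have [t00 t0T] := andP ht0.
have tin : t0 \in `[- T, T].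
  by rewrite in_itv /= t0T andbT (le_trans _ (ltW t00))// oppr_le0 (le_trans (ltW t00)).
have [[hA _] _] := hu t0 tin.
have [[mg fg] _] := hA ord0.
have {}mg : mC ((u t0).1 ord0 : P2 -> C) by [].
split=> //.
have i : rI mu2 (fun xi => e xi * normc ((u t0).1 ord0 xi)).
  apply/integrableP; split.
    apply/measurable_EFinP; apply: measurable_funM; first exact: rI_m ie.
    exact: measurable_normc.
  rewrite (eq_integral (fun xi => (e xi * normc ((u t0).1 ord0 xi))%:E)); last first.
    by move=> xi _ /=; rewrite ger0_norm// mulr_ge0 ?normc_ge0.
  apply: (le_lt_trans (pairing_le mg)).
  by rewrite lte_mul_pinfty// lee_fin sqrtr_ge0.
apply: (iC_le _ (rIZ 2 i)).
  by apply: mCM => //; exact: mC_testf.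
by move=> xi; apply: (le_trans (n1_le_normc _)); rewrite normc_testf.
Qed.

Lemma comb_component a (u v : R -> state R) :
  ((a%:C *: u + v) t0).1 ord0 = (fun xi => a%:C * (u t0).1 ord0 xi + (v t0).1 ord0 xi).
Proof. by []. Qed.

Lemma functional_ell : functional (CT s T) (CT_norm s T) dualc dom ell.
Proof.
split.
- exact: sqrtr_ge0.
- exact: CT_dom.
- move=> a u v [m1 i1] [m2 i2]; rewrite /dom comb_component.
  split.
    by apply: mCD => //; apply: mCM => //; exact: mC_cst.
  have := iCD (iCZ a%:C i1) i2; congr iC; apply/funext => xi.
  by rewrite mulrDr mulrCA.
- move=> a u v [m1 i1] [m2 i2]; rewrite /ell comb_component.
  rewrite (eq_cint _ (g := fun xi => a%:C * (testf xi * (u t0).1 ord0 xi) + testf xi * (v t0).1 ord0 xi)).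
    rewrite cintD//; last exact: iCZ.
    rewrite cintZ//; move: (cint _ _) (cint _ _) => z w.
    by rewrite !ReImE; ring.
  by move=> xi; rewrite mulrDr mulrCA.
- exact: ell_le.
Qed.

End Functional.

Section Homogeneity.
Context {R : realType}.
Local Notation C := R[i].
Local Notation mu2 := (@mu2 R).
Local Notation P2 := (measurableTypeR R * measurableTypeR R)%type.

Lemma Hs_norm_scale s (a : R) (g : P2 -> C) : mC g ->
  Hs_norm s (fun xi => a%:C * g xi) = (`|a|%:E * Hs_norm s g)%E.
Proof.
move=> mg; rewrite /Hs_norm unlock.
have mf : measurable_fun setT (fun xi : P2 => (1 + enorm xi) `^ s * Normc.normc (g xi)).
  by apply: measurable_funM; [exact: measurable_bracket|exact: measurable_normc].
have E : (\int[leb2 (R := R)]_x `|((1 + enorm x) `^ s * Normc.normc (a%:C * g x))%:E| `^ 2 =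
    (`|a| ^+ 2)%:E * \int[leb2 (R := R)]_x `|((1 + enorm x) `^ s * Normc.normc (g x))%:E| `^ 2)%E.
  rewrite -ge0_integralZl_EFin ?sqr_ge0//.
  - apply: eq_integral => x _; rewrite !poweR_EFin -EFinM; congr (_%:E).
    rewrite !(powR_mulrn 2) ?normr_ge0// Normc.normcM -exprMn; congr (_ ^+ 2).
    have -> : Normc.normc a%:C = `|a| by rewrite /= expr0n /= addr0 sqrtr_sqr.
    by rewrite mulrCA normrM normr_id.
  - by move=> x _; exact: poweR_ge0.
  - rewrite (_ : (fun x => _) = fun x : P2 => (`|(1 + enorm x) `^ s * Normc.normc (g x)| `^ 2)%:E).
      apply/measurable_EFinP.
      apply: (measurableT_comp (f := fun x : R => x `^ 2) (measurable_powR 2)).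
      exact: measurableT_comp.
    by apply/funext => x; rewrite poweR_EFin.
rewrite E poweRM ?lee_fin ?sqr_ge0//.
  by rewrite poweR_EFin powR12_sqrt ?sqr_ge0// sqrtr_sqr normr_id.
by apply: integral_ge0 => x _; exact: poweR_ge0.
Qed.

Lemma state_norm_scale s (a : R) (u : state R) :
  (forall nu, mC (u.1 nu : P2 -> C)) -> (forall k, mC (component u.2 k : P2 -> C)) ->
  state_norm s (a%:C *: u) = (`|a|%:E * state_norm s u)%E.
Proof.
move=> m1 m2; rewrite /state_norm.
have E1 nu : Hs_norm s ((a%:C *: u).1 nu) = (`|a|%:E * Hs_norm s (u.1 nu))%E.
  exact: (Hs_norm_scale s a (m1 nu)).
have E2 k : Hs_norm s (component (a%:C *: u).2 k) = (`|a|%:E * Hs_norm s (component u.2 k))%E.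
  rewrite -(Hs_norm_scale s a (m2 k)); congr Hs_norm; apply/funext => xi.
  by rewrite /component /= mxE.
rewrite (eq_bigr _ (fun nu _ => E1 nu)) (eq_bigr _ (fun k _ => E2 k)).
rewrite -!ge0_sume_distrr; [|by move=> *; exact: Lnorm_ge0..].
by rewrite ge0_muleDr// sume_ge0// => *; exact: Lnorm_ge0.
Qed.

Lemma powR_range (X x r : R) : 0 < X -> X <= x <= 5 * X -> x `^ r <= 5 `^ `|r| * X `^ r.
Proof.
move=> X0 /andP[h1 h2]; have x0 : 0 < x := lt_le_trans X0 h1.
have [r0|r0] := leP 0 r.
  rewrite (ger0_norm r0) -powRM ?(ltW X0)//.
  by apply: ge0_ler_powR; rewrite ?nnegrE ?mulr_ge0 ?(ltW X0) ?(ltW x0).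
have rE : r = - `|r| by rewrite ltr0_norm// opprK.
have h : x `^ r <= X `^ r.
  rewrite rE !powRN lef_pV2 ?posrE ?powR_gt0//.
  by apply: ge0_ler_powR; rewrite ?nnegrE ?(ltW X0) ?(ltW x0).
apply: (le_trans h); rewrite ler_peMl ?powR_ge0//.
by rewrite -[leLHS](powRr0 5) ler_powR// ler1n.
Qed.

(** Letting [t] tend to 0 gives [a = 0]; after division by [t^2] it gives [b = 0]. *)
Lemma quad_limit (a b C : R) :
  (forall e, 0 < e -> exists2 d, 0 < d & forall t, 0 < t < d ->
     `|a + b * t ^+ 2| <= (e + C * t ^+ 2) * t ^+ 2) -> a = 0 /\ b = 0.
Proof.
move=> h.
have pick (d c : R) : 0 < d -> 0 < c -> exists2 t, 0 < t < d & t ^+ 2 <= c /\ t ^+ 2 <= 1.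
  move=> d0 c0; pose t := Num.min (d / 2) (Num.min c 1).
  have t0 : 0 < t by rewrite !lt_min divr_gt0// c0 ltr01.
  have [t1 t2 t3] : [/\ t <= d / 2, t <= c & t <= 1].
    by rewrite /t !ge_min !lexx /= ?orbT; split.
  have tt : t ^+ 2 <= t by rewrite expr2 ler_piMl// ltW.
  exists t; first by rewrite t0 /=; lra.
  by split; lra.
have a0 : a = 0.
  apply/eqP; rewrite -normr_eq0 eq_le normr_ge0 andbT leNgt; apply/negP => p.
  have [d d0 hd] := h 1 ltr01.
  pose c := `|b| + 1 + `|C|.
  have c0 : 0 < c by rewrite /c; have := normr_ge0 b; have := normr_ge0 C; lra.
  have [t ht [t1 t2]] := pick d (`|a| / (2 * c)) d0 ltac:(by rewrite divr_gt0// mulr_gt0).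
  have := hd t ht; have q0 := sqr_ge0 t.
  have e1 : `|a| <= `|a + b * t ^+ 2| + `|b| * t ^+ 2.
    by rewrite -{1}(addrK (b * t ^+ 2) a) (le_trans (ler_normB _ _))// normrM (ger0_norm q0).
  have e2 : (1 + C * t ^+ 2) * t ^+ 2 <= (1 + `|C|) * t ^+ 2.
    rewrite ler_wpM2r// lerD2l (le_trans (ler_norm _))// normrM (ger0_norm q0).
    by rewrite ler_piMr.
  move=> e3; have : `|a| <= c * t ^+ 2 by rewrite /c !mulrDl; rewrite mulrDl in e2; lra.
  move: t1; rewrite ler_pdivlMr ?mulr_gt0//; lra.
split=> //; apply/eqP; rewrite -normr_eq0 eq_le normr_ge0 andbT leNgt; apply/negP => p.
have [d d0 hd] := h (`|b| / 4) ltac:(by rewrite divr_gt0).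
have c0 : 0 < `|C| + 1 by rewrite ltr_wpDl.
have [t ht [t1 t2]] := pick d (`|b| / 4 / (`|C| + 1)) d0 ltac:(by rewrite !divr_gt0).
have t0 : 0 < t ^+ 2 by rewrite exprn_gt0//; case/andP: ht.
have := hd t ht; rewrite a0 add0r normrM (gtr0_norm t0) ler_pM2r//.
move: t1; rewrite ler_pdivlMr// => t1.
have : C * t ^+ 2 <= `|C| * t ^+ 2 by rewrite ler_wpM2r ?ler_norm// ltW.
lra.
Qed.

End Homogeneity.

(** * Failure of second-order differentiability *)
Section Conclusion.
Context {R : realType}.
Local Notation C := R[i].
Local Notation mu2 := (@mu2 R).
Local Notation P2 := (measurableTypeR R * measurableTypeR R)%type.

Lemma kappa0_gt0 : 0 < @kappa0 R.
Proof.
have I0 : 0 < @Irho R.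
  have h : Rintegral mu2 setT (fun xi => 1 / 4 * box 0 1 0 1 xi) <= @Irho R.
    apply: le_Rintegral => //; [exact: rIZ (rI_box 0 1 0 1)|exact: rI_rho|].
    move=> xi _; rewrite boxE ?ler01//.
    case: (boolP (_ && _)) => [/andP[/andP[a1 a2] /andP[b1 b2]]|_]; last first.
      by rewrite mulr0 ltW// rho_gt0.
    have r1 (x : R) : 0 <= x -> x <= 1 -> 1 / 2 <= rho1 x.
      move=> x0 x1; rewrite div1r lef_pV2 ?posrE ?oneDsqr_gt0//.
      have : x ^+ 2 <= 1 by rewrite expr2 mulr_ile1.
      by lra.
    rewrite mulr1n; have := ler_pM (divr_ge0 ler01 (ler0n _ 2)) (divr_ge0 ler01 (ler0n _ 2)) (r1 _ a1 a2) (r1 _ b1 b2).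
    by apply: le_trans; rewrite le_eqVlt; apply/orP; left; apply/eqP; field.
  apply: lt_le_trans h; rewrite RintegralZl//; last exact: rI_box.
  by rewrite int_box subr0 normr1 !mulr1 divr_gt0.
by rewrite mulr_gt0 ?exprn_gt0 ?invr_gt0 ?exprn_gt0 ?mulr_gt0 ?pi_gt0.
Qed.

Section Scaling.
Variable Z : P2 -> Prop.
Hypothesis Z_ae : forall xi, {ae mu2, forall eta, ~ Z (psub xi eta)}.
Hypothesis Z_opp : forall xi, Z (- xi) -> Z xi.
Hypothesis Z_0 : Z 0.
Variables (T : R) (K tau : R) (psi psi' : 'I_2 -> R -> P2 -> C).
Hypothesis h : forall k, fld Z K (psi k).
Hypothesis E : forall k t xi, psi' k t xi = tau%:C * psi k t xi.

Lemma Jmap_scale mu nu t xi : Jmap psi' mu nu t xi = (tau ^+ 2)%:C * Jmap psi mu nu t xi.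
Proof.
rewrite /Jmap big_distrr /=; apply: eq_bigr => p _; rewrite mulrCA; congr (_ * _).
have m k := fld_mt t (h k); have b k := fld_b (h k) t.
rewrite /conv -cintZ; last first.
  exact: (iC_conv xi (mC_refl (m p.2.1)) (m p.2.2) (wbound_refl (b p.2.1)) (b p.2.2)).
apply: eq_cint => eta; rewrite /refl !E cJM cJ_R expr2 rcM.
by ring.
Qed.

Lemma duh_scale b (G G' : R -> P2 -> C) (c : C) L t xi : fld Z L G ->
  (forall r, G' r xi = c * G r xi) -> duh T b G' t xi = c * duh T b G t xi.
Proof.
move=> hG e; rewrite /duh; case: (`|t| <= T); last by rewrite mulr0.
rewrite -cintZ; last exact: (iC_duh b t xi hG).
by apply: eq_cint => r; rewrite e mulrCA.
Qed.

Lemma Amap_scale nu t xi : Amap T psi' nu t xi = (tau ^+ 2)%:C * Amap T psi nu t xi.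
Proof.
have hJ mu := lp1 (lp_Jmap Z_ae Z_opp (fun k => lp_refl0 (h k)) mu nu).
have hR b := lp1 (lp_comb (symb_R Z_0 b) (fun mu => lp_refl0 (hJ mu))).
have D b : duh T b (fun t xi => \sum_(mu < 3) (R_ b mu xi)%:C * Jmap psi' mu nu t xi) t xi =
    (tau ^+ 2)%:C * duh T b (fun t xi => \sum_(mu < 3) (R_ b mu xi)%:C * Jmap psi mu nu t xi) t xi.
  apply: (duh_scale (L := _) b t (hR b)) => r.
  rewrite big_distrr /=; apply: eq_bigr => mu _; by rewrite Jmap_scale mulrCA.
transitivity (\sum_(b : bool) (tau ^+ 2)%:C * (- 2^-1 *
    duh T b (fun t xi => \sum_(mu < 3) (R_ b mu xi)%:C * Jmap psi mu nu t xi) t xi)).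
  by apply: eq_bigr => b _; rewrite D mulrCA.
by rewrite -big_distrr.
Qed.

End Scaling.

Definition data (m tau : R) : state R :=
  (fun _ _ => 0, fun xi => \col_k dataC m tau k xi).

Lemma data_scale m tau : tau%:C *: data m 1 = data m tau.
Proof.
congr pair.
  by apply/funext => nu; apply/funext => xi /=; exact: mulr0.
apply/funext => xi; apply/matrixP => k j; rewrite !mxE.
by rewrite /dataC (_ : 1%:C = 1 :> C)// mul1r.
Qed.

Lemma component_data m tau k : component (data m tau).2 k = dataC m tau k.
Proof. by apply/funext => xi; rewrite /component /= mxE. Qed.

Section FixedFrequency.
Variables (s T t0 m : R).
Hypothesis T0 : 0 < T.
Hypothesis ht0 : 0 < t0 <= T.
Hypothesis m10 : 10 <= m.
Local Notation N := (m ^+ 2).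
Local Notation e := (@boxX R m).

Let m0 : 0 < m. Proof. by rewrite (lt_le_trans _ m10). Qed.

Lemma boxX_01 xi : e xi = 0 \/ e xi = 1.
Proof. by rewrite (boxXE m10); case: (_ && _); [right|left]. Qed.

Lemma bracket_range (xi : P2) : N <= xi.1 -> xi.1 <= 11 / 5 * N -> `|xi.2| <= 3 * m ->
  N <= 1 + enorm xi <= 5 * N.
Proof.
move=> h1 h2 h3; have m10' := m10; have m0' := m0.
have mN : 10 * m <= N by rewrite expr2 ler_wpM2r// ltW.
have := enorm_le_l1 xi; have := enorm_ge1 xi; have := ler_norm xi.1.
by rewrite (ger0_norm (_ : 0 <= xi.1)); [move=> *; apply/andP; split; lra|lra].
Qed.

Definition bracket_cst : R := 5 `^ `|s|.

Lemma bracket_boxX xi : e xi != 0 -> (1 + enorm xi) `^ (- s) <= bracket_cst / N `^ s.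
Proof.
rewrite (boxXE m10); case: (boolP (_ && _)) => [/andP[/andP[a1 a2] /andP[b1 b2]] _|_];
  last by rewrite eqxx.
rewrite -powRN /bracket_cst -(normrN s); apply: powR_range; first by rewrite exprn_gt0.
have m0' := m0; have N0 : 0 <= N by rewrite sqr_ge0.
by apply: bracket_range; [|lra|rewrite ger0_norm; lra].
Qed.

Lemma bracket_chi xi : chi m xi != 0 -> (1 + enorm xi) `^ s <= bracket_cst * N `^ s.
Proof.
move=> /(chi_supp m10)[h1 h2 h3]; apply: powR_range; first by rewrite exprn_gt0.
exact: bracket_range.
Qed.

Definition dual_bracket : R := bracket_cst / N `^ s.
Lemma dual_bracket_ge0 : 0 <= dual_bracket. Proof. by rewrite divr_ge0 ?powR_ge0. Qed.

Local Notation ellX := (@ell R t0 e).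
Local Notation dualX := (@dualc R e dual_bracket).

Lemma functional_box : functional (CT s T) (CT_norm s T) dualX (dom t0 e) ellX.
Proof.
apply: functional_ell => //; [exact: rI_box|exact: boxX_01|exact: bracket_boxX|exact: dual_bracket_ge0].
Qed.

Lemma dualX_sqr : dualX ^+ 2 = dual_bracket ^+ 2 * (N / 10 * m).
Proof.
have m0' := m0.
rewrite /dualc sqr_sqrtr; last first.
  by apply: Rintegral_ge0 => xi _; rewrite mulr_ge0 ?sqr_ge0// box_ge0.
rewrite RintegralZl//; last exact: rI_box.
rewrite int_box; congr (_ * (_ * _)).
  by rewrite (_ : 11 / 10 * N - N = N / 10) ?ger0_norm ?divr_ge0 ?sqr_ge0//; field.
by rewrite ger0_norm; lra.
Qed.

Lemma mC_dataC tau k : mC (dataC m tau k : P2 -> C).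
Proof. exact: fld_mt 0 (fld_data m10 tau k). Qed.

Lemma int_chi : Rintegral mu2 setT (chi m) = N * m / 2.
Proof.
have m0' := m0; have N0 : 0 <= N by rewrite sqr_ge0.
rewrite RintegralD//; [|exact: rI_box|exact: rI_box].
rewrite !int_box sub0r opprK (ger0_norm (ltW m0)).
rewrite (_ : 11 / 10 * N - N = N / 10); last by field.
rewrite (_ : 11 / 5 * N - 2 * N = N / 5); last by field.
rewrite (_ : 3 * m - m = 2 * m); last by ring.
by rewrite !ger0_norm ?divr_ge0 ?mulr_ge0 ?(ltW m0)//; field.
Qed.

Definition data_bound : R := Num.sqrt (4 * (bracket_cst * N `^ s) ^+ 2 * (N * m / 2)).

Lemma Hs_norm_data k : (Hs_norm s (dataC m 1 k) <= data_bound%:E)%E.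
Proof.
have ic : rI mu2 (chi m) by apply: rID; exact: rI_box.
have -> : data_bound = Num.sqrt (Rintegral mu2 setT (fun xi => 4 * (bracket_cst * N `^ s) ^+ 2 * chi m xi)).
  by rewrite /data_bound RintegralZl// int_chi.
apply: Hs_norm_le; [exact: mC_dataC|exact: rIZ ic|].
move=> xi; rewrite /dataC (_ : 1%:C = 1 :> C)// mul1r.
have [e0|n0] := eqVneq (chi m xi) 0.
  by rewrite e0 (_ : 0%:C = 0 :> C)// mul0r n1_0 mulr0 mulr0 expr0n.
have c := chi_ge0 m xi; have c1 := chi_le1 m10 xi.
have b1 := bracket_chi n0; have b2 := n1_chi_pol m k xi.
have h := ler_pM (powR_ge0 _ _) (n1_ge0 _) b1 b2.
have a0 : 0 <= bracket_cst * N `^ s by rewrite mulr_ge0 ?powR_ge0.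
have p1 : 0 <= (1 + enorm xi) `^ s * n1 ((chi m xi)%:C * pol k xi) by rewrite mulr_ge0 ?powR_ge0 ?n1_ge0.
have p2 : 0 <= bracket_cst * N `^ s * (chi m xi * 2) by rewrite mulr_ge0// mulr_ge0.
have : ((1 + enorm xi) `^ s * n1 ((chi m xi)%:C * pol k xi)) ^+ 2 <= (bracket_cst * N `^ s * (chi m xi * 2)) ^+ 2.
  by rewrite ler_sqr ?nnegrE.
move/le_trans; apply.
have -> : (bracket_cst * N `^ s * (chi m xi * 2)) ^+ 2 = 4 * (bracket_cst * N `^ s) ^+ 2 * (chi m xi * chi m xi) by ring.
by apply: ler_wpM2l; [rewrite mulr_ge0 ?sqr_ge0|exact: ler_piMr].
Qed.

Lemma Hs_norm0 : Hs_norm s (fun _ => 0) = 0%E :> \bar R.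
Proof.
have m0C : mC (fun _ : P2 => 0 : C) by exact: mC_cst.
have := Hs_norm_scale s 0 m0C; rewrite normr0 mul0e => <-.
by congr Hs_norm; apply/funext => xi; rewrite mulr0.
Qed.

Lemma data_Hs tau : state_Hs s (data m tau).
Proof.
split=> [nu|k].
  split; last by apply: aeW => xi; rewrite cJ0.
  split; first exact: mC_cst.
  by rewrite Hs_norm0 ltry.
rewrite component_data; split; first exact: mC_dataC.
have E : dataC m tau k = fun xi => tau%:C * dataC m 1 k xi.
  by apply/funext => xi; rewrite /dataC (_ : 1%:C = 1 :> C)// mul1r.
rewrite E Hs_norm_scale; last exact: mC_dataC.
rewrite lte_mul_pinfty ?lee_fin//; first exact: (le_lt_trans (Hs_norm_data k) (ltry _)).
Qed.

Definition data_norm : R := fine (state_norm s (data m 1)).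

Lemma state_norm_data1 : (state_norm s (data m 1) <= (data_bound + data_bound)%:E)%E.
Proof.
rewrite /state_norm big1 ?add0e; last by move=> nu _; exact: Hs_norm0.
rewrite !big_ord_recl big_ord0 adde0 !component_data EFinD.
by apply: leeD; exact: Hs_norm_data.
Qed.

Lemma state_norm_data tau : state_norm s (tau%:C *: data m 1) = (`|tau| * data_norm)%:E.
Proof.
rewrite state_norm_scale; [|by move=> nu; exact: mC_cst|by move=> k; rewrite component_data; exact: mC_dataC].
rewrite EFinM /data_norm fineK// ge0_fin_numE ?state_norm_ge0//.
exact: le_lt_trans state_norm_data1 (ltry _).
Qed.

Lemma data_norm_ge0 : 0 <= data_norm. Proof. by rewrite fine_ge0// state_norm_ge0. Qed.

Lemma data_norm_le : data_norm <= data_bound + data_bound.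
Proof.
rewrite -lee_fin /data_norm fineK; first exact: state_norm_data1.
by rewrite ge0_fin_numE ?state_norm_ge0//; exact: le_lt_trans state_norm_data1 (ltry _).
Qed.

(** The coefficient of [tau^2] in the expansion of [ell] along the solutions with
    data [tau f]. *)
Definition quad_coef : R := ellX (to_state (Amap T (wave (chi m))) (wave (chi m))).

Lemma iC_testf (g : P2 -> C) (K : R) : mC g -> (forall xi, n1 (g xi) <= K) ->
  iC mu2 (fun xi => testf t0 e xi * g xi) /\
  (forall xi, n1 (testf t0 e xi * g xi) <= 2 * K * e xi).
Proof.
move=> mg bg.
have b xi : n1 (testf t0 e xi * g xi) <= 2 * K * e xi.
  apply: (le_trans (n1M _ _)); apply: (@le_trans _ _ ((e xi * 2) * K)).
    apply: ler_pM; rewrite ?n1_ge0//; apply: (le_trans (n1M _ _)).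
    by rewrite n1R (ger0_norm (box_ge0 _ _ _ _ _)) ler_wpM2l ?box_ge0 ?n1_cis.
  by rewrite le_eqVlt; apply/orP; left; apply/eqP; ring.
split=> //; apply: (iC_le _ (rIZ (2 * K) (rI_box _ _ _ _)) b).
by apply: mCM => //; apply: mC_testf; exact: rI_box.
Qed.

Lemma fld_Amap_wave nu : exists K, fld (Zset m) K (Amap T (wave (chi m)) nu).
Proof.
eexists; exact: (lp1 (lp_Amap (lines_ae _ _) (@lines_opp _ _ _) (Zset_0 m) T0
  (fun k => lp_refl0 (fld_wave m10 k)) nu)).
Qed.

Lemma quad_coef_ge : t0 <= 1 / 12 -> 24 / t0 <= N -> kappa0 * (t0 / 40 * N) * (N / 10 * m) <= quad_coef.
Proof.
move=> t12 Nt; have [K hK] := fld_Amap_wave ord0.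
have [i b] := iC_testf (fld_mt t0 hK) (fun xi => wbound_le xi (fld_b hK t0)).
have m0' := m0.
have -> : kappa0 * (t0 / 40 * N) * (N / 10 * m) =
    Rintegral mu2 setT (fun xi => kappa0 * (t0 / 40 * N) * e xi).
  rewrite RintegralZl//; last exact: rI_box.
  rewrite int_box; congr (_ * (_ * _)).
    by rewrite (_ : 11 / 10 * N - N = N / 10) ?ger0_norm ?divr_ge0 ?sqr_ge0//; field.
  by rewrite ger0_norm; lra.
have -> : quad_coef = Rintegral mu2 setT (fun xi => - 1 * complex.Re (testf t0 e xi * Amap T (wave (chi m)) ord0 t0 xi)).
  by rewrite RintegralZl ?mulN1r//; exact: i.1.
apply: le_Rintegral => //; [exact: rIZ (rI_box _ _ _ _)|exact: rIZ i.1|].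
move=> xi _; rewrite mulN1r /testf.
have [e0|n0] := eqVneq (e xi) 0.
  by rewrite e0 (_ : 0%:C = 0 :> C)// !mul0r mulr0 cRe0 oppr0.
have e1 : e xi = 1 by case: (boxX_01 xi) n0 => -> //; rewrite eqxx.
by rewrite e1 (_ : 1%:C = 1 :> C)// mul1r mulr1; exact: Amap_data_ge.
Qed.

(** The solution differs from the free wave at third order, so its potential
    differs at fourth order from that created by the free wave. *)
Lemma small_solutions : exists (c4 d : R), 0 < d /\ forall tau, 0 < `|tau| < d ->
  exists2 u, smooth_solution T (data m tau) u & `|ellX u - tau ^+ 2 * quad_coef| <= c4 * tau ^+ 4.
Proof.
pose K1 := Kdata m; have K10 : 0 < K1 by exact: Kdata_gt0.
pose c := 8 * cN T * (16 * K1) ^+ 2 + 1.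
have cN0 := cN_ge0 T0; have cA0 := cA_ge0 T0.
have c0' : 0 < c by rewrite ltr_wpDl// mulr_ge0 ?sqr_ge0// mulr_ge0.
pose c4 := 32 * cA T * cN T * (16 * K1) ^+ 4.
pose I := Rintegral mu2 setT e.
exists (2 * c4 * I), (Num.min 1 c^-1); split; first by rewrite lt_min ltr01 invr_gt0.
move=> tau /andP[tau0]; rewrite lt_min => /andP[tau1 tau2].
have t2 : tau ^+ 2 = `|tau| ^+ 2 by rewrite real_normK ?num_real.
have K0 : 0 < `|tau| * K1 by rewrite mulr_gt0.
have hk : 8 * cN T * (16 * (`|tau| * K1)) ^+ 2 <= 1.
  have -> : 8 * cN T * (16 * (`|tau| * K1)) ^+ 2 = (c - 1) * `|tau| ^+ 2 by rewrite /c; ring.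
  have h1 : `|tau| ^+ 2 <= `|tau| by rewrite expr2 ler_piMr// ltW.
  have h2 : c * `|tau| <= 1 by rewrite mulrC -ler_pdivlMr// div1r ltW.
  have h3 : c * `|tau| ^+ 2 <= c * `|tau| by rewrite ler_wpM2l// ltW.
  by rewrite mulrBl mul1r; have := sqr_ge0 `|tau|; lra.
have Z_ae := @lines_ae R [:: 0; N; 11 / 10 * N; 2 * N; 11 / 5 * N] [:: 0; m; 2 * m; 3 * m].
have Z_opp := @lines_opp R [:: 0; N; 11 / 10 * N; 2 * N; 11 / 5 * N] [:: 0; m; 2 * m; 3 * m].
have [psi [hlp hsol]] := smooth_solution_exists Z_ae Z_opp (Zset_0 m) T0 K0
  (fld_data m10 tau) erefl hk.
exists (to_state (Amap T psi) psi) => //.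
set k := 16 * (`|tau| * K1) in hlp hk.
have hA := lp_Amap Z_ae Z_opp (Zset_0 m) T0 hlp ord0.
have EA xi : Amap T (freemap (dataC m tau)) ord0 t0 xi = (tau ^+ 2)%:C * Amap T (wave (chi m)) ord0 t0 xi.
  by apply: (Amap_scale Z_ae Z_opp (Zset_0 m) T (fld_wave m10)) => i t z; exact: freemap_data.
have [iA bA] := iC_testf (fld_mt t0 (lp1 hA)) (fun xi => wbound_le xi (fld_b (lp1 hA) t0)).
have [iB bB] := iC_testf (fld_mt t0 (lp2 hA)) (fun xi => wbound_le xi (fld_b (lp2 hA) t0)).
have [K hK] := fld_Amap_wave ord0.
have [iW bW] := iC_testf (fld_mt t0 hK) (fun xi => wbound_le xi (fld_b hK t0)).
have mD : mC (fun xi : P2 => Amap T psi ord0 t0 xi - Amap T (freemap (dataC m tau)) ord0 t0 xi).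
  by apply: mCB; [exact: fld_mt t0 (lp1 hA)|exact: fld_mt t0 (lp2 hA)].
have [iD bD] := iC_testf mD (fun xi => wbound_le xi (lpd hA t0)).
have -> : ellX (to_state (Amap T psi) psi) - tau ^+ 2 * quad_coef =
  - complex.Re (cint mu2 (fun xi => testf t0 e xi *
     (Amap T psi ord0 t0 xi - Amap T (freemap (dataC m tau)) ord0 t0 xi))).
  have -> : cint mu2 (fun xi => testf t0 e xi *
     (Amap T psi ord0 t0 xi - Amap T (freemap (dataC m tau)) ord0 t0 xi)) =
     cint mu2 (fun xi => testf t0 e xi * Amap T psi ord0 t0 xi) -
     (tau ^+ 2)%:C * cint mu2 (fun xi => testf t0 e xi * Amap T (wave (chi m)) ord0 t0 xi).
    rewrite -cintZ//.
    have iZ := iCZ (tau ^+ 2)%:C iW.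
    rewrite -cintB//; apply: eq_cint => xi; rewrite EA.
    by move: (testf _ _ _) (Amap _ _ _ _ _) (Amap _ _ _ _ _) (_%:C) => x y z w; ring.
  have ReL (z w : C) (x : R) :
      - complex.Re z - x * - complex.Re w = - complex.Re (z - x%:C * w).
    by rewrite !ReImE; ring.
  exact: ReL.
rewrite normrN; apply: (le_trans (Re_n1 _)).
apply: (le_trans (n1_cint_le iD (rIZ _ (rI_box _ _ _ _)) bD)).
rewrite RintegralZl//; last exact: rI_box.
rewrite -/I le_eqVlt; apply/orP; left; apply/eqP.
have -> : tau ^+ 4 = `|tau| ^+ 4 by rewrite (exprM tau 2 2) (exprM _ 2 2) t2.
by rewrite /c4 /k; ring.
Qed.

(** The solutions are known to second order, and a C^2 map has only one expansion
    of second order along a line; its quadratic coefficient is bounded through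
    the bilinear map. *)
Lemma quadratic_bound (r rC M : R) (Phi : state R -> R -> state R) D1 B :
  0 < r -> 0 < rC -> flow_map s T r Phi ->
  (forall x, state_Hs s x -> (state_norm s x < rC%:E)%E ->
     frechet_derivative (state_Hs s) (state_norm s) (CT s T) (CT_norm s T) Phi x (D1 x)) ->
  frechet_derivative2 (state_Hs s) (state_norm s) (CT s T) (CT_norm s T) D1 0 B ->
  (forall h k, state_Hs s h -> state_Hs s k ->
     (CT_norm s T (B h k) <= M%:E * state_norm s h * state_norm s k)%E) ->
  2 * quad_coef <= dualX * (M * data_norm * data_norm).
Proof.
move=> r0 rC0 hPhi hF hB hM.
have Df tau : state_Hs s (tau%:C *: data m 1) by rewrite data_scale; exact: data_Hs.
pose r' := Num.min r rC.
have r'0 : 0 < r' by rewrite lt_min r0.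
have inr tau : `|tau| * data_norm < r' -> (state_norm s (tau%:C *: data m 1) < r%:E)%E.
  by rewrite state_norm_data lte_fin lt_min => /andP[].
have hD tau : `|tau| * data_norm < r' -> CT s T (Phi (tau%:C *: data m 1)).
  by move=> /inr h; have [] := hPhi _ (Df tau) h.
have hF' x : state_Hs s x -> (state_norm s x < r'%:E)%E ->
    frechet_derivative (state_Hs s) (state_norm s) (CT s T) (CT_norm s T) Phi x (D1 x).
  move=> h1 h2; apply: hF => //; apply: (lt_le_trans h2).
  by rewrite lee_fin ge_min lexx orbT.
have hl := functional_box.
have [a0 [a1 [a2 [ha hexp]]]] := taylor_line hl data_norm_ge0 Df state_norm_data r'0 hD hF' hB hM.
have [c4 [d4 [d40 hsol]]] := small_solutions.
have k1 : 0 < data_norm + 1 by rewrite ltr_wpDl// data_norm_ge0.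
have hh tau : 0 < `|tau| < d4 -> `|tau| * data_norm < r' ->
    `|ellX (Phi (tau%:C *: data m 1)) - tau ^+ 2 * quad_coef| <= c4 * tau ^+ 4.
  move=> h1 h2; have [u hu] := hsol tau h1.
  have [hc huniq] := hPhi _ (Df tau) (inr _ h2).
  have z : CT_norm s T (Phi (tau%:C *: data m 1) - u) = 0%E by apply: huniq; rewrite data_scale.
  have Du : dom t0 e u by apply: (functional_sub hl); exact: (hu.1 s).
  have DP : dom t0 e (Phi (tau%:C *: data m 1)) by apply: (functional_sub hl).
  have := functional_bound hl (functionalB_dom hl DP Du) (_ : _ <= 0%:E)%E.
  rewrite z mulr0 lexx => /(_ isT); rewrite (functionalB hl DP Du) => h3.
  have -> : ellX (Phi (tau%:C *: data m 1)) = ellX u.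
    apply/eqP; rewrite -subr_eq0 -normr_eq0 eq_le h3 normr_ge0//.
  by [].
(* Adding the values at t and - t removes the linear term of the expansion. *)
have [q1 q2] : 2 * a0 = 0 /\ a2 - 2 * quad_coef = 0.
  apply: (quad_limit (C := 2 * c4)) => ee ee0.
  have [d d0 hd] := hexp (ee / 2) (divr_gt0 ee0 (ltr0n _ 2)).
  exists (Num.min d (Num.min d4 (r' / (data_norm + 1)))).
    by rewrite !lt_min d0 d40 divr_gt0.
  move=> t /andP[tp]; rewrite !lt_min => /andP[t1 /andP[t2 t3]].
  have tn : `|t| = t by rewrite gtr0_norm.
  have small : t * data_norm < r'.
    by move: t3; rewrite ltr_pdivlMr// mulrDr mulr1; apply: le_lt_trans; rewrite lerDl ltW.
  have A1 := hd t; have A2 := hd (- t); have B1 := hh t; have B2 := hh (- t).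
  rewrite normrN tn in A2 B2; rewrite tn in A1 B1.
  have {}A1 := A1 t1; have {}A2 := A2 t1.
  have tt : 0 < t < d4 by rewrite tp.
  have {}B1 := B1 tt small; have {}B2 := B2 tt small.
  rewrite sqrrN in A2 B2; rewrite (_ : (- t) ^+ 4 = t ^+ 4) in B2; last by ring.
  move: A1 A2 B1 B2.
  move: (ellX _) (ellX _) => y1 y2.
  have -> : (ee + 2 * c4 * t ^+ 2) * t ^+ 2 = ee * t ^+ 2 + 2 * (c4 * t ^+ 4) by ring.
  have -> : 2 * a0 + (a2 - 2 * quad_coef) * t ^+ 2 =
     (a0 + a1 * t + a2 / 2 * t ^+ 2) + (a0 + a1 * - t + a2 / 2 * t ^+ 2) - 2 * (t ^+ 2 * quad_coef) by field.
  move: (a0 + a1 * t + a2 / 2 * t ^+ 2) (a0 + a1 * - t + a2 / 2 * t ^+ 2) (t ^+ 2 * quad_coef) (c4 * t ^+ 4) => p q w v.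
  have -> : ee / 2 * t ^+ 2 = (ee * t ^+ 2) / 2 by field.
  move: (ee * t ^+ 2) => x.
  rewrite !ler_norml => /andP[? ?] /andP[? ?] /andP[? ?] /andP[? ?].
  by apply/andP; split; lra.
have E : 2 * quad_coef = a2 by lra.
by rewrite E (le_trans (ler_norm _)).
Qed.

(** The hypothesis compares powers of [m]: by [quad_coef_ge] the bound for the
    quadratic coefficient is of order [m^5], and the upper bound is of order
    [m^(9/2 + 2 s)]. *)
Lemma growth (M : R) : t0 <= 1 / 12 -> 24 / t0 <= N -> 2 * quad_coef <= dualX * (M * data_norm * data_norm) ->
  4 * (kappa0 * t0 / 400) ^+ 2 * m <= 32 / 5 * M ^+ 2 * bracket_cst ^+ 6 * m `^ (4 * s).
Proof.
move=> t12 Nt hq; have hL := quad_coef_ge t12 Nt.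
have N0 : 0 < N by rewrite exprn_gt0.
have k0 := kappa0_gt0; have [t00 _] := andP ht0.
pose P := N `^ s; have P0 : 0 < P by exact: powR_gt0.
have a0 : 0 <= bracket_cst by exact: powR_ge0.
have cX0 : 0 <= dualX by exact: sqrtr_ge0.
have b0 : 0 <= data_bound by exact: sqrtr_ge0.
have data_bound2 : data_bound ^+ 2 = 4 * (bracket_cst * P) ^+ 2 * (N * m / 2).
  rewrite sqr_sqrtr//; apply: mulr_ge0; first by apply: mulr_ge0 => //; exact: sqr_ge0.
  by apply: divr_ge0 => //; apply: mulr_ge0; exact: ltW.
have kk : data_norm * data_norm <= 4 * data_bound ^+ 2.
  have := ler_pM data_norm_ge0 data_norm_ge0 data_norm_le data_norm_le.
  by rewrite (_ : (data_bound + data_bound) * (data_bound + data_bound) = 4 * data_bound ^+ 2)//; ring.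
have h1 : 2 * (kappa0 * t0 / 400) * (N ^+ 2 * m) <= dualX * (`|M| * (4 * data_bound ^+ 2)).
  apply: (@le_trans _ _ (2 * quad_coef)).
    by apply: le_trans (ler_wpM2l (ler0n _ 2) hL); rewrite le_eqVlt; apply/orP; left; apply/eqP; field.
  apply: (le_trans hq); rewrite ler_wpM2l// -mulrA.
  apply: (@le_trans _ _ (`|M| * (data_norm * data_norm))).
    by rewrite ler_wpM2r ?ler_norm// mulr_ge0 ?data_norm_ge0.
  by rewrite ler_wpM2l.
have p1 : 0 <= 2 * (kappa0 * t0 / 400) * (N ^+ 2 * m).
  apply: mulr_ge0; last by apply: mulr_ge0; [exact: sqr_ge0|exact: ltW].
  exact: mulr_ge0 (ler0n _ 2) (divr_ge0 (mulr_ge0 (ltW k0) (ltW t00)) (ler0n _ 400)).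
(* Squaring removes the square roots from the norms. *)
have h2 := ler_pM p1 p1 h1 h1.
have P2E : P ^+ 2 = m `^ (4 * s).
  rewrite /P -(powR_mulrn 2 (powR_ge0 _ _)) -powRrM -(powR_mulrn 2 (ltW m0)) -powRrM.
  by congr (_ `^ _); ring.
have E2 : dualX * (`|M| * (4 * data_bound ^+ 2)) * (dualX * (`|M| * (4 * data_bound ^+ 2))) =
    32 / 5 * M ^+ 2 * bracket_cst ^+ 6 * P ^+ 2 * (N ^+ 3 * m ^+ 3).
  have -> : dualX * (`|M| * (4 * data_bound ^+ 2)) * (dualX * (`|M| * (4 * data_bound ^+ 2))) =
    dualX ^+ 2 * `|M| ^+ 2 * (16 * (data_bound ^+ 2) ^+ 2) by ring.
  rewrite dualX_sqr real_normK ?num_real// data_bound2 /dual_bracket -/P.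
  by field; rewrite gt_eqF.
have E1 : 2 * (kappa0 * t0 / 400) * (N ^+ 2 * m) * (2 * (kappa0 * t0 / 400) * (N ^+ 2 * m)) =
   4 * (kappa0 * t0 / 400) ^+ 2 * m * (N ^+ 3 * m ^+ 3) by ring.
move: h2; rewrite E1 E2 P2E ler_pM2r//.
by rewrite mulr_gt0// !exprn_gt0.
Qed.

End FixedFrequency.

End Conclusion.

Lemma power_lt_linear (R : realType) (s L C g : R) :
  s < 1 / 4 -> 0 <= C -> 0 < g ->
  exists m : R, [/\ 10 <= m, L <= m & C * m `^ (4 * s) < g * m].
Proof.
move=> hs C0 g0.
have p : 0 < 1 - 4 * s by lra.
have Cg0 : 0 <= C / g + 1 by apply: addr_ge0 => //; apply: divr_ge0 => //; exact: ltW.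
pose X := (C / g + 1) `^ (1 - 4 * s)^-1.
pose m := Num.max 10 (Num.max L X).
have [m10 mt mX] : [/\ 10 <= m, L <= m & X <= m].
  by rewrite /m !le_max !lexx /= ?orbT; split.
have m0 : 0 < m by lra.
exists m; split => //.
have E : m = m `^ (4 * s) * m `^ (1 - 4 * s).
  rewrite -powRD; last by rewrite (gt_eqF m0) implybT.
  by rewrite (_ : 4 * s + (1 - 4 * s) = 1) ?powRr1 ?ltW//; ring.
have P0 : 0 < m `^ (4 * s) by exact: powR_gt0.
have hX : C / g + 1 <= m `^ (1 - 4 * s).
  have -> : C / g + 1 = X `^ (1 - 4 * s).
    by rewrite /X -powRrM mulVf ?gt_eqF// powRr1.
  have X0 : 0 <= X by exact: powR_ge0.
  by apply: ge0_ler_powR; rewrite ?nnegrE //; exact: ltW.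
rewrite {2}E mulrCA mulrC ltr_pM2l// mulrC -ltr_pdivrMr//.
by apply: lt_le_trans hX; rewrite ltrDl.
Qed.

Close Scope complex_scope.
Close Scope classical_set_scope.
Unset Implicit Arguments.

Theorem theorem1p2 (R : realType) (s T : R) (hs : s < 1 / 4) (hT : 0 < T)
    (r : R) (hr : 0 < r) (Phi : state R -> R -> state R)
    (hPhi : flow_map s T r Phi) :
  ~ C2_at0 (state_Hs s) (state_norm s) (CT s T) (CT_norm s T) Phi.
Proof.
move=> [rC [D1 [D2 [rC0 hF hF2 _]]]].
have ten : 10 <= 10 :> R by [].
(* The zero state is the data scaled by 0, which gives its norm. *)
have e0 : (0 : state R) = real_complex R 0 *: data 10 1.
  by rewrite (_ : real_complex R 0 = 0)// scale0r.
have Hs0 : state_Hs s 0 by rewrite e0 data_scale; exact: data_Hs.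
have n0 : (state_norm s (0 : state R)%R < rC%:E)%E.
  by rewrite e0 state_norm_data// normr0 mul0r lte_fin.
have hB := hF2 0 Hs0 n0.
have [[_ [_ [M hM]]] _] := hB.
(* Within a time 1/12 a phase bounded by 6 turns by 1/2 at most. *)
pose t0 := Num.min T (1 / 12).
have ht0 : 0 < t0 <= T by rewrite lt_min hT divr_gt0//= ge_min lexx.
have t12 : t0 <= 1 / 12 by rewrite ge_min lexx orbT.
have [t00 _] := andP ht0.
have g0 : 0 < 4 * (kappa0 * t0 / 400) ^+ 2.
  apply: mulr_gt0; [exact: ltr0n|apply: exprn_gt0; apply: divr_gt0; last exact: ltr0n].
  by apply: mulr_gt0; [exact: kappa0_gt0|].
have C0 : 0 <= 32 / 5 * M ^+ 2 * bracket_cst s ^+ 6.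
  by apply: mulr_ge0; [apply: mulr_ge0; [lra|exact: sqr_ge0]|apply: exprn_ge0; exact: powR_ge0].
have [m [m10 mt mC]] := power_lt_linear (24 / t0) hs C0 g0.
have m1 : 1 <= m by lra.
have Nt : 24 / t0 <= m ^+ 2.
  apply: (le_trans mt); rewrite expr2 -{1}(mulr1 m).
  by apply: ler_wpM2l => //; lra.
have hq := quadratic_bound hT ht0 m10 hr rC0 hPhi hF hB hM.
have := growth hT ht0 m10 t12 Nt hq.
by rewrite leNgt mC.
Qed.
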